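(* Let $\boldsymbol r_1=(r_1^v,-1)$ with $r_1^v\ge0$ and let $\boldsymbol r_2=(r_2^v,r_2^e)\ge\max\{\boldsymbol r_1-2,-1\}$ be an integer pair with $r_2^v\ge2r_2^e$. Assume $$k\ge\max\{2r_1^v+2,\ 2r_2^v+3,\ 3r_2^e+6,\ 6[r_2^e=-1,r_2^v=1],\ 4[r_2^e=-1,r_2^v=0]\}.$$ Then the following finite element divdiv complex is exact: $$\mathbf{RT}\xrightarrow{\subset}\mathbb V^{\operatorname{curl}}_{k+1}\big((r_1^v+1,0);\mathbb R^2\big)\xrightarrow{\operatorname{sym}\operatorname{curl}}\mathbb V^{\operatorname{div}\operatorname{div}}_k\big((r_1^v,-1),\boldsymbol r_2;\mathbb S\big)\xrightarrow{\operatorname{div}\operatorname{div}}\mathbb V^{L^2}_{k-2}(\boldsymbol r_2)\to0.$$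
   Context: $\Omega\subset\mathbb R^2$ is a bounded, simply connected, Lipschitz polygonal domain and $\mathcal T_h$ is a conforming triangulation of $\Omega$. For each edge $e$ of $\mathcal T_h$ a unit normal $n$ and a unit tangent $t$ are fixed ($t$ obtained from $n$ by the same $90^\circ$ rotation on every edge). $\partial_n,\partial_t$ are directional derivatives; $\nabla^i$ is the collection of all $i$-th order partial derivatives. A degree of freedom (DoF) attached to a vertex or edge is single-valued for a piecewise polynomial if its values computed from all triangles containing that vertex or edge coincide. $\mathbb P_j$ denotes polynomials of degree $\le j$ ($\{0\}$ if $j<0$). Index ranges $i=a,\dots,b$ with $b<a$ are empty. For integer pairs $\boldsymbol r=(r^v,r^e)$, inequalities, maxima and addition of constants are componentwise. $[\text{statement}]$ is $1$ if the statement is true, $0$ otherwise. $\mathbb S$ = symmetric $2\times2$ matrices, $\boldsymbol x$ is the position vector, $\mathbf{RT}=\mathbb R^2+\boldsymbol x\mathbb R$. $\operatorname{curl}v=(\partial_{x_2}v,-\partial_{x_1}v)$ for scalar $v$; curl of a vector field and div of a matrix field are row-wise; $\operatorname{sym}\boldsymbol\tau=\frac12(\boldsymbol\tau+\boldsymbol\tau^{\intercal})$. On an edge, $\operatorname{tr}_2^{\operatorname{div}\operatorname{div}}(\boldsymbol\tau)=\partial_t(t^{\intercal}\boldsymbol\tau n)+n^{\intercal}\operatorname{div}\boldsymbol\tau$. $\mathbb V_k(\boldsymbol r)$ is the space of $u\in L^2(\Omega)$ with $u|_T\in\mathbb P_k(T)$ for all $T\in\mathcal T_h$ for which the following DoFs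 are single-valued: $D^\alpha u(v)$ for $|\alpha|\le r^v$ at every vertex $v$; and $\int_e\partial_n^\beta u\,q\,ds$ for $q\in\mathbb P_{k-2(r^v+1)+\beta}(e)$, $\beta=0,\dots,r^e$, on every edge $e$. $\mathbb V^{L^2}_k(\boldsymbol r)=\mathbb V_k(\boldsymbol r)$ and $\mathbb V^{\operatorname{curl}}_k(\boldsymbol r;\mathbb R^2)=\mathbb V_k(\boldsymbol r)\times\mathbb V_k(\boldsymbol r)$. $\mathbb V^{\operatorname{div}\operatorname{div}}_k((r_1^v,-1),\boldsymbol r_2;\mathbb S)$ is the space of $\boldsymbol\tau\in L^2(\Omega;\mathbb S)$ with $\boldsymbol\tau|_T\in\mathbb P_k(T;\mathbb S)$ for all $T$ for which the following DoFs are single-valued, at all vertices $v$ and edges $e$: - $\nabla^i\boldsymbol\tau(v)$, $i=0,\dots,r_1^v$; - $\nabla^j\operatorname{div}\operatorname{div}\boldsymbol\tau(v)$, $j=\max\{r_1^v-1,0\},\dots,r_2^v$; - $\int_e n^{\intercal}\boldsymbol\tau n\,q\,ds$, $q\in\mathbb P_{k-2(r_1^v+1)}(e)$; - $\int_e\operatorname{tr}_2^{\operatorname{div}\operatorname{div}}(\boldsymbol\tau)\,q\,ds$, $q\in\mathbb P_{k-1-2r_1^v}(e)$; - $\int_e\partial_n^i(\operatorname{div}\operatorname{div}\boldsymbol\tau)\,q\,ds$, $q\in\mathbb P_{k-2(r_2^v+2)+i}(e)$, $i=0,\dots,r_2^e$. (No continuity of $t^{\intercal}\boldsymbol\tau n$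 across edges is imposed.) A complex is exact if at every space the image of the incoming map equals the kernel of the outgoing one (the first map being the inclusion). *)

(* Defs.v *)
From HB Require Import structures.
From mathcomp Require Import all_boot all_order all_algebra.
From mathcomp Require Import all_classical all_reals all_analysis.
From mathcomp Require mpoly.
(* The notations of mpoly clash with those of MathComp-Analysis. *)
Import -(notations) mpoly.

Set Implicit Arguments.
Unset Strict Implicit.
Unset Printing Implicit Defensive.

Import Order.TTheory GRing.Theory Num.Theory.
Import numFieldNormedType.Exports.

Local Open Scope classical_set_scope.
Local Open Scope ring_scope.

Section Plane.
Variable R : realType.
Local Notation plane := 'rV[R]_2.

(* The norm `|x| of 'rV[R]_2 is the sup norm, hence this explicit
   Euclidean inner product. *)
Definition dot (u v : plane) : R := \sum_(i < 2) u 0 i * v 0 i.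

(* Counterclockwise rotation by 90 degrees. *)
Definition rot90 (u : plane) : plane :=
  \row_(i < 2) (if i == 0 then - u 0 1 else u 0 0).

Definition segment (a b : plane) : set plane :=
  [set a + s *: (b - a) | s in `[(0 : R), 1]].

Definition frontier (A : set plane) : set plane := closure A `\` interior A.

Definition path_in (A : set plane) (g : R -> plane) : Prop :=
  {within `[(0 : R), 1], continuous g} /\
  forall s, s \in `[(0 : R), 1] -> A (g s).

Definition path_connected (A : set plane) : Prop :=
  forall x y, A x -> A y -> exists g, [/\ path_in A g, g 0 = x & g 1 = y].

Definition null_homotopic_in (A : set plane) (g : R -> plane) : Prop :=
  exists H : R * R -> plane,
    [/\ {within `[(0 : R), 1] `*` `[(0 : R), 1], continuous H},
        forall s t, s \in `[(0 : R), 1] -> t \in `[(0 : R), 1] -> A (H (s, t)),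
        forall s, s \in `[(0 : R), 1] -> H (s, 0) = g s /\ H (s, 1) = g 0 &
        forall t, t \in `[(0 : R), 1] -> H (0, t) = g 0 /\ H (1, t) = g 0].

Definition simply_connected (A : set plane) : Prop :=
  [/\ A !=set0, path_connected A &
      forall g, path_in A g -> g 0 = g 1 -> null_homotopic_in A g].

Definition lipschitz_domain (A : set plane) : Prop :=
  forall x, frontier A x ->
  exists (e : plane) (phi : R -> R) (r : R),
    [/\ dot e e = 1, [lipschitz phi s | s in [set: R]], 0 < r &
        forall y, ball x r y -> (A y <-> phi (dot y (rot90 e)) < dot y e)].

Definition polygonal (A : set plane) : Prop :=
  exists s : seq (plane * plane),
    frontier A = [set x | exists2 ab, ab \in s & segment ab.1 ab.2 x].

End Plane.

Section Triangulation.
Variable R : realType.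

Record mesh := Mesh {
  vertex : finType;
  triangle : finType;
  pos : vertex -> 'rV[R]_2;
  verts : triangle -> {set vertex} }.

Variable M : mesh.
Implicit Types (S : {set vertex M}) (K L : triangle M) (a b v : vertex M).

Definition hull S : set 'rV[R]_2 :=
  [set x | exists c : vertex M -> R,
     [/\ forall v, 0 <= c v, \sum_(v in S) c v = 1 &
         x = \sum_(v in S) c v *: pos v]].

Definition affinely_independent S : Prop :=
  forall c : vertex M -> R,
    \sum_(v in S) c v = 0 -> \sum_(v in S) c v *: pos v = 0 ->
    forall v, v \in S -> c v = 0.

Record conforming_triangulation (Omega : set 'rV[R]_2) : Prop := {
  pos_inj : injective (@pos M);
  verts_inj : injective (@verts M);
  verts_cover : forall v, exists K, v \in verts K;
  verts_card : forall K, #|verts K| = 3%N;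
  verts_indep : forall K, affinely_independent (verts K);
  (* two closed triangles meet in the hull of their common vertices, i.e. in
     nothing, in a common vertex, or in a common edge *)
  verts_conforming : forall K L,
    hull (verts K) `&` hull (verts L) = hull (verts K :&: verts L);
  triangles_cover : closure Omega = \bigcup_K hull (verts K) }.

Definition edge_of a b K : bool := (a != b) && ([set a; b]%SET \subset verts K).

Definition unit_normals (nu : {set vertex M} -> 'rV[R]_2) : Prop :=
  forall a b K, edge_of a b K ->
    dot (nu [set a; b]%SET) (nu [set a; b]%SET) = 1 /\
    dot (nu [set a; b]%SET) (pos b - pos a) = 0.

End Triangulation.

Section Polynomials.
Variable R : realType.
Local Notation plane := 'rV[R]_2.
Local Notation pol := (mpoly 2 R).
Implicit Types (p : pol) (w : 'rV[pol]_2) (tau : 'M[pol]_2).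

(* mmeasure mdeg p is 1 + the degree of p, and 0 if p = 0. *)
Definition deg_le (j : int) p : bool :=
  (p == 0) || ((mmeasure mdeg p)%:Z <= j + 1).

Definition peval p (x : plane) : R := meval (fun i => x 0 i) p.

Definition dirder (d : plane) p : pol := \sum_(i < 2) d 0 i *: mderiv i p.

Definition edge_int (a b : plane) p : R :=
  Num.sqrt (dot (b - a) (b - a)) *
  \int[lebesgue_measure]_(s in `[(0 : R), 1]) peval p (a + s *: (b - a)).

Definition curl p : 'rV[pol]_2 :=
  \row_(j < 2) (if j == 0 then mderiv 1 p else - mderiv 0 p).

Definition curlv w : 'M[pol]_2 := \matrix_(i < 2, j < 2) curl (w 0 i) 0 j.

Definition symm tau : 'M[pol]_2 :=
  \matrix_(i < 2, j < 2) ((2^-1 : R) *: (tau i j + tau j i)).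

Definition symcurl w : 'M[pol]_2 := symm (curlv w).

Definition divv w : pol := \sum_(j < 2) mderiv j (w 0 j).

Definition divm tau : 'rV[pol]_2 := \row_(i < 2) divv (row i tau).

Definition divdiv tau : pol := divv (divm tau).

(* d^T tau e *)
Definition bil (d : plane) tau (e : plane) : pol :=
  \sum_(i < 2) \sum_(j < 2) (d 0 i * e 0 j) *: tau i j.

(* The tangent is t = rot90 n; the trace is even in t, so that the clockwise
   rotation would give the same trace. *)
Definition tr2 (n : plane) tau : pol :=
  dirder (rot90 n) (bil (rot90 n) tau n) + \sum_(i < 2) n 0 i *: divm tau 0 i.

(* The vector field x |-> a + c x. *)
Definition rt_field (a : plane) (c : R) : 'rV[pol]_2 :=
  \row_(i < 2) (mpolyC 2 (a 0 i) + c *: mpolyX R (mnm1 i)).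

End Polynomials.

(* An L^2 function (a class modulo equality almost everywhere) that is
   polynomial on every triangle is represented by the family of its
   restrictions to the triangles; no compatibility is required between
   neighbouring triangles. *)

Section Spaces.
Variables (R : realType) (M : mesh R) (nu : {set vertex M} -> 'rV[R]_2).
Local Notation pol := (mpoly 2 R).
Local Notation pw A := {ffun triangle M -> A}.

Definition piecewise (A B : Type) (f : A -> B) (u : pw A) : pw B :=
  [ffun K => f (u K)].

Definition vertex_single_valued (u : triangle M -> pol) : Prop :=
  forall (v : vertex M) (K L : triangle M), v \in verts K -> v \in verts L ->
    peval (u K) (pos v) = peval (u L) (pos v).

(* f n p is the integrand associated with the unit normal n of the edge and the
   restriction p; the moments are taken against all q of degree at most j. *)
Definition edge_single_valued (A : Type) (f : 'rV[R]_2 -> A -> pol) (j : int)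
    (u : triangle M -> A) : Prop :=
  forall (a b : vertex M) (K L : triangle M), edge_of a b K -> edge_of a b L ->
  forall q : pol, deg_le j q ->
    let n := nu [set a; b]%SET in
    edge_int (pos a) (pos b) (f n (u K) * q) =
    edge_int (pos a) (pos b) (f n (u L) * q).

Definition Vscal (k : int) (r : int * int) : set (pw pol) :=
  [set u | [/\ forall K, deg_le k (u K),
     forall al : multinom 2, (mdeg al)%:Z <= r.1 ->
       vertex_single_valued (fun K => mderivm al (u K)) &
     forall be : nat, be%:Z <= r.2 ->
       edge_single_valued (fun n => iter be (dirder n))
         (k - 2 * (r.1 + 1) + be%:Z) u]].

Definition VL2 (k : int) (r : int * int) : set (pw pol) := Vscal k r.

Definition Vcurl (k : int) (r : int * int) : set (pw 'rV[pol]_2) :=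
  [set v | forall i, Vscal k r (piecewise (fun w : 'rV[pol]_2 => w 0 i) v)].

Definition Vdivdiv (k r1v : int) (r2 : int * int) : set (pw 'M[pol]_2) :=
  [set tau |
    [/\ forall K, (tau K)^T = tau K,
        forall K i j, deg_le k (tau K i j) &
    [/\ forall al : multinom 2, (mdeg al)%:Z <= r1v ->
          forall i j, vertex_single_valued (fun K => mderivm al (tau K i j)),
        forall al : multinom 2,
          Num.max (r1v - 1) 0 <= (mdeg al)%:Z -> (mdeg al)%:Z <= r2.1 ->
          vertex_single_valued (fun K => mderivm al (divdiv (tau K))),
        edge_single_valued (fun n t => bil n t n) (k - 2 * (r1v + 1)) tau,
        edge_single_valued (@tr2 R) (k - 1 - 2 * r1v) tau &
        forall i : nat, i%:Z <= r2.2 ->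
          edge_single_valued (fun n t => iter i (dirder n) (divdiv t))
            (k - 2 * (r2.1 + 2) + i%:Z) tau]]].

Definition RT : set (pw 'rV[pol]_2) :=
  [set v | exists a c, v = [ffun=> rt_field a c]].

End Spaces.

Arguments piecewise {R} M {A B} f u.
Arguments RT {R} M _.

(* Exactness at B of A --f--> B --g--> W. *)
Definition exact_at (U V : Type) (W : nmodType) (f : U -> V) (g : V -> W)
    (A : set U) (B : set V) : Prop :=
  f @` A = B `&` g @^-1` [set 0].

(* Main.v *)
Require Import Defs.
From HB Require Import structures.
From mathcomp Require Import all_boot all_order all_algebra.
From mathcomp Require Import all_classical all_reals all_analysis.
From mathcomp Require mpoly.
Import -(notations) mpoly.
From mathcomp Require Import ring lra zify.
Import Order.TTheory GRing.Theory Num.Theory.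
Import numFieldNormedType.Exports.
Local Open Scope classical_set_scope.
Local Open Scope ring_scope.

(** The inclusions of the complex and the exactness at the first space are local
    computations. The traces n^T tau n and tr2 of a symmetric curl on an edge are,
    up to sign, the first derivative of the normal part and the second derivative
    of the tangential part of the potential along the edge
    (gtr_symcurl, ttr_symcurl), and symcurl is of finite type: its kernel is RT,
    and an element of RT is determined by its jet of order one at a point, or by
    its restriction to an edge. Edge moments together with vertex jets amount to
    equality of the traces (moments_eq).

    Exactness at the middle space. On each triangle a field in the kernel of
    divdiv is the symmetric curl of a polynomial potential, unique up to RT. At a
    common vertex two such potentials differ by an element of RT up to a flat
    remainder, and at both ends of a common edge this element is the same. One
    obtains an RT-valued cocycle on the triangles, indexed by pairs of triangles
    that meet. As the domain is simply connected with a Lipschitz boundary, the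
    cocycle splits (cocycle_split): sum its values along paths; loops contribute
    nothing because they are null-homotopic, and the Lipschitz charts make the
    domain connected near its boundary vertices. Correcting the potentials by the
    splitting makes them match.

    Exactness at the last space. Given u, choose on each triangle a polynomial
    field with double divergence u, and correct it by the symmetric curl of a
    polynomial w so as to realize common vertex jets and common edge traces.
    The jets of w exist because the complex is exact on jets
    (symcurl_exact_jet), the edge traces of w are obtained by integration
    (edge_transport), and w itself by interpolation (triangle_interp), provided
    that the integration around the triangle closes up. It does so up to an
    element of RT, and the edge data contain enough freedom to change this defect
    by any element of RT, with opposite signs on the two sides of the edge. That
    all defects can be removed at once is a discrete statement, dual to the
    injectivity of the boundary map from triangles to edges. The latter holds in
    the plane because a chain of triangles without boundary would have zero area
    (boundary_inj). *)

Set Implicit Arguments.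
Unset Strict Implicit.
Unset Printing Implicit Defensive.

(** * Bivariate polynomials: degrees and antiderivatives *)

Section TwoIndices.

Lemma ord2_cases (i : 'I_2) : i = 0 \/ i = 1.
Proof.
by case: i => [[|[|//]] lti]; [left | right]; apply: val_inj.
Qed.

Lemma ord2_ind (P : 'I_2 -> Prop) : P 0 -> P 1 -> forall i, P i.
Proof. by move=> P0 P1 i; case: (ord2_cases i) => ->. Qed.

Lemma sum_ord2 (V : nmodType) (F : 'I_2 -> V) : \sum_(i < 2) F i = F 0 + F 1.
Proof.
rewrite !big_ord_recl big_ord0 addr0.
by congr (F _ + F _); apply: val_inj.
Qed.

Lemma eq_plane (R : realType) (u v : 'rV[R]_2) :
  u 0 0 = v 0 0 -> u 0 1 = v 0 1 -> u = v.
Proof.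
move=> e0 e1; apply/matrixP => i j; rewrite ord1.
by elim/ord2_ind: j.
Qed.

End TwoIndices.

Section Polys.
Variable R : realType.
Local Notation plane := 'rV[R]_2.
Local Notation pol := (mpoly 2 R).
Local Notation Xv i := (mpolyX R (mnm1 (i : 'I_2))).
Implicit Types (p q : pol) (a b v : plane) (i j : 'I_2).

Definition msz p : nat := mmeasure (@mdeg 2) p.

Lemma deg_leE (k : nat) p : deg_le k%:Z p = (msz p <= k.+1)%N.
Proof.
rewrite /deg_le /msz; case: eqVneq => [->|_] /=; first by rewrite mmeasure0.
by rewrite -PoszD addn1 lez_nat.
Qed.

Lemma mszD n p q : (msz p <= n -> msz q <= n -> msz (p + q)%R <= n)%N.
Proof.
move=> hp hq; apply: leq_trans (mmeasureD_le _ _ _) _.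
by rewrite geq_max hp hq.
Qed.

Lemma mszN p : msz (- p)%R = msz p.
Proof. exact: mmeasureN. Qed.

Lemma mszB n p q : (msz p <= n -> msz q <= n -> msz (p - q)%R <= n)%N.
Proof. by move=> hp hq; apply: mszD; rewrite ?mszN. Qed.

Lemma mszZ n (c : R) p : (msz p <= n -> msz (c *: p)%R <= n)%N.
Proof. by move=> hp; apply: leq_trans (mmeasureZ_le _ _ _) hp. Qed.

Lemma msz0 : msz (0 : pol) = 0%N.
Proof. exact: mmeasure0. Qed.

Lemma msz_sum (I : Type) (r : seq I) (P : pred I) (F : I -> pol) n :
  (forall l, P l -> msz (F l) <= n)%N -> (msz (\sum_(l <- r | P l) F l)%R <= n)%N.
Proof.
move=> h; elim/big_rec: _ => [|l p Pl hp]; first by rewrite msz0.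
by apply: mszD => //; apply: h.
Qed.

Lemma mszC n (c : R) : (0 < n -> msz (mpolyC 2 c) <= n)%N.
Proof. by rewrite /msz mmeasureC; case: (_ != _). Qed.

Lemma mszX i : msz (Xv i) = 2%N.
Proof. by rewrite /msz mmeasureX /= mdeg1. Qed.

Lemma mszM m n p q : (msz p <= m.+1 -> msz q <= n.+1 ->
  msz (p * q)%R <= (m + n).+1)%N.
Proof.
rewrite /msz => hp hq.
have [->|nz_p] := eqVneq p 0; first by rewrite mul0r mmeasure0.
have [->|nz_q] := eqVneq q 0; first by rewrite mulr0 mmeasure0.
rewrite (msizeM nz_p nz_q); apply: (@leq_trans (m.+1 + n.+1).-1); last by rewrite addnS.
by rewrite -!subn1 leq_sub2r// leq_add.
Qed.

Lemma mszM_exp m n p : (msz p <= m.+1 -> msz (p ^+ n)%R <= (n * m).+1)%N.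
Proof.
move=> hp; elim: n => [|n IH]; first by rewrite expr0 mszC.
by rewrite exprS mulSn; apply: mszM.
Qed.

Lemma msz_mderiv n i p : (msz p <= n.+1 -> msz (mderiv i p) <= n)%N.
Proof.
move=> hp; rewrite /mderiv big_seq; apply: msz_sum => m hm.
have [mi0|mi0] := eqVneq (m i) 0%N; first by rewrite mi0 mul0r scale0r msz0.
apply: mszZ; rewrite /msz mmeasureX /=.
have := msize_mdeg_lt hm; rewrite -/(msz p) => hlt.
have em : mnm_add (mnm_sub m (mnm1 i)) (mnm1 i) = m.
  apply/mnmP => j; rewrite mnmDE mnmBE mnm1E.
  by case: eqVneq => [<-|_] /=; [rewrite subnK// lt0n | rewrite subn0 addn0].
have := mdegD (mnm_sub m (mnm1 i)) (mnm1 i); rewrite em mdeg1; lia.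
Qed.

Lemma pol_ind (P : pol -> Prop) :
  (forall c, P (mpolyC 2 c)) -> (forall i p, P p -> P (Xv i * p)) ->
  (forall p q, P p -> P q -> P (p + q)) -> forall p, P p.
Proof.
move=> PC PX PD; elim/mpolyind => [|c m p _ _ Pp]; first by rewrite -(mpolyC0 2).
apply: PD => //; rewrite -mul_mpolyC mpolyXE_id.
have Pn i n q : P q -> P (Xv i ^+ n * q).
  by elim: n => [|n IH] Pq; rewrite ?expr0 ?mul1r// exprS -mulrA; apply/PX/IH.
rewrite big_ord_recl big_ord_recl big_ord0.
by rewrite mulr1 mulrC -mulrA; apply: (Pn); apply: (Pn).
Qed.

Lemma mderivXU i j : mderiv i (Xv j) = mpolyC 2 (i == j)%:R.
Proof.
rewrite mderivX mnm1E eq_sym; case: eqVneq => [->|_]; last by rewrite scale0r mpolyC0.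
rewrite scale1r mpolyC1 -mpolyX0; congr (@mpolyX _ _ _); apply/mnmP => l.
by rewrite mnmBE mnm0E subnn.
Qed.

Section Anti.
Variable (i : 'I_2) (p : pol).

Definition antider : pol :=
  \sum_(m <- msupp p) ((m i).+1%:R^-1 * mcoeff m p) *: mpolyX R (mnm_add m (mnm1 i)).

Lemma mderiv_antider : mderiv i antider = p.
Proof.
rewrite /antider raddf_sum /= {3}[p]mpolyE; apply: eq_bigr => m _.
rewrite mderivZ mderivX mnmDE mnm1E eqxx addn1 scalerA.
rewrite mulrAC mulVf ?mul1r ?pnatr_eq0//; congr (_ *: @mpolyX _ _ _).
by apply/mnmP => l; rewrite mnmBE mnmDE addnK.
Qed.

Lemma msz_antider n : (msz p <= n -> msz antider <= n.+1)%N.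
Proof.
move=> hp; rewrite /antider big_seq; apply: msz_sum => m hm.
apply: mszZ; rewrite /msz mmeasureX /= mdegD mdeg1 addn1 ltnS.
exact: leq_trans (msize_mdeg_lt hm) hp.
Qed.

Lemma mderiv_antider_neq j : mderiv j p = 0 -> j != i -> mderiv j antider = 0.
Proof.
move=> hp ji; rewrite /antider raddf_sum /= big_seq big1// => m hm.
rewrite mderivZ mderivX mnmDE mnm1E eq_sym (negbTE ji) addn0.
have [->|mj0] := eqVneq (m j) 0%N; first by rewrite scale0r scaler0.
have em : mnm_add (mnm_sub m (mnm1 j)) (mnm1 j) = m.
  apply/mnmP => l; rewrite mnmDE mnmBE mnm1E.
  by case: eqVneq => [<-|_] /=; [rewrite subnK// lt0n | rewrite subn0 addn0].
have /(congr1 (mcoeff (mnm_sub m (mnm1 j)))) := hp.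
rewrite mcoeff_deriv em mcoeff0 => /eqP; rewrite mulrn_eq0 /=.
by move=> /eqP ->; rewrite mulr0 scale0r.
Qed.

End Anti.

(** An antiderivative f of p in the second variable already has the right
    second derivative; the defect q + d_0 f depends on the first variable only,
    and subtracting its antiderivative in that variable repairs it. *)
Lemma div_free_curl n p q : mderiv 0 p + mderiv 1 q = 0 ->
  (msz p <= n)%N -> (msz q <= n)%N ->
  exists phi, [/\ p = mderiv 1 phi, q = - mderiv 0 phi & (msz phi <= n.+1)%N].
Proof.
move=> hdiv hp hq; pose f := antider 1 p.
have f1 : mderiv 1 f = p by exact: mderiv_antider.
have hf : (msz f <= n.+1)%N by exact: msz_antider.
pose r := q + mderiv 0 f.
have r1 : mderiv 1 r = 0.
  by rewrite /r mderivD mderiv_comm f1 addrC.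
exists (f - antider 0 r); rewrite !mderivB f1 mderiv_antider.
rewrite (mderiv_antider_neq r1)// subr0; split=> //.
  by rewrite /r opprB addrK.
apply: mszB => //; apply: msz_antider; apply: mszD => //.
exact: msz_mderiv.
Qed.

Lemma mderiv_eq0 p : mderiv 0 p = 0 -> mderiv 1 p = 0 -> exists c, p = mpolyC 2 c.
Proof.
move=> p0 p1; exists (mcoeff mnm0 p).
apply/mpolyP => m; rewrite mcoeffC; have [->|m0] := eqVneq m mnm0.
  by rewrite mulr1.
rewrite mulr0.
have [i mi] : exists i, m i != 0%N.
  apply: contrapT => /forallNP h; move/negP: m0; apply; apply/eqP/mnmP => i.
  by apply/eqP; rewrite mnm0E; have /negP := h i; rewrite negbK.
have di : mderiv i p = 0 by elim/ord2_ind: i mi.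
have em : mnm_add (mnm_sub m (mnm1 i)) (mnm1 i) = m.
  apply/mnmP => l; rewrite mnmDE mnmBE mnm1E.
  by case: eqVneq => [<-|_] /=; [rewrite subnK// lt0n | rewrite subn0 addn0].
have /(congr1 (mcoeff (mnm_sub m (mnm1 i)))) := di.
by rewrite mcoeff_deriv em mcoeff0 => /eqP; rewrite mulrn_eq0 /= => /eqP.
Qed.

End Polys.

(** * Jets at a point and restriction to a line *)

Section Jets.
Variable R : realType.
Local Notation plane := 'rV[R]_2.
Local Notation pol := (mpoly 2 R).
Local Notation Xv i := (mpolyX R (mnm1 (i : 'I_2))).
Implicit Types (p q : pol) (a b v x : plane) (i : 'I_2) (r : {poly R}).

Lemma pevalD p q x : peval (p + q) x = peval p x + peval q x.
Proof. exact: mevalD. Qed.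
Lemma pevalN p x : peval (- p) x = - peval p x.
Proof. exact: mevalN. Qed.
Lemma pevalB p q x : peval (p - q) x = peval p x - peval q x.
Proof. exact: mevalB. Qed.
Lemma pevalM p q x : peval (p * q) x = peval p x * peval q x.
Proof. exact: mevalM. Qed.
Lemma pevalZ (c : R) p x : peval (c *: p) x = c * peval p x.
Proof. exact: mevalZ. Qed.
Lemma pevalC (c : R) x : peval (mpolyC 2 c) x = c.
Proof. exact: mevalC. Qed.
Lemma pevalX i x : peval (Xv i) x = x 0 i.
Proof. exact: mevalXU. Qed.
Lemma peval0 x : peval (0 : pol) x = 0.
Proof. exact: meval0. Qed.

Definition pevalE := (pevalD, pevalN, pevalM, pevalZ, pevalC, pevalX, peval0).

(** All derivatives of p of order less than n vanish at v; the recursion on n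
    turns the Leibniz rule and the chain rule into inductions. *)
Fixpoint flat v (n : nat) p : Prop :=
  if n is m.+1 then
    [/\ peval p v = 0, flat v m (mderiv 0 p) & flat v m (mderiv 1 p)]
  else True.

(** The univariate analogue, at the point c. *)
Fixpoint uflat (c : R) (n : nat) r : Prop :=
  if n is m.+1 then r.[c] = 0 /\ uflat c m r^`() else True.

Lemma flatS v n p : flat v n.+1 p -> flat v n p.
Proof.
elim: n p => [//|n IH] p /= [-> h0 h1].
by split=> //; apply: IH.
Qed.

Lemma flat_le v m n p : (m <= n)%N -> flat v n p -> flat v m p.
Proof.
move=> /subnK <-; elim: (n - m)%N => [//|j IH] h.
exact/IH/flatS.
Qed.

Lemma flat_mderiv v n i p : flat v n.+1 p -> flat v n (mderiv i p).
Proof. by move=> [_ h0 h1]; elim/ord2_ind: i. Qed.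

Lemma flat0 v n : flat v n 0.
Proof. by elim: n => [//|n IH] /=; rewrite !mderiv0 peval0. Qed.

Lemma flatD v n p q : flat v n p -> flat v n q -> flat v n (p + q).
Proof.
elim: n p q => [//|n IH] p q /= [p0 p1 p2] [q0 q1 q2].
by rewrite pevalD p0 q0 addr0 !mderivD; split=> //; apply: IH.
Qed.

Lemma flatZ v n (c : R) p : flat v n p -> flat v n (c *: p).
Proof.
elim: n p => [//|n IH] p /= [p0 p1 p2].
by rewrite pevalZ p0 mulr0 !mderivZ; split=> //; apply: IH.
Qed.

Lemma flatN v n p : flat v n p -> flat v n (- p).
Proof. by rewrite -scaleN1r; apply: flatZ. Qed.

Lemma flatB v n p q : flat v n p -> flat v n q -> flat v n (p - q).
Proof. by move=> hp hq; apply: flatD => //; apply: flatN. Qed.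

Lemma flatMr v n p q : flat v n q -> flat v n (p * q).
Proof.
elim: n p q => [//|n IH] p q hq; have [q0 q1 q2] := hq.
split; first by rewrite pevalM q0 mulr0.
  by rewrite mderivM; apply: flatD; apply: IH => //; apply: flatS.
by rewrite mderivM; apply: flatD; apply: IH => //; apply: flatS.
Qed.

Lemma flatMl v n p q : flat v n p -> flat v n (p * q).
Proof. by rewrite mulrC; apply: flatMr. Qed.

Lemma flatM v m n p q : flat v m p -> flat v n q -> flat v (m + n) (p * q).
Proof.
elim: m n p q => [|m IHm] n p q; first by rewrite add0n => _; apply: flatMr.
elim: n p q => [|n IHn] p q hp hq; first by rewrite addn0; apply: flatMl.
have dM i : flat v (m + n).+1 (mderiv i (p * q)).
  rewrite mderivM; apply: flatD.
    by rewrite -addnS; apply: IHm => //; apply: flat_mderiv.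
  by rewrite -addSn; apply: IHn => //; apply: flat_mderiv.
rewrite addSn addnS; split=> //.
by case: hp => p0 _ _; rewrite pevalM p0 mul0r.
Qed.

Lemma flatX v n p : peval p v = 0 -> flat v n (p ^+ n).
Proof.
move=> p0; elim: n => [//|n IH]; rewrite exprS -add1n.
by apply: flatM.
Qed.

Lemma flat_cond v n p :
  flat v n p <-> forall al, (mdeg al < n)%N -> peval (mderivm al p) v = 0.
Proof.
elim: n p => [|n IH] p; first by split.
split=> [[p0 p1 p2] al hal|h].
- have [->|al0] := eqVneq al mnm0; first by rewrite mderivm0m.
  have [i ai] : exists i, al i != 0%N.
    apply: contrapT => /forallNP h; move/negP: al0; apply; apply/eqP/mnmP => i.
    by apply/eqP; rewrite mnm0E; have /negP := h i; rewrite negbK.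
  have em : al = mnm_add (mnm1 i) (mnm_sub al (mnm1 i)).
    apply/mnmP => l; rewrite mnmDE mnmBE mnm1E.
    by case: eqVneq => [<-|_] /=; [rewrite subnKC// lt0n | rewrite subn0 add0n].
  rewrite em mderivmDm mderivmU1m.
  have /IH : flat v n (mderiv i p) by apply: flat_mderiv.
  by apply; move: hal; rewrite {1}em mdegD mdeg1 add1n.
- split; first by rewrite -[p]mderivm0m h// mdeg0.
    by apply/IH => al hal; rewrite -mderivmU1m -mderivmDm h// mdegD mdeg1.
  by apply/IH => al hal; rewrite -mderivmU1m -mderivmDm h// mdegD mdeg1.
Qed.

(** Induction on p: through X_i = (X_i - v_i) + v_i, the approximations of p of
    orders n and n + 1 give one of X_i p of order n + 1. *)
Lemma taylor v p n : exists c : pol, (msz c <= n)%N /\ flat v n (p - c).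
Proof.
elim/pol_ind: p n => [c|i p IH|p q IHp IHq] n.
- case: n => [|n]; first by exists 0; rewrite msz0.
  by exists (mpolyC 2 c); rewrite subrr mszC//; split=> //; apply: flat0.
- case: n => [|n]; first by exists 0; rewrite msz0.
  have [c [hc oc]] := IH n; have [d [hd od]] := IH n.+1.
  exists ((Xv i - mpolyC 2 (v 0 i)) * c + v 0 i *: d); split.
    apply: mszD; last exact: mszZ.
    case: n c hc {oc d hd od} => [|n] c hc.
      move: hc; rewrite leqn0 /msz mmeasure_poly_eq0 => /eqP ->.
      by rewrite mulr0 mmeasure0.
    apply: (@mszM _ 1 n) => //.
    by apply: mszB; rewrite ?mszX// mszC.
  have -> : Xv i * p - ((Xv i - mpolyC 2 (v 0 i)) * c + v 0 i *: d) =
     (Xv i - mpolyC 2 (v 0 i)) * (p - c) + v 0 i *: (p - d).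
    by rewrite -!mul_mpolyC; ring.
  apply: flatD; last exact: flatZ.
  apply: (@flatM v 1 n) => //.
  by split=> //; rewrite !pevalE subrr.
- have [c [hc oc]] := IHp n; have [d [hd od]] := IHq n.
  exists (c + d); split; first exact: mszD.
  by rewrite opprD addrACA; apply: flatD.
Qed.

(** The restriction of p to the line through a and b, in the parameter that is
    0 at a and 1 at b. *)
Definition res a b p : {poly R} :=
  mmap polyC (fun i => (a 0 i)%:P + (b 0 i - a 0 i)%:P * 'X) p.

HB.instance Definition _ a b := GRing.RMorphism.copy (res a b)
  (mmap polyC (fun i => (a 0 i)%:P + (b 0 i - a 0 i)%:P * 'X)).

Lemma resC a b (c : R) : res a b (mpolyC 2 c) = c%:P.
Proof. exact: mmapC. Qed.

Lemma resX a b i : res a b (Xv i) = (a 0 i)%:P + (b 0 i - a 0 i)%:P * 'X.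
Proof. by rewrite /res mmapX mmap1U. Qed.

Lemma resZ a b (c : R) p : res a b (c *: p) = c *: res a b p.
Proof. by rewrite -mul_mpolyC rmorphM /= resC mul_polyC. Qed.

Lemma resD a b p q : res a b (p + q) = res a b p + res a b q.
Proof. exact: rmorphD. Qed.
Lemma resB a b p q : res a b (p - q) = res a b p - res a b q.
Proof. exact: rmorphB. Qed.
Lemma resM a b p q : res a b (p * q) = res a b p * res a b q.
Proof. exact: rmorphM. Qed.

Lemma horner_res a b p s : (res a b p).[s] = peval p (a + s *: (b - a)).
Proof.
elim/pol_ind: p => [c|i p IH|p q IHp IHq].
- by rewrite resC hornerC pevalC.
- by rewrite resM hornerM IH resX pevalM pevalX !hornerE !mxE mulrC [s * _]mulrC mulrC.
- by rewrite resD hornerD IHp IHq pevalD.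
Qed.

Lemma res_at0 a b p : (res a b p).[0] = peval p a.
Proof. by rewrite horner_res scale0r addr0. Qed.

Lemma res_at1 a b p : (res a b p).[1] = peval p b.
Proof. by rewrite horner_res scale1r addrC subrK. Qed.

Lemma dirderE (d : plane) p : dirder d p = d 0 0 *: mderiv 0 p + d 0 1 *: mderiv 1 p.
Proof. exact: sum_ord2. Qed.

Lemma dirderD (d : plane) p q : dirder d (p + q) = dirder d p + dirder d q.
Proof. by rewrite !dirderE !mderivD !scalerDr addrACA. Qed.

Lemma dirderZ (d : plane) (c : R) p : dirder d (c *: p) = c *: dirder d p.
Proof. by rewrite !dirderE !mderivZ scalerDr !scalerA !(mulrC c). Qed.

Lemma dirderN (d : plane) p : dirder d (- p) = - dirder d p.
Proof. by have := dirderZ d (-1) p; rewrite !scaleN1r. Qed.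

Lemma dirderB (d : plane) p q : dirder d (p - q) = dirder d p - dirder d q.
Proof. by rewrite dirderD dirderN. Qed.

Lemma dirderM (d : plane) p q : dirder d (p * q) = dirder d p * q + p * dirder d q.
Proof. by rewrite !dirderE !mderivM -!mul_mpolyC; ring. Qed.

Lemma flat_dirder v n (d : plane) p : flat v n.+1 p -> flat v n (dirder d p).
Proof. by case=> _ p1 p2; rewrite dirderE; apply: flatD; apply: flatZ. Qed.

Lemma msz_dirder n (d : plane) p : (msz p <= n.+1)%N -> (msz (dirder d p) <= n)%N.
Proof. by move=> hp; rewrite dirderE; apply: mszD; apply/mszZ/msz_mderiv. Qed.

Lemma deriv_res a b p : (res a b p)^`() = res a b (dirder (b - a) p).
Proof.
elim/pol_ind: p => [c|i p IH|p q IHp IHq].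
- by rewrite resC derivC dirderE !mderivC !scaler0 addr0 rmorph0.
- rewrite resM derivM IH dirderM resD !resM; congr (_ * _ + _ * _).
  rewrite resX derivD derivC derivM derivC derivX mul0r add0r mulr1 add0r.
  rewrite dirderE !mderivXU resD !resZ !resC !mxE.
  by elim/ord2_ind: i; rewrite /= scaler0 ?addr0 ?add0r -[X in _ = X]mul_polyC mulr1.
- by rewrite resD derivD IHp IHq dirderD resD.
Qed.

Lemma size_res a b p : (size (res a b p) <= msz p)%N.
Proof.
rewrite /res /mmap big_seq; elim/big_rec: _ => [|m q hm hq]; first by rewrite size_poly0.
apply: leq_trans (size_polyD _ _) _; rewrite geq_max hq andbT.
apply: leq_trans (size_polyMleq _ _) _.
have hc : (size (mcoeff m p)%:P <= 1)%N by exact: size_polyC_leq1.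
pose X i : {poly R} := (a 0 i)%:P + (b 0 i - a 0 i)%:P * 'X.
have hX i : (size (X i) <= 2)%N.
  apply: leq_trans (size_polyD _ _) _; rewrite geq_max.
  rewrite (leq_trans (size_polyC_leq1 _))//=.
  by apply: leq_trans (size_polyMleq _ _) _; rewrite size_polyX addn2 /= ltnS size_polyC_leq1.
have hXn i n : (size (X i ^+ n)%R <= n.+1)%N.
  apply: leq_trans (size_poly_exp_leq _ _) _; rewrite ltnS.
  have := hX i; set s := size _; case: s => [|[|[|]]] //= _; rewrite ?mul0n//; lia.
suff : (size (mmap1 X m) <= (mdeg m).+1)%N.
  rewrite -/X; have := msize_mdeg_lt hm; rewrite -/(msz p); move: (size _) hc (size _) => n1 ? n2; lia.
rewrite /mmap1 !big_ord_recl big_ord0 mulr1 mdegE !big_ord_recl big_ord0 addn0.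
apply: leq_trans (size_polyMleq _ _) _.
set s1 := size _; set s2 := size _.
have h1 := hXn ord0 (m ord0); have h2 := hXn (lift ord0 ord0) (m (lift ord0 ord0)).
rewrite -/s1 -/s2 in h1 h2 *; lia.
Qed.

Lemma flat_res0 a b n p : flat a n p -> uflat 0 n (res a b p).
Proof.
elim: n p => [//|n IH] p hp; have [p0 _ _] := hp.
by split; [rewrite res_at0 | rewrite deriv_res; apply: IH; apply: flat_dirder].
Qed.

Lemma flat_res1 a b n p : flat b n p -> uflat 1 n (res a b p).
Proof.
elim: n p => [//|n IH] p hp; have [p0 _ _] := hp.
by split; [rewrite res_at1 | rewrite deriv_res; apply: IH; apply: flat_dirder].
Qed.

Lemma res_swap a b p : res b a p = res a b p \Po (1 - 'X).
Proof.
elim/pol_ind: p => [c|i p IH|p q IHp IHq].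
- by rewrite !resC comp_polyC.
- rewrite !resM IH comp_polyM; congr (_ * _); rewrite !resX.
  rewrite comp_polyD comp_polyM !comp_polyC comp_polyX !polyCB; ring.
- by rewrite !resD IHp IHq comp_polyD.
Qed.

End Jets.

(** * Univariate jets, Hermite interpolation, edge moments *)

Section Univariate.
Variable R : realType.
Implicit Types (p q r : {poly R}) (c : R).

Lemma uflatS c n r : uflat c n.+1 r -> uflat c n r.
Proof.
by elim: n r => [//|n IH] r /= [-> h]; split=> //; apply: IH.
Qed.

Lemma uflatD c n p q : uflat c n p -> uflat c n q -> uflat c n (p + q).
Proof.
elim: n p q => [//|n IH] p q /= [p0 p1] [q0 q1].
by rewrite hornerD p0 q0 addr0 derivD; split=> //; apply: IH.
Qed.

Lemma uflatMr c n p q : uflat c n q -> uflat c n (p * q).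
Proof.
elim: n p q => [//|n IH] p q hq; have [q0 q1] := hq.
split; first by rewrite hornerM q0 mulr0.
by rewrite derivM; apply: uflatD; apply: IH => //; apply: uflatS.
Qed.

Lemma uflatZ c n (l : R) p : uflat c n p -> uflat c n (l *: p).
Proof. by rewrite -mul_polyC; apply: uflatMr. Qed.

Lemma uflatN c n p : uflat c n p -> uflat c n (- p).
Proof. by rewrite -scaleN1r; apply: uflatZ. Qed.

Lemma uflat_subC c n p q : uflat c n (p - q) -> uflat c n (q - p).
Proof. by move=> /uflatN; rewrite opprB. Qed.

Lemma uflat_trans c n p q r :
  uflat c n (p - q) -> uflat c n (q - r) -> uflat c n (p - r).
Proof. by move=> h1 h2; have := uflatD h1 h2; rewrite addrA subrK. Qed.

Lemma uflatXsub c n : uflat c n (('X - c%:P) ^+ n).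
Proof.
elim: n => [//|n IH]; split; first by rewrite horner_exp hornerXsubC subrr expr0n.
rewrite deriv_exp derivXsubC mul1r -mulr_natl; exact: uflatMr.
Qed.

(** If r = ('X - c) q, then r' = q + ('X - c) q'. The lemma shift, for the
    combinations (k + 1) q + ('X - c) q' that appear when this is
    differentiated repeatedly, shows that q is as flat as r'. *)
Lemma uflat_factor c n r :
  uflat c n r <-> exists q, r = ('X - c%:P) ^+ n * q.
Proof.
split; last by move=> [q ->]; rewrite mulrC; apply/uflatMr/uflatXsub.
have shift k m q : uflat c m (k.+1%:R *: q + ('X - c%:P) * q^`()) -> uflat c m q.
  elim: m k q => [//|m IH] k q [h0 h1]; split.
    move: h0; rewrite hornerD hornerZ hornerM hornerXsubC subrr mul0r addr0.
    by move=> /eqP; rewrite mulf_eq0 pnatr_eq0 /= => /eqP.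
  apply: (IH k.+1); move: h1; rewrite derivD derivZ derivM derivXsubC mul1r addrA.
  by rewrite -{2}[q^`()]scale1r -scalerDl -[1]/(1%:R) -natrD addn1.
elim: n r => [|n IH] r; first by exists r; rewrite expr0 mul1r.
move=> [r0 r1]; have /factor_theorem[q rE] : root r c by apply/rootP.
have /IH[s qE] : uflat c n q.
  apply: (shift 0%N); move: r1; rewrite rE derivM derivXsubC mulr1 scale1r.
  by rewrite addrC mulrC.
by exists s; rewrite rE qE exprS; ring.
Qed.

Lemma poly_eq0_itv p : (forall s, 0 <= s <= 1 -> p.[s] = 0) -> p = 0.
Proof.
move=> h; apply/eqP; apply: contraT => p0.
pose rs : seq R := [seq (n.+1%:R)^-1 | n <- iota 0 (size p)].
have := @max_poly_roots _ p rs p0; rewrite size_map size_iota ltnn; apply.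
  apply/allP => x /mapP[n _ ->]; apply/rootP/h.
  by rewrite invr_ge0 ler0n invf_le1 ?ltr0n// ler1n.
rewrite map_inj_uniq ?iota_uniq// => m n /invr_inj /eqP.
by rewrite eqr_nat eqSS => /eqP.
Qed.

Definition uprim p : {poly R} := \poly_(i < (size p).+1) (p`_i.-1 / i%:R).

Lemma deriv_uprim p : (uprim p)^`() = p.
Proof.
apply/polyP => i; rewrite coef_deriv coef_poly ltnS.
case: ltnP => hi; last by rewrite mul0rn nth_default.
by rewrite /= -[_ *+ _]mulr_natr divfK// pnatr_eq0.
Qed.

Lemma size_uprim p : (size (uprim p) <= (size p).+1)%N.
Proof. exact: size_poly. Qed.

Lemma deriv_eq0 p : p^`() = 0 -> exists c, p = c%:P.
Proof.
move=> p0; exists p`_0; apply/polyP => -[|i]; rewrite coefC//=.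
have := congr1 (fun q : {poly R} => q`_i) p0; rewrite coef_deriv coef0 => /eqP.
by rewrite mulrn_eq0 /= => /eqP.
Qed.

(** The powers of 'X and 'X - 1 are coprime; a Bezout relation gives a
    solution, and its remainder modulo the product of the two powers has the
    required degree. *)
Lemma hermite n (A B : {poly R}) : exists H : {poly R},
  [/\ (size H <= n.*2)%N, uflat 0 n (H - A) & uflat 1 n (H - B)].
Proof.
pose P : {poly R} := ('X - 0%:P) ^+ n; pose Q : {poly R} := ('X - 1%:P) ^+ n.
have cop : coprimep P Q.
  by apply/coprimep_expl/coprimep_expr/coprimep_XsubC2; rewrite subr0 oner_neq0.
have [[u v] /=] := Bezout_coprimepP _ _ cop.
rewrite -size_poly_eq1 => /size_poly1P[c c0 kE].
have PQ0 : P * Q != 0 by rewrite mulf_neq0// expf_neq0// polyXsubC_eq0.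
have szPQ : size (P * Q) = n.*2.+1.
  rewrite size_mul ?expf_neq0 ?polyXsubC_eq0// !size_exp_XsubC.
  by rewrite addSn addnS -addnn.
pose H0 := c^-1 *: (A * (v * Q) + B * (u * P)).
have HE : H0 %% (P * Q) = H0 - H0 %/ (P * Q) * (P * Q).
  by rewrite {2}(divp_eq H0 (P * Q)) addrAC subrr add0r.
have cE : c^-1 *: (u * P + v * Q) = 1.
  by rewrite kE -mul_polyC -polyCM mulVf.
exists (H0 %% (P * Q)); split.
- by rewrite -ltnS -szPQ ltn_modp.
- have -> : H0 %% (P * Q) - A =
      (c^-1 *: ((B - A) * u) - H0 %/ (P * Q) * Q) * P.
    rewrite HE; set D := H0 %/ _.
    have -> : H0 - D * (P * Q) - A = H0 - D * (P * Q) - A * (c^-1 *: (u * P + v * Q)) by rewrite cE mulr1.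
    rewrite /H0 -!mul_polyC; ring.
  by apply/uflatMr/uflatXsub.
- have -> : H0 %% (P * Q) - B =
      (c^-1 *: ((A - B) * v) - H0 %/ (P * Q) * P) * Q.
    rewrite HE; set D := H0 %/ _.
    have -> : H0 - D * (P * Q) - B = H0 - D * (P * Q) - B * (c^-1 *: (u * P + v * Q)) by rewrite cE mulr1.
    rewrite /H0 -!mul_polyC; ring.
  by apply/uflatMr/uflatXsub.
Qed.

Lemma uflat_factor01 n p : uflat 0 n p -> uflat 1 n p ->
  exists2 q, p = 'X ^+ n * (1 - 'X) ^+ n * q & (size q <= size p - n.*2)%N.
Proof.
have [-> _ _|p0] := eqVneq p 0; first by exists 0; rewrite ?mulr0// size_poly0.
move=> /uflat_factor[q pE]; rewrite subr0 in pE.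
move=> /uflat_factor[r pE'].
have cop : coprimep ('X ^+ n : {poly R}) (('X - 1%:P) ^+ n).
  have : coprimep (('X - 0%:P : {poly R}) ^+ n) (('X - 1%:P) ^+ n).
    by apply/coprimep_expl/coprimep_expr/coprimep_XsubC2; rewrite subr0 oner_neq0.
  by rewrite polyC0 subr0.
have : 'X ^+ n * ('X - 1%:P) ^+ n %| p.
  rewrite Gauss_dvdp//; apply/andP; split.
    by rewrite pE dvdp_mulr.
  by rewrite pE' dvdp_mulr.
move=> /dvdpP[w wE]; exists ((-1) ^+ n *: w).
  have -> : (1 - 'X : {poly R}) = - ('X - 1%:P) by rewrite opprB.
  rewrite [(- ('X - _)) ^+ n]exprNn -mul_polyC polyC_exp polyCN {1}wE.
  set e : {poly R} := (-1) ^+ n; set Y := ('X - _) ^+ n.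
  have ee : e * e = 1 by rewrite /e -expr2 sqrr_sign.
  by rewrite -[LHS]mul1r -{1}ee; ring.
have w0 : w != 0 by apply: contraNneq p0 => w0; rewrite wE w0 mul0r.
have P0 : ('X ^+ n : {poly R}) != 0 by rewrite expf_neq0// polyX_eq0.
have Q0 : ('X - 1%:P : {poly R}) ^+ n != 0 by rewrite expf_neq0// polyXsubC_eq0.
rewrite size_scale ?signr_eq0// wE size_mul ?mulf_neq0//.
rewrite (size_mul P0 Q0) size_polyXn size_exp_XsubC.
by rewrite addSn addnS /= -addnn; lia.
Qed.

(** P is nondecreasing on [0, 1] with equal end values, hence constant
    there. *)
Lemma nonneg_prim_eq0 (P : {poly R}) :
  (forall s, 0 <= s <= 1 -> 0 <= P^`().[s]) -> P.[1] = P.[0] -> P^`() = 0.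
Proof.
move=> P0 P01.
suff : P - P.[0]%:P = 0.
  by move=> /(congr1 (@deriv _)); rewrite derivB derivC subr0 deriv0.
apply: poly_eq0_itv => s hs; rewrite hornerD hornerN hornerC.
have cP : {within `[0, 1], continuous (horner P)}.
  by apply/continuous_subspaceT => x; exact: continuous_horner.
have mono := @ger0_derive1_le_cc R (horner P) 0 1
  (fun x _ => @derivable_horner _ P x).
have dP x : x \in `]0, 1[%R -> 0 <= (horner P)^`()%classic x.
  by rewrite in_itv /= => /andP[x0 x1]; rewrite -derivE P0// !ltW.
have /andP[s0 s1] := hs.
have h1 := mono dP cP 0 s; have h2 := mono dP cP s 1.
apply/eqP; rewrite subr_eq0 eq_le; apply/andP; split.
  by rewrite -P01; apply: h2; rewrite // in_itv /= ?ler01 ?lexx ?s0.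
by apply: h1; rewrite // in_itv /= ?ler01 ?lexx ?s0.
Qed.

Lemma Rint_deriv (P : {poly R}) :
  \int[lebesgue_measure]_(s in `[(0 : R), 1]) P^`().[s] = P.[1] - P.[0].
Proof.
rewrite /Rintegral (@continuous_FTC2 _ _ (horner P)) ?ltr01//.
- by apply/continuous_subspaceT => x; exact: continuous_horner.
- split.
  + by move=> x _; exact: derivable_horner.
  + by apply: cvg_at_right_filter; exact: continuous_horner.
  + by apply: cvg_at_left_filter; exact: continuous_horner.
- by move=> x _; rewrite -derivE.
Qed.

End Univariate.

Section Edges.
Variable R : realType.
Local Notation plane := 'rV[R]_2.
Local Notation pol := (mpoly 2 R).
Local Notation Xv i := (mpolyX R (mnm1 (i : 'I_2))).
Implicit Types (p q : pol) (a b d v x : plane) (r : {poly R}).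

Lemma dotE a b : dot a b = a 0 0 * b 0 0 + a 0 1 * b 0 1.
Proof. exact: sum_ord2. Qed.

Lemma dot_gt0 a : a != 0 -> 0 < dot a a.
Proof.
move=> a0; rewrite dotE lt_neqAle addr_ge0 ?sqr_ge0 -?expr2 ?sqr_ge0// andbT eq_sym.
rewrite paddr_eq0 ?sqr_ge0// !sqrf_eq0; apply: contraNN a0 => /andP[/eqP h0 /eqP h1].
by apply/eqP/eq_plane; rewrite mxE.
Qed.

Lemma edge_int_prim a b p (P : {poly R}) : P^`() = res a b p ->
  edge_int a b p = Num.sqrt (dot (b - a) (b - a)) * (P.[1] - P.[0]).
Proof.
move=> hP; rewrite /edge_int -Rint_deriv; congr (_ * Rintegral _ _ _).
by apply: funext => s; rewrite hP horner_res.
Qed.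

Lemma eq_edge_int a b p q : res a b p = res a b q -> edge_int a b p = edge_int a b q.
Proof.
move=> h; rewrite (edge_int_prim (P := uprim (res a b p))) ?deriv_uprim//.
by rewrite (edge_int_prim (P := uprim (res a b p))) ?deriv_uprim.
Qed.

(** r evaluated at p. When p is an affine coordinate along an edge, this
    extends r from the edge to the plane. *)
Definition ucomp r p : pol := (map_poly (@mpolyC 2 R) r).[p].

Lemma ucompC (c : R) p : ucomp c%:P p = mpolyC 2 c.
Proof. by rewrite /ucomp map_polyC hornerC. Qed.

Lemma ucompS r (c : R) p : ucomp (r * 'X + c%:P) p = ucomp r p * p + mpolyC 2 c.
Proof.
by rewrite /ucomp rmorphD rmorphM /= map_polyX map_polyC !hornerE.
Qed.

Lemma mderiv_ucomp (i : 'I_2) r p : mderiv i (ucomp r p) = ucomp r^`() p * mderiv i p.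
Proof.
elim/poly_ind: r => [|r c IH].
  by rewrite deriv0 -polyC0 !ucompC mderivC mpolyC0 mul0r.
rewrite ucompS mderivD mderivM mderivC addr0 IH derivD derivM derivX derivC addr0.
rewrite mulr1 /ucomp rmorphD rmorphM /= map_polyX !hornerE; ring.
Qed.

Lemma res_ucomp a b r p : res a b (ucomp r p) = r \Po res a b p.
Proof.
elim/poly_ind: r => [|r c IH].
  by rewrite comp_poly0 -polyC0 ucompC resC.
by rewrite ucompS resD resM IH resC comp_polyD comp_polyM comp_polyX comp_polyC.
Qed.

Lemma msz_ucomp n r p : (msz p <= 2)%N -> (size r <= n)%N -> (msz (ucomp r p) <= n)%N.
Proof.
move=> hp hr; rewrite /ucomp horner_coef.
apply: msz_sum => -[l /= hl] _; rewrite coef_map /= mul_mpolyC; apply: mszZ.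
have := @mszM_exp _ 1 l p hp; rewrite muln1 => h; apply: leq_trans h _.
by apply: leq_trans hr; apply: leq_trans hl _; exact: size_poly.
Qed.

(** The affine function that is 0 at a, 1 at b, with gradient along b - a. *)
Definition along a b : pol :=
  \sum_(i < 2) ((b - a) 0 i / dot (b - a) (b - a)) *: (Xv i - mpolyC 2 (a 0 i)).

Lemma msz_along a b : (msz (along a b) <= 2)%N.
Proof.
by apply: msz_sum => i _; apply: mszZ; apply: mszB; rewrite ?mszX// mszC.
Qed.

Lemma res_along a b : a != b -> res a b (along a b) = 'X.
Proof.
move=> ab; have : dot (b - a) (b - a) != 0.
  by rewrite gt_eqF// dot_gt0// subr_eq0 eq_sym.
rewrite /along sum_ord2 resD !resZ !resB !resX !resC.
set D := dot _ _ => D0; rewrite ![_ + _ - _]addrAC !subrr !add0r -!mul_polyC !mulrA -mulrDl.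
rewrite -!polyCM -polyCD -[RHS]mul1r -(polyC1 R); congr (_%:P * _).
have DE : D = (b 0 0 - a 0 0) * (b 0 0 - a 0 0) + (b 0 1 - a 0 1) * (b 0 1 - a 0 1).
  by rewrite /D dotE !mxE.
by rewrite !mxE mulrAC [X in _ + X]mulrAC -mulrDl -DE divff.
Qed.

(** The difference p1 - p2 restricts to (s (1 - s))^n times some q0. Testing
    against an extension of q0, which has an admissible degree, makes the
    integrand the nonnegative polynomial (s (1 - s))^n q0^2. *)
Lemma moments_eq (J n : nat) (j : int) a b (p1 p2 : pol) : a != b ->
  j = J%:Z - 1 - 2 * n%:Z -> (msz (p1 - p2)%R <= J)%N ->
  flat a n (p1 - p2) -> flat b n (p1 - p2) ->
  (forall q, deg_le j q -> edge_int a b (p1 * q) = edge_int a b (p2 * q)) ->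
  res a b p1 = res a b p2.
Proof.
move=> ab jE hJ fa fb mom; set p := p1 - p2.
apply/eqP; rewrite -subr_eq0 -resB -/p; apply/eqP.
have [q0 rE hq] := uflat_factor01 (flat_res0 b fa) (flat_res1 a fb).
have [q00|q0n] := eqVneq q0 0; first by rewrite rE q00 mulr0.
have hsz : (size q0 <= J - n.*2)%N.
  apply: leq_trans hq _; rewrite leq_sub2r//; exact: leq_trans (size_res _ _ _) hJ.
have hJn : (n.*2 < J)%N.
  by move: hsz; move: q0n; rewrite -size_poly_gt0; lia.
pose q := ucomp q0 (along a b).
have rq : res a b q = q0 by rewrite res_ucomp res_along// comp_polyXr.
have dq : deg_le j q.
  have -> : j = (J - n.*2).-1%:Z by rewrite jE; lia.
  rewrite deg_leE; apply: msz_ucomp; first exact: msz_along.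
  by apply: leq_trans hsz _; lia.
have := mom q dq.
pose P1 := uprim (res a b (p1 * q)); pose P2 := uprim (res a b (p2 * q)).
rewrite (edge_int_prim (P := P1)) ?deriv_uprim// (edge_int_prim (P := P2)) ?deriv_uprim//.
have L0 : Num.sqrt (dot (b - a) (b - a)) != 0.
  by rewrite gt_eqF// sqrtr_gt0 dot_gt0// subr_eq0 eq_sym.
move=> /(mulfI L0) hP.
have dP : (P1 - P2)^`() = 'X ^+ n * (1 - 'X) ^+ n * q0 ^+ 2.
  rewrite derivB !deriv_uprim -resB -mulrBl resM rq -/p rE expr2; ring.
have : (P1 - P2)^`() = 0.
  apply: nonneg_prim_eq0 => [s /andP[s0 s1]|].
    rewrite dP hornerM; apply: mulr_ge0; last by rewrite horner_exp sqr_ge0.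
    by rewrite !hornerE mulr_ge0// exprn_ge0// subr_ge0.
  by rewrite !hornerD !hornerN; lra.
rewrite dP => /eqP; rewrite !mulf_eq0 !expf_eq0 /= polyX_eq0 andbF /=.
have -> : (1 - 'X == 0 :> {poly R}) = false.
  by apply/negbTE; rewrite subr_eq0 eq_sym -subr_eq0 -(polyC1 R) polyXsubC_eq0.
by rewrite andbF orbb => /eqP q00; rewrite rE q00 mulr0.
Qed.

End Edges.

(** * The polynomial divdiv complex and its edge traces *)

Section Complex.
Variable R : realType.
Local Notation plane := 'rV[R]_2.
Local Notation pol := (mpoly 2 R).
Local Notation Xv i := (mpolyX R (mnm1 (i : 'I_2))).
Implicit Types (p q f : pol) (a b d n v x : plane) (w : 'rV[pol]_2) (tau : 'M[pol]_2).

Lemma half2 p : (2^-1 : R) *: (p + p) = p.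
Proof. by rewrite -mulr2n -[p *+ 2]scaler_nat scalerA mulVf ?scale1r// pnatr_eq0. Qed.

Lemma divmE tau (i : 'I_2) : divm tau 0 i = mderiv 0 (tau i 0) + mderiv 1 (tau i 1).
Proof. by rewrite /divm /divv mxE sum_ord2 !mxE. Qed.

Lemma divdivE tau : divdiv tau =
  mderiv 0 (mderiv 0 (tau 0 0) + mderiv 1 (tau 0 1)) +
  mderiv 1 (mderiv 0 (tau 1 0) + mderiv 1 (tau 1 1)).
Proof. by rewrite /divdiv /divv sum_ord2 !divmE. Qed.

Lemma symcurl00 w : symcurl w 0 0 = mderiv 1 (w 0 0).
Proof. by rewrite /symcurl /symm /curlv /curl !mxE /= half2. Qed.

Lemma symcurl11 w : symcurl w 1 1 = - mderiv 0 (w 0 1).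
Proof. by rewrite /symcurl /symm /curlv /curl !mxE /= half2. Qed.

Lemma symcurl01 w : symcurl w 0 1 =
  (2^-1 : R) *: (mderiv 1 (w 0 1) - mderiv 0 (w 0 0)).
Proof. by rewrite /symcurl /symm /curlv /curl !mxE /= addrC. Qed.

Lemma symcurl10 w : symcurl w 1 0 = symcurl w 0 1.
Proof. by rewrite /symcurl /symm !mxE addrC. Qed.

Lemma eq_sym_mx tau (sigma : 'M[pol]_2) : tau^T = tau -> sigma^T = sigma ->
  tau 0 0 = sigma 0 0 -> tau 0 1 = sigma 0 1 -> tau 1 1 = sigma 1 1 -> tau = sigma.
Proof.
move=> /matrixP ht /matrixP hs e0 e1 e2; apply/matrixP => i j.
elim/ord2_ind: i; elim/ord2_ind: j => //.
by rewrite -(ht 1 0) -(hs 1 0) !mxE.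
Qed.

Lemma trmx_symcurl w : (symcurl w)^T = symcurl w.
Proof. by apply/matrixP => i j; rewrite /symcurl /symm !mxE addrC. Qed.

Lemma symcurlD w (z : 'rV[pol]_2) : symcurl (w + z) = symcurl w + symcurl z.
Proof.
have sD (s t : 'M[pol]_2) : s^T = s -> t^T = t -> (s + t)^T = s + t.
  by move=> hs ht; rewrite linearD /= hs ht.
apply: eq_sym_mx; rewrite ?sD ?trmx_symcurl//.
- by rewrite symcurl00 [RHS]mxE !symcurl00 mxE mderivD.
- by rewrite symcurl01 [RHS]mxE !symcurl01 !mxE !mderivD -scalerDr opprD addrACA.
- by rewrite symcurl11 [RHS]mxE !symcurl11 mxE mderivD opprD.
Qed.

Lemma symcurlN w : symcurl (- w) = - symcurl w.
Proof.
apply: eq_sym_mx; rewrite ?trmx_symcurl//; first by rewrite linearN /= trmx_symcurl.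
- by rewrite symcurl00 [RHS]mxE symcurl00 mxE mderivN.
- by rewrite symcurl01 [RHS]mxE symcurl01 !mxE !mderivN -scalerN opprB opprK addrC.
- by rewrite symcurl11 [RHS]mxE symcurl11 mxE mderivN.
Qed.

Lemma symcurlB w (z : 'rV[pol]_2) : symcurl (w - z) = symcurl w - symcurl z.
Proof. by rewrite symcurlD symcurlN. Qed.

Lemma divdivD tau (s : 'M[pol]_2) : divdiv (tau + s) = divdiv tau + divdiv s.
Proof. by rewrite !divdivE !mxE !mderivD; ring. Qed.

Lemma divdivN tau : divdiv (- tau) = - divdiv tau.
Proof. by rewrite !divdivE !mxE !(mderivD, mderivN); ring. Qed.

Lemma divdivB tau (s : 'M[pol]_2) : divdiv (tau - s) = divdiv tau - divdiv s.
Proof. by rewrite divdivD divdivN. Qed.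

Lemma msz_symcurl m w : (forall i, (msz (w 0%R i) <= m.+1)%N) ->
  forall i j, (msz (symcurl w i j) <= m)%N.
Proof.
move=> hw; apply: ord2_ind; apply: ord2_ind; rewrite ?symcurl10 ?symcurl00 ?symcurl01 ?symcurl11.
- exact: msz_mderiv.
- by apply/mszZ/mszB; apply: msz_mderiv.
- by apply/mszZ/mszB; apply: msz_mderiv.
- by rewrite mszN msz_mderiv.
Qed.

Lemma flat_symcurl v m w : (forall i, flat v m.+1 (w 0 i)) ->
  forall i j, flat v m (symcurl w i j).
Proof.
move=> hw; apply: ord2_ind; apply: ord2_ind; rewrite ?symcurl10 ?symcurl00 ?symcurl01 ?symcurl11.
- exact: flat_mderiv.
- by apply/flatZ/flatB; apply: flat_mderiv.
- by apply/flatZ/flatB; apply: flat_mderiv.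
- by apply/flatN/flat_mderiv.
Qed.

(** Half the divergence completes the symmetric curl to the full gradient. *)
Definition hdiv w : pol := (2^-1 : R) *: (mderiv 0 (w 0 0) + mderiv 1 (w 0 1)).

Lemma grad00 w : mderiv 0 (w 0 0) = hdiv w - symcurl w 0 1.
Proof.
by rewrite symcurl01 /hdiv -scalerBr -{1}[mderiv 0 _]half2; congr (_ *: _); ring. Qed.

Lemma grad11 w : mderiv 1 (w 0 1) = hdiv w + symcurl w 0 1.
Proof. by rewrite symcurl01 /hdiv -scalerDr -{1}[mderiv 1 _]half2; congr (_ *: _); ring. Qed.

Lemma grad10 w : mderiv 1 (w 0 0) = symcurl w 0 0.
Proof. by rewrite symcurl00. Qed.

Lemma grad01 w : mderiv 0 (w 0 1) = - symcurl w 1 1.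
Proof. by rewrite symcurl11 opprK. Qed.

(** Equality of the mixed second derivatives of w expresses the gradient of
    hdiv w through symcurl w alone: the operator symcurl is of finite type. *)
Lemma grad0_hdiv w : mderiv 0 (hdiv w) = - (mderiv 0 (symcurl w 0 1) + mderiv 1 (symcurl w 1 1)).
Proof.
have e : mderiv 0 (mderiv 1 (w 0 1)) = mderiv 1 (mderiv 0 (w 0 1)) by rewrite mderiv_comm.
by move: e; rewrite grad11 grad01 mderivD mderivN => /eqP; rewrite eq_sym -subr_eq => /eqP <-; ring.
Qed.

Lemma grad1_hdiv w : mderiv 1 (hdiv w) = mderiv 0 (symcurl w 0 0) + mderiv 1 (symcurl w 0 1).
Proof.
have e : mderiv 1 (mderiv 0 (w 0 0)) = mderiv 0 (mderiv 1 (w 0 0)) by rewrite mderiv_comm.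
by move: e; rewrite grad00 grad10 mderivB => /eqP; rewrite subr_eq => /eqP ->.
Qed.

Lemma divdiv_symcurl w : divdiv (symcurl w) = 0.
Proof.
by rewrite divdivE symcurl10 -grad1_hdiv -[X in _ + mderiv 1 X]opprK -grad0_hdiv
   mderivN mderiv_comm subrr.
Qed.

(** Two rounds of potentials: divm tau is divergence-free, hence the curl of
    some phi; adding a rotation matrix times phi, which symm kills, makes both
    rows of tau divergence-free. *)
Lemma symcurl_exact m tau : tau^T = tau -> divdiv tau = 0 ->
  (forall i j, (msz (tau i j) <= m.+1)%N) ->
  exists w, symcurl w = tau /\ forall i, (msz (w 0%R i) <= m.+2)%N.
Proof.
move=> ht hd hsz; have t10 : tau 1 0 = tau 0 1 by rewrite -{1}ht mxE.
have dsz (i : 'I_2) : (msz (mderiv 0 (tau i 0) + mderiv 1 (tau i 1))%R <= m)%N.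
  by apply: mszD; apply: msz_mderiv.
have [] := @div_free_curl R m _ _ _ (dsz 0) (dsz 1); first by rewrite -divdivE.
move=> phi [p1 p2 hphi].
have [] := @div_free_curl R m.+1 (tau 0 0) (tau 0 1 - phi).
- by rewrite mderivB addrA p1 subrr.
- exact: hsz.
- exact: mszB.
move=> w0 [q1 q2 hw0].
have [] := @div_free_curl R m.+1 (tau 1 0 + phi) (tau 1 1).
- by rewrite mderivD addrAC p2 addNr.
- exact: mszD.
- exact: hsz.
move=> w1 [r1 r2 hw1].
exists (\row_j (if j == 0 then w0 else w1)); split; last first.
  by apply: ord2_ind; rewrite !mxE.
apply: eq_sym_mx; rewrite ?trmx_symcurl//.
- by rewrite symcurl00 !mxE -q1.
- rewrite symcurl01 !mxE /= -r1 -q2 t10 -[RHS]half2; congr (_ *: _); ring.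
- by rewrite symcurl11 !mxE /= -r2.
Qed.

Lemma divdiv_surj m f : (msz f <= m)%N ->
  exists tau, [/\ tau^T = tau, divdiv tau = f & forall i j, (msz (tau i j) <= m.+2)%N].
Proof.
move=> hf; pose F := antider 0 (antider 0 f).
exists (\matrix_(i, j) if (i == 0) && (j == 0) then F else 0); split.
- by apply/matrixP => i j; rewrite !mxE andbC.
- by rewrite divdivE !mxE /= !(mderiv0, addr0) !mderiv_antider.
- move=> i j; rewrite mxE; case: ifP => _; last by rewrite msz0.
  by do 2 apply: msz_antider.
Qed.

(** The vanishing of p on the line through v in the second direction takes care
    of the pure derivatives in that direction; all others are derivatives of
    mderiv 0 p. *)
Lemma flat_of_deriv0 v j p : flat v j (mderiv 0 p) ->
  res v (v + delta_mx 0 1) p = 0 -> flat v j.+1 p.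
Proof.
elim: j p => [|j IH] p h0 hr.
  by split=> //; rewrite -(res_at0 v (v + delta_mx 0 1)) hr horner0.
split=> //; first by rewrite -(res_at0 v (v + delta_mx 0 1)) hr horner0.
apply: IH; first by rewrite mderiv_comm; exact: flat_mderiv h0.
have /(congr1 (@deriv _)) := hr; rewrite deriv_res deriv0 addrAC subrr add0r.
by rewrite dirderE !mxE /= scale0r add0r scale1r.
Qed.

(** Any antiderivative in the first variable, corrected by a polynomial in the
    second one so as to vanish on the line of flat_of_deriv0. *)
Lemma flat_antider v j f : flat v j f -> exists F, mderiv 0 F = f /\ flat v j.+1 F.
Proof.
move=> hf; pose G := antider 0 f; pose y := Xv 1 - mpolyC 2 (v 0 1).
exists (G - ucomp (res v (v + delta_mx 0 1) G) y).
have d0 : mderiv 0 (G - ucomp (res v (v + delta_mx 0 1) G) y) = f.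
  rewrite mderivB mderiv_antider mderiv_ucomp mderivB mderivXU mderivC subr0.
  by rewrite mpolyC0 mulr0 subr0.
split=> //; apply: flat_of_deriv0; first by rewrite d0.
rewrite resB res_ucomp; suff -> : res v (v + delta_mx 0 1) y = 'X by rewrite comp_polyXr subrr.
rewrite /y resB resX resC !mxE /=; ring.
Qed.

(** Subtracting from tau a field with the same double divergence and flat to
    order j + 2 leaves a field that is exactly a symmetric curl. *)
Lemma symcurl_exact_jet v j tau : tau^T = tau -> flat v j (divdiv tau) ->
  exists w, forall i l, flat v j.+2 ((tau - symcurl w) i l).
Proof.
move=> ht /flat_antider[F1 [F1E fF1]].
have [F [FE fF]] := flat_antider fF1.
pose s : 'M[pol]_2 := \matrix_(i, j) if (i == 0) && (j == 0) then F else 0.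
have sT : s^T = s by apply/matrixP => i l; rewrite !mxE andbC.
have hd : divdiv (tau - s) = 0.
  by rewrite divdivB [divdiv s]divdivE !mxE /= !(mderiv0, addr0) FE F1E subrr.
pose m := (msz ((tau - s) 0 0)%R + msz ((tau - s) 0 1)%R +
  (msz ((tau - s) 1 0)%R + msz ((tau - s) 1 1)%R))%N.
have [] := @symcurl_exact m (tau - s) _ hd.
- by rewrite linearB /= ht sT.
- by apply: ord2_ind; apply: ord2_ind; rewrite /m;
    move: (msz _) (msz _) (msz _) (msz _) => *; lia.
move=> w [wE _]; exists w => i l; rewrite wE opprB addrC subrK mxE.
by case: ifP => _ //; exact: flat0.
Qed.

(** The gradient of w is a combination of symcurl w and hdiv w, and the
    gradient of hdiv w one of first derivatives of symcurl w. *)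
Lemma flat_of_symcurl v m w : (forall i j, flat v m.+1 (symcurl w i j)) ->
  (forall i, peval (w 0 i) v = 0) -> peval (hdiv w) v = 0 ->
  forall i, flat v m.+2 (w 0 i).
Proof.
move=> ht hw hc.
have fc : flat v m.+1 (hdiv w).
  split=> //; rewrite ?grad0_hdiv ?grad1_hdiv.
    by apply/flatN/flatD; apply: flat_mderiv.
  by apply: flatD; apply: flat_mderiv.
apply: ord2_ind; split; rewrite ?grad00 ?grad01 ?grad10 ?grad11 //.
- exact: flatB.
- exact: flatN.
- exact: flatD.
Qed.

Lemma rt_fieldE a (c : R) (i : 'I_2) : rt_field a c 0 i = mpolyC 2 (a 0 i) + c *: Xv i.
Proof. by rewrite mxE. Qed.

Lemma symcurl_rt a (c : R) : symcurl (rt_field a c) = 0.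
Proof.
apply: eq_sym_mx; rewrite ?trmx_symcurl ?linear0// ?symcurl00 ?symcurl01 ?symcurl11
  !rt_fieldE !mxE !mderivD !mderivC !mderivZ !mderivXU /= ?mpolyC0 ?scaler0 ?addr0
  ?oppr0 //.
by rewrite subrr scaler0.
Qed.

Lemma hdiv_rt a (c : R) : hdiv (rt_field a c) = mpolyC 2 c.
Proof.
rewrite /hdiv !rt_fieldE !mderivD !mderivC !mderivZ !mderivXU /= !add0r half2.
by rewrite -mul_mpolyC mulr1.
Qed.

Lemma rt_fieldD a b (c e : R) : rt_field (a + b) (c + e) = rt_field a c + rt_field b e.
Proof.
apply/matrixP => i j; rewrite ord1 [RHS]mxE !rt_fieldE mxE mpolyCD scalerDl.
by rewrite addrACA.
Qed.

Lemma rt_fieldN a (c : R) : rt_field (- a) (- c) = - rt_field a c.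
Proof.
apply/matrixP => i j; rewrite ord1 [RHS]mxE !rt_fieldE mxE mpolyCN scaleNr.
by rewrite opprD.
Qed.

Lemma hdivD w (z : 'rV[pol]_2) : hdiv (w + z) = hdiv w + hdiv z.
Proof. by rewrite /hdiv !mxE !mderivD -scalerDr addrACA. Qed.

Lemma hdivN w : hdiv (- w) = - hdiv w.
Proof. by rewrite /hdiv !mxE !mderivN -scalerN opprD. Qed.

Lemma symcurl_eq0 w : symcurl w = 0 -> exists a c, w = rt_field a c.
Proof.
move=> h0; have z i j : symcurl w i j = 0 by rewrite h0 mxE.
have [] := @mderiv_eq0 R (hdiv w).
- by rewrite grad0_hdiv !z !mderiv0 addr0 oppr0.
- by rewrite grad1_hdiv !z !mderiv0 addr0.
move=> c cE.
have hw i : exists e, w 0 i - c *: Xv i = mpolyC 2 e.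
  apply: mderiv_eq0; rewrite mderivB mderivZ mderivXU -mul_mpolyC;
  by elim/ord2_ind: i; rewrite /= ?mpolyC0 ?mulr1 ?mulr0 ?grad00 ?grad01 ?grad10 ?grad11
     ?z ?cE ?subr0 ?addr0 ?subrr ?oppr0.
have [e0 h1] := hw 0; have [e1 h2] := hw 1.
exists (\row_j (if j == 0 then e0 else e1)), c.
apply/matrixP => i j; rewrite ord1 rt_fieldE mxE; elim/ord2_ind: j => /=.
  by rewrite -h1 subrK.
by rewrite -h2 subrK.
Qed.

Definition wdot d w : pol := d 0 0 *: w 0 0 + d 0 1 *: w 0 1.

(** Traces on an edge with direction d, scaled so as to be polynomial in d: for
    a unit normal n of the edge, n^T tau n and tr2 n tau are nonzero multiples
    of gtr d tau and ttr d tau. *)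
Definition gtr d tau : pol := bil (rot90 d) tau (rot90 d).

Definition ttr d tau : pol :=
  dirder d (bil d tau (rot90 d)) + dot d d *: wdot (rot90 d) (divm tau).

Lemma bilE d tau n : bil d tau n =
  (d 0 0 * n 0 0) *: tau 0 0 + (d 0 0 * n 0 1) *: tau 0 1
  + ((d 0 1 * n 0 0) *: tau 1 0 + (d 0 1 * n 0 1) *: tau 1 1).
Proof. by rewrite /bil !sum_ord2. Qed.

Lemma rot0 d : rot90 d 0 0 = - d 0 1. Proof. by rewrite mxE. Qed.
Lemma rot1 d : rot90 d 0 1 = d 0 0. Proof. by rewrite mxE. Qed.

Lemma gtr_symcurl d w : gtr d (symcurl w) = - dirder d (wdot (rot90 d) w).
Proof.
rewrite /gtr bilE dirderE /wdot rot0 rot1 !mderivD !mderivZ grad00 grad01 grad10 grad11.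
rewrite symcurl10 -!mul_mpolyC !(mpolyCM, mpolyCN); ring.
Qed.

Lemma ttr_symcurl d w : ttr d (symcurl w) = - dirder d (dirder d (wdot d w)).
Proof.
have -> : dirder d (wdot d w) = dot d d *: hdiv w - bil d (symcurl w) (rot90 d).
  rewrite bilE dotE dirderE /wdot rot0 rot1 !mderivD !mderivZ grad00 grad01 grad10 grad11.
  rewrite symcurl10 -!mul_mpolyC !(mpolyCM, mpolyCN, mpolyCD); ring.
rewrite dirderB dirderZ /ttr opprB; congr (_ + _).
rewrite /wdot !divmE symcurl10 -grad1_hdiv -[mderiv 0 (symcurl w 0 1) + _]opprK.
rewrite -grad0_hdiv dirderE rot0 rot1 -!mul_mpolyC !mpolyCN; ring.
Qed.

End Complex.

(** * Interpolation on a triangle *)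

Section Triangle.
Variable R : realType.
Local Notation plane := 'rV[R]_2.
Local Notation pol := (mpoly 2 R).
Local Notation Xv i := (mpolyX R (mnm1 (i : 'I_2))).
Implicit Types (p q f : pol) (a b c d n v x : plane) (w : 'rV[pol]_2) (tau : 'M[pol]_2).

Lemma dot_rot90 d : dot (rot90 d) (rot90 d) = dot d d.
Proof. by rewrite !dotE !rot0 !rot1; ring. Qed.

Lemma rvZ (s : R) d (i : 'I_2) : (s *: d) 0 i = s * d 0 i.
Proof. by rewrite mxE. Qed.

Lemma unit_normalE n d : dot n n = 1 -> dot n d = 0 -> d != 0 ->
  exists2 s : R, s ^+ 2 * dot d d = 1 & n = s *: rot90 d.
Proof.
move=> n1 nd d0; have D0 : dot d d != 0 by rewrite gt_eqF// dot_gt0.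
pose s := dot n (rot90 d) / dot d d.
have nE : n = s *: rot90 d.
  have e0 : n 0 0 * dot d d = dot n (rot90 d) * rot90 d 0 0.
    have : n 0 0 * dot d d - dot n (rot90 d) * rot90 d 0 0 = d 0 0 * dot n d.
      by rewrite !dotE !rot0 !rot1; ring.
    by rewrite nd mulr0 => /eqP; rewrite subr_eq0 => /eqP.
  have e1 : n 0 1 * dot d d = dot n (rot90 d) * rot90 d 0 1.
    have : n 0 1 * dot d d - dot n (rot90 d) * rot90 d 0 1 = d 0 1 * dot n d.
      by rewrite !dotE !rot0 !rot1; ring.
    by rewrite nd mulr0 => /eqP; rewrite subr_eq0 => /eqP.
  by apply: eq_plane; rewrite rvZ /s mulrAC -?e0 -?e1 mulfK.
exists s => //; rewrite -n1 [in RHS]nE !dotE !rvZ !rot0 !rot1; ring.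
Qed.

Lemma bil_unit (s : R) d tau :
  bil (s *: rot90 d) tau (s *: rot90 d) = s ^+ 2 *: gtr d tau.
Proof.
rewrite /gtr !bilE !rvZ -!mul_mpolyC expr2 !mpolyCM; ring.
Qed.

Lemma tr2_unit (s : R) d tau : s ^+ 2 * dot d d = 1 ->
  tr2 (s *: rot90 d) tau = s ^+ 3 *: ttr d tau.
Proof.
move=> s1; have rr : rot90 (s *: rot90 d) = - s *: d.
  by apply: eq_plane; rewrite ?rot0 ?rot1 !rvZ ?rot0 ?rot1 ?mulrN ?mulNr ?opprK.
have s3 : s ^+ 3 *: (dot d d *: wdot (rot90 d) (divm tau)) = s *: wdot (rot90 d) (divm tau).
  by rewrite scalerA exprS -mulrA s1 mulr1.
rewrite /tr2 rr /ttr scalerDr s3; congr (_ + _).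
  rewrite !bilE !dirderE !rvZ !mderivD !mderivZ -!mul_mpolyC.
  rewrite !exprS expr0 !(mpolyCM, mpolyCN) mpolyC1; ring.
rewrite sum_ord2 /wdot !rvZ scalerDr !scalerA //.
Qed.

Definition cr (u v : plane) : R := u 0 0 * v 0 1 - u 0 1 * v 0 0.

(** The barycentric coordinate of c in the triangle abc. *)
Definition bary a b c : pol := (cr (b - a) (c - a))^-1 *:
  ((b - a) 0 0 *: (Xv 1 - mpolyC 2 (a 0 1)) - (b - a) 0 1 *: (Xv 0 - mpolyC 2 (a 0 0))).

Lemma bary_eval a b c x : peval (bary a b c) x = cr (b - a) (x - a) / cr (b - a) (c - a).
Proof. by rewrite /bary !pevalE mulrC /cr !mxE. Qed.

Lemma msz_bary a b c : (msz (bary a b c) <= 2)%N.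
Proof.
by apply/mszZ/mszB; apply/mszZ/mszB; rewrite ?mszX// mszC.
Qed.

Lemma cr_rot a b c : cr (c - b) (a - b) = cr (b - a) (c - a).
Proof. by rewrite /cr !mxE; ring. Qed.

Lemma cr_swap a b c : cr (c - a) (b - a) = - cr (b - a) (c - a).
Proof. by rewrite /cr !mxE; ring. Qed.

Lemma cr_self a b : cr (b - a) (b - a) = 0.
Proof. by rewrite /cr mulrC subrr. Qed.

Lemma bary_a a b c : peval (bary a b c) a = 0.
Proof. by rewrite bary_eval subrr /cr !mxE !mulr0 subrr mul0r. Qed.
Lemma bary_b a b c : peval (bary a b c) b = 0.
Proof. by rewrite bary_eval cr_self mul0r. Qed.
Lemma bary_c a b c : cr (b - a) (c - a) != 0 -> peval (bary a b c) c = 1.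
Proof. by move=> D0; rewrite bary_eval divff. Qed.

Lemma res_affine a b p : (msz p <= 2)%N ->
  res a b p = (peval p a)%:P + (peval p b - peval p a)%:P * 'X.
Proof.
move=> hp; have := leq_trans (size_res a b p) hp; rewrite -(res_at0 a b) -(res_at1 a b).
move: (res a b p) => r hr; have rE : r = (r`_0)%:P + (r`_1)%:P * 'X.
  apply/polyP => -[|[|i]]; rewrite coefD coefC coefCM coefX /= ?mulr0 ?addr0 ?mulr1 ?add0r//.
  by rewrite nth_default// (leq_trans hr).
have h1 : r.[1] = r`_0 + r`_1 by rewrite {1}rE !hornerE.
by rewrite horner_coef0 h1 [_ + _ - _]addrAC subrr add0r.
Qed.

Lemma res_bary_ab a b c : res a b (bary a b c) = 0.
Proof. by rewrite res_affine ?msz_bary// bary_a bary_b subrr mul0r addr0. Qed.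
Lemma res_bary_bc a b c : cr (b - a) (c - a) != 0 -> res b c (bary a b c) = 'X.
Proof. by move=> ?; rewrite res_affine ?msz_bary// bary_b bary_c// subr0 mul1r add0r. Qed.

Lemma res_swap0 a b p : res a b p = 0 -> res b a p = 0.
Proof. by move=> h; rewrite res_swap h comp_poly0. Qed.

(** A power of the barycentric coordinate of c is invertible on jets at c and
    flat at the other two vertices. *)
Lemma vertex_jet (M N : nat) a b c f : (M.*2 < N)%N -> cr (b - a) (c - a) != 0 ->
  exists p, [/\ (msz p <= N.+1)%N, flat c M.+1 (p - f), flat a M.+1 p & flat b M.+1 p].
Proof.
move=> MN D0; pose l := bary a b c; pose h := \sum_(i < M.+1) (1 - l) ^+ i.
pose e := (N - M)%N.
have lh : l * h = 1 - (1 - l) ^+ M.+1.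
  have := subrX1 (1 - l) M.+1; rewrite -/h => H.
  by apply: oppr_inj; rewrite opprB H -mulNr; congr (_ * _); ring.
have inv : flat c M.+1 (l ^+ e * h ^+ e - 1).
  rewrite -exprMn subrX1; apply: flatMl; rewrite lh addrAC subrr add0r.
  apply/flatN/flatX; rewrite pevalB bary_c// -[1]/(mpolyC 2 1) pevalC subrr //.
have [t [ht ft]] := taylor c (f * h ^+ e) M.+1.
exists (l ^+ e * t); split.
- have -> : N.+1 = (e * 1 + M).+1 by rewrite muln1 /e; lia.
  by apply: mszM => //; apply: mszM_exp; exact: msz_bary.
- have -> : l ^+ e * t - f = f * (l ^+ e * h ^+ e - 1) - l ^+ e * (f * h ^+ e - t) by ring.
  by apply: flatB; apply: flatMr.
- apply/flatMl/(@flat_le _ _ _ e); first by rewrite /e; lia.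
  by apply: flatX; exact: bary_a.
- apply/flatMl/(@flat_le _ _ _ e); first by rewrite /e; lia.
  by apply: flatX; exact: bary_b.
Qed.

(** The data are a multiple of (s (1 - s))^(M + 1), which extends as a power of
    the product of the barycentric coordinates of a and b; the cofactor is
    evaluated at the coordinate of b. *)
Lemma edge_bubble (M N : nat) a b c (P : {poly R}) : (M.*2 < N)%N ->
  cr (b - a) (c - a) != 0 -> (size P <= N.+1)%N -> uflat 0 M.+1 P -> uflat 1 M.+1 P ->
  exists p, [/\ (msz p <= N.+1)%N, res a b p = P,
    [/\ flat a M.+1 p, flat b M.+1 p & flat c M.+1 p] &
    [/\ res a c p = 0, res c a p = 0, res b c p = 0 & res c b p = 0]].
Proof.
move=> MN D0 hP f0 f1; have [r PE hr] := uflat_factor01 f0 f1.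
have Da : cr (c - b) (a - b) != 0 by rewrite cr_rot.
have Db : cr (a - c) (b - c) != 0 by rewrite cr_rot.
have [r0|r0] := eqVneq r 0.
  exists 0; rewrite PE r0 mulr0 /res !rmorph0 msz0; split=> //.
  by split; exact: flat0.
have szr : (0 < size r)%N by rewrite size_poly_gt0.
pose la := bary b c a; pose lb := bary c a b.
have rla : res a b la = 1 - 'X.
  rewrite res_affine ?msz_bary// bary_c// bary_a sub0r polyCN mulNr mul1r //.
have rlb : res a b lb = 'X by exact: res_bary_bc.
exists (la ^+ M.+1 * lb ^+ M.+1 * ucomp r lb); split.
- have -> : N.+1 = ((M.+1 * 1 + M.+1 * 1) + (N - M.+1.*2)).+1 by lia.
  apply: mszM; last first.
    by apply: msz_ucomp; [exact: msz_bary | apply: leq_trans hr _; lia].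
  by apply: mszM; apply: mszM_exp; exact: msz_bary.
- rewrite !resM !rmorphXn /= rla rlb res_ucomp rlb comp_polyXr PE; ring.
- split; apply: flatMl.
  + by apply/flatMr/flatX; exact: bary_b.
  + by apply/flatMl/flatX; exact: bary_a.
  + by apply/flatMl/flatX; exact: bary_b.
- have ac0 : res a c (la ^+ M.+1 * lb ^+ M.+1 * ucomp r lb) = 0.
    rewrite !resM !rmorphXn /= [res a c lb]res_swap.
    by rewrite res_bary_ab comp_poly0 expr0n /= mulr0 mul0r.
  have bc0 : res b c (la ^+ M.+1 * lb ^+ M.+1 * ucomp r lb) = 0.
    by rewrite !resM !rmorphXn /= res_bary_ab expr0n /= !mul0r.
  by split=> //; apply: res_swap0.
Qed.

(** The three vertex jets are interpolated first, which is possible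
    independently since 2 M < N. What remains on each edge is flat at its ends
    and extends by a bubble that vanishes on the other two edges. *)
Lemma triangle_interp (M N : nat) a b c fa fb fc (Pab Pbc Pac : {poly R}) :
  (M.*2 < N)%N -> cr (b - a) (c - a) != 0 ->
  (size Pab <= N.+1)%N -> (size Pbc <= N.+1)%N -> (size Pac <= N.+1)%N ->
  uflat 0 M.+1 (Pab - res a b fa) -> uflat 1 M.+1 (Pab - res a b fb) ->
  uflat 0 M.+1 (Pbc - res b c fb) -> uflat 1 M.+1 (Pbc - res b c fc) ->
  uflat 0 M.+1 (Pac - res a c fa) -> uflat 1 M.+1 (Pac - res a c fc) ->
  exists p, [/\ (msz p <= N.+1)%N,
    [/\ flat a M.+1 (p - fa), flat b M.+1 (p - fb) & flat c M.+1 (p - fc)] &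
    [/\ res a b p = Pab, res b c p = Pbc & res a c p = Pac]].
Proof.
move=> MN D0 sab sbc sac ab0 ab1 bc0 bc1 ac0 ac1.
have Da : cr (c - b) (a - b) != 0 by rewrite cr_rot.
have Db : cr (a - c) (b - c) != 0 by rewrite cr_rot.
have Dc : cr (c - a) (b - a) != 0 by rewrite cr_swap oppr_eq0.
have [pc [sc fcc fca fcb]] := vertex_jet fc MN D0.
have [pa [sa faa fab fac]] := vertex_jet fa MN Da.
have [pb [sb fbb fbc fba]] := vertex_jet fb MN Db.
pose v := pa + pb + pc.
have va : flat a M.+1 (v - fa).
  have -> : v - fa = (pa - fa) + pb + pc by rewrite /v; ring.
  by do 2 apply: flatD => //.
have vb : flat b M.+1 (v - fb).
  have -> : v - fb = (pb - fb) + pa + pc by rewrite /v; ring.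
  by do 2 apply: flatD => //.
have vc : flat c M.+1 (v - fc).
  have -> : v - fc = (pc - fc) + pa + pb by rewrite /v; ring.
  by do 2 apply: flatD => //.
have sv : (msz v <= N.+1)%N by do 2 apply: mszD => //.
have rsz x y : (size (res x y v) <= N.+1)%N by exact: leq_trans (size_res _ _ _) sv.
have szB (P Q : {poly R}) : (size P <= N.+1 -> size Q <= N.+1 -> size (P - Q)%R <= N.+1)%N.
  by move=> hp hq; apply: leq_trans (size_polyD _ _) _; rewrite size_polyN geq_max hp.
have J0 x y f (P : {poly R}) : flat x M.+1 (v - f) -> uflat 0 M.+1 (P - res x y f) ->
    uflat 0 M.+1 (P - res x y v).
  move=> h1 h2; apply: uflat_trans h2 _; apply: uflat_subC.
  by rewrite -resB; apply: flat_res0.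
have J1 x y f (P : {poly R}) : flat y M.+1 (v - f) -> uflat 1 M.+1 (P - res x y f) ->
    uflat 1 M.+1 (P - res x y v).
  move=> h1 h2; apply: uflat_trans h2 _; apply: uflat_subC.
  by rewrite -resB; apply: flat_res1.
have [eab [s1 r1 [f1a f1b f1c] [z1 z2 z3 z4]]] :=
  edge_bubble MN D0 (szB _ _ sab (rsz a b)) (J0 _ _ _ _ va ab0) (J1 _ _ _ _ vb ab1).
have [ebc [s2 r2 [f2b f2c f2a] [y1 y2 y3 y4]]] :=
  edge_bubble MN Da (szB _ _ sbc (rsz b c)) (J0 _ _ _ _ vb bc0) (J1 _ _ _ _ vc bc1).
have [eac [s3 r3 [f3a f3c f3b] [x1 x2 x3 x4]]] :=
  edge_bubble MN Dc (szB _ _ sac (rsz a c)) (J0 _ _ _ _ va ac0) (J1 _ _ _ _ vc ac1).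
have dE q : v + eab + ebc + eac - q = (v - q) + eab + ebc + eac by ring.
exists (v + eab + ebc + eac); split.
- by do 3 apply: mszD => //.
- by split; rewrite dE; do 3 apply: flatD => //.
rewrite !resD r1 r2 r3 z1 z3 y2 y4 x1 x4 !(addr0, add0r).
by split; rewrite -!resD -/v addrC subrK.
Qed.

End Triangle.

(** * The boundary map of a conforming mesh *)

Section Combinatorics.

(** A matrix with independent rows has a right inverse. *)
Lemma solvable_of_transpose (F : fieldType) (T E : finType) (B : T -> E -> F) :
  (forall y : T -> F, (forall e, \sum_K y K * B K e = 0) -> forall K, y K = 0) ->
  forall m : T -> F, exists x : E -> F, forall K, \sum_e B K e * x e = m K.
Proof.
move=> inj m.
pose A : 'M[F]_(#|T|, #|E|) := \matrix_(i, j) B (enum_val i) (enum_val j).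
have /row_freeP[C AC] : row_free A.
  apply: inj_row_free => v vA; apply/rowP => i; rewrite mxE.
  have := inj (fun K => v 0 (enum_rank K)) _ (enum_val i); rewrite enum_valK; apply.
  move=> e; have := congr1 (fun u : 'rV_#|E| => u 0 (enum_rank e)) vA; rewrite !mxE => h; rewrite -[RHS]h.
  rewrite (reindex (@enum_val T predT)) /=; last by exists enum_rank => ? _; rewrite ?enum_rankK ?enum_valK.
  by apply: eq_bigr => j _; rewrite mxE enum_valK enum_rankK.
pose u := C *m \col_i m (enum_val i).
exists (fun e => u (enum_rank e) 0) => K.
have : (A *m u) (enum_rank K) 0 = m K by rewrite /u mulmxA AC mul1mx mxE enum_rankK.
rewrite mxE => <-.
rewrite (reindex (@enum_val E predT)) /=; last by exists enum_rank => ? _; rewrite ?enum_rankK ?enum_valK.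
by apply: eq_bigr => j _; rewrite enum_valK [A _ _]mxE enum_rankK.
Qed.

Lemma sum_set3 (V : nmodType) (T : finType) (S : {set T}) a b c (F : T -> V) :
  S = [set a; b; c]%SET -> #|S| = 3%N -> \sum_(v in S) F v = F a + F b + F c.
Proof.
move=> SE cS.
have [ab ca cb] : [/\ a != b, c != a & c != b].
  move: cS; rewrite SE finset.setUC cardsU1 cards2 !inE negb_or.
  by case: (a != b); case: (c != a); case: (c != b).
rewrite SE finset.setUC big_setU1 ?inE ?negb_or ?ca//=.
by rewrite big_setU1 ?inE//= big_set1 addrC.
Qed.

Lemma set3_neq (T : finType) (S : {set T}) a b c :
  S = [set a; b; c]%SET -> #|S| = 3%N -> [/\ a != b, b != c & a != c].
Proof.
move=> SE; rewrite SE finset.setUC cardsU1 cards2 !inE negb_or ![c == _]eq_sym.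
by case: (a != b); case: (a != c); case: (b != c).
Qed.

Lemma set3_rot (T : finType) (a b c : T) : [set a; b; c]%SET = [set b; c; a]%SET.
Proof. by apply/finset.setP => x; rewrite !inE -orbA orbC. Qed.

Lemma set3_of_card (T : finType) (S : {set T}) : #|S| = 3%N ->
  exists a b c, S = [set a; b; c]%SET.
Proof.
move=> cS; have : enum S != [::] by rewrite -size_eq0 -cardE cS.
move: cS; rewrite cardE; case E : (enum S) => [|a [|b [|c [|]]]] //= _ _.
exists a, b, c; apply/finset.setP => x; rewrite -mem_enum E !inE.
by rewrite orbA.
Qed.

Lemma set3_third (T : finType) (S : {set T}) a b : #|S| = 3%N -> a != b ->
  a \in S -> b \in S -> exists c, S = [set a; b; c]%SET.
Proof.
move=> cS ab aS bS.
have /cards1P[c cE] : #|S :\: [set a; b]%SET| == 1%N.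
  rewrite cardsD cS (finset.setIidPr _) ?cards2 ?ab//.
  by apply/fintype.subsetP => x; rewrite !inE => /orP[] /eqP ->.
exists c.
apply/finset.setP => x; have := congr1 (fun A : {set T} => x \in A) cE; rewrite !inE.
case: (eqVneq x a) => [->|xa]; first by rewrite aS.
case: (eqVneq x b) => [->|xb]; first by rewrite bS.
by rewrite /= => ->.
Qed.

End Combinatorics.

Section MeshGeometry.
Variables (R : realType) (Th : mesh R) (Omega : set 'rV[R]_2).
Hypothesis conf : conforming_triangulation Th Omega.
Local Notation plane := 'rV[R]_2.
Implicit Types (K L : triangle Th) (a b c u v : vertex Th) (x : plane).

Lemma coef_unique K (e f : vertex Th -> R) :
  \sum_(v in verts K) e v = \sum_(v in verts K) f v ->
  \sum_(v in verts K) e v *: pos v = \sum_(v in verts K) f v *: pos v ->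
  forall v, v \in verts K -> e v = f v.
Proof.
move=> h1 h2 v vK; apply/eqP; rewrite -subr_eq0; apply/eqP.
apply: (verts_indep conf (c := fun v => e v - f v)) vK.
  by rewrite sumrB h1 subrr.
under eq_bigr do rewrite scalerBl.
by rewrite sumrB h2 subrr.
Qed.

(** Barycentric coordinates are unique and, by conformity, those of a common
    point of K and L can be supported in the common vertices. *)
Lemma support_common K L x (e : vertex Th -> R) :
  hull (verts K) x -> hull (verts L) x ->
  \sum_(v in verts K) e v = 1 -> x = \sum_(v in verts K) e v *: pos v ->
  forall v, v \in verts K -> e v != 0 -> v \in verts L.
Proof.
move=> xK xL e1 ex v vK.
have : (hull (verts K) `&` hull (verts L)) x by split.
rewrite (verts_conforming conf) => -[f [f0 f1 fx]].
pose g u := if u \in verts L then f u else 0.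
have -> : e v = g v.
  apply: (coef_unique (K := K)) => //; rewrite ?e1 -?ex.
    rewrite -[LHS]f1 [RHS]big_mkcond [LHS]big_mkcond; apply: eq_bigr => u _.
    by rewrite /g inE; case: (u \in verts K).
  rewrite [LHS]fx [RHS]big_mkcond [LHS]big_mkcond; apply: eq_bigr => u _.
  by rewrite /g inE; case: (u \in verts K); case: (u \in verts L); rewrite /= ?scale0r.
by rewrite /g; case: ifP => // _; rewrite eqxx.
Qed.

Lemma verts_sub_eq K L : verts K \subset verts L -> K = L.
Proof.
move=> KL; apply: (verts_inj conf); apply/eqP.
by rewrite eqEcard KL !(verts_card conf).
Qed.

Lemma hull3 K a b c x (ea eb ec : R) : verts K = [set a; b; c]%SET ->
  0 <= ea -> 0 <= eb -> 0 <= ec -> ea + eb + ec = 1 ->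
  x = ea *: pos a + eb *: pos b + ec *: pos c -> hull (verts K) x.
Proof.
move=> KE ha hb hc h1 hx.
have [ab bc ac] := set3_neq KE (verts_card conf K).
exists (fun v => if v == a then ea else if v == b then eb else if v == c then ec else 0); split.
- by move=> v; do 3 case: ifP => // _.
- rewrite (sum_set3 _ KE (verts_card conf K)) !eqxx.
  by rewrite (eq_sym b) (negbTE ab) !(eq_sym c) (negbTE ac) (negbTE bc).
- rewrite (sum_set3 _ KE (verts_card conf K)) !eqxx.
  by rewrite (eq_sym b) (negbTE ab) !(eq_sym c) (negbTE ac) (negbTE bc).
Qed.

Lemma support3 K L a b c x (ea eb ec : R) : verts K = [set a; b; c]%SET ->
  0 <= ea -> 0 <= eb -> 0 < ec -> ea + eb + ec = 1 ->
  x = ea *: pos a + eb *: pos b + ec *: pos c -> hull (verts L) x -> c \in verts L.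
Proof.
move=> KE ha hb hc h1 hx xL.
have [ab bc ac] := set3_neq KE (verts_card conf K).
have xK := hull3 KE ha hb (ltW hc) h1 hx.
pose e v := if v == a then ea else if v == b then eb else ec.
have ec' : e c = ec by rewrite /e !(eq_sym c) (negbTE ac) (negbTE bc).
apply: (support_common (K := K) (e := e) xK xL).
- rewrite (sum_set3 _ KE (verts_card conf K)) ec' /e !eqxx.
  by rewrite (eq_sym b) (negbTE ab).
- rewrite (sum_set3 _ KE (verts_card conf K)) ec' /e !eqxx.
  by rewrite (eq_sym b) (negbTE ab).
- by rewrite KE !inE eqxx orbT.
- by rewrite ec' gt_eqF.
Qed.

Lemma cr_neq0 K a b c : verts K = [set a; b; c]%SET ->
  cr (pos b - pos a) (pos c - pos a) != 0.
Proof.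
move=> KE; apply/eqP => D0.
have [ab bc ac] := set3_neq KE (verts_card conf K).
have rel (s t : R) : s *: (pos b - pos a) + t *: (pos c - pos a) = 0 -> s = 0 /\ t = 0.
  move=> h.
  pose e v := if v == a then - s - t else if v == b then s else t.
  have ec' : e c = t by rewrite /e !(eq_sym c) (negbTE ac) (negbTE bc).
  have eb' : e b = s by rewrite /e (eq_sym b) (negbTE ab) eqxx.
  have ea' : e a = - s - t by rewrite /e eqxx.
  have z v : v \in verts K -> e v = 0.
    apply: (verts_indep conf (c := e)).
      by rewrite (sum_set3 _ KE (verts_card conf K)) ea' eb' ec'; ring.
    rewrite (sum_set3 _ KE (verts_card conf K)) ea' eb' ec' -h.
    by rewrite scalerBl !scalerBr scaleNr; apply: eq_plane; rewrite !mxE; ring.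
  by rewrite -eb' -ec' !z // KE !inE eqxx ?orbT.
set p := pos b - pos a in D0 rel; set q := pos c - pos a in D0 rel.
rewrite /cr in D0; clearbody p q.
have [] := rel (- q 0 1) (p 0 1).
  by apply: eq_plane; rewrite !mxE; lra.
move=> /eqP; rewrite oppr_eq0 => /eqP q1 p1.
have [] := rel (- q 0 0) (p 0 0).
  by apply: eq_plane; rewrite !mxE; lra.
move=> /eqP; rewrite oppr_eq0 => /eqP q0 p0.
have [] := rel 1 0; last by move=> /eqP; rewrite oner_eq0.
by apply: eq_plane; rewrite !mxE ?p0 ?p1 ?q0 ?q1; ring.
Qed.

(** Near the midpoint of the edge, on its inner side, the two triangles
    overlap; conformity allows this only if they share all vertices. *)
Lemma same_side K L a b c c' : verts K = [set a; b; c]%SET ->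
  verts L = [set a; b; c']%SET ->
  0 < cr (pos b - pos a) (pos c - pos a) * cr (pos b - pos a) (pos c' - pos a) -> K = L.
Proof.
move=> KE LE; set D := cr _ (pos c - _); set D' := cr _ (pos c' - _) => DD.
have D'0 : D' != 0 by exact: cr_neq0 LE.
pose g := D / D'; pose al := cr (pos c - pos a) (pos c' - pos a) / D'.
have g0 : 0 < g.
  have : 0 < (D * D') / D' ^+ 2 by rewrite divr_gt0// exprn_even_gt0.
  by rewrite expr2 invfM mulrA mulfK.
pose n : R := 4 + 2 * `|al| + 2 * g.
have n0 : 0 < n by rewrite /n; have := normr_ge0 al; lra.
pose e : R := n^-1.
have e0 : 0 < e by rewrite invr_gt0.
have en : e * n = 1 by rewrite mulVf // gt_eqF.
pose x := ((1 - e) / 2) *: pos a + ((1 - e) / 2) *: pos b + e *: pos c.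
have e1 : e <= 4^-1.
  by rewrite /e lef_pV2 ?posrE// /n; have := normr_ge0 al; lra.
have cE : pos c = (1 - al - g) *: pos a + al *: pos b + g *: pos c'.
  have alD : al * D' = cr (pos c - pos a) (pos c' - pos a) by rewrite divfK.
  have gD : g * D' = D by rewrite divfK.
  have comb (p q r : R) : ((1 - al - g) * p + al * q + g * r) * D' =
      D' * p - (al * D') * p - (g * D') * p + (al * D') * q + (g * D') * r by ring.
  apply: eq_plane; rewrite !mxE; apply: (mulIf D'0);
  rewrite comb alD gD /D /D' /cr !mxE; ring.
have xE : x = ((1 - e) / 2 + e * (1 - al - g)) *: pos a
  + ((1 - e) / 2 + e * al) *: pos b + (e * g) *: pos c'.
  by rewrite /x {1}cE; apply: eq_plane; rewrite !mxE; ring.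
have eal : `|e * al| + e * g <= (1 - 4 * e) / 2.
  have -> : `|e * al| = e * `|al| by rewrite normrM gtr0_norm.
  by move: en; rewrite /n; lra.
have eg : 0 < e * g by rewrite mulr_gt0.
have := ler_norm (e * al); have := ler_norm (- (e * al)); rewrite normrN => h1 h2.
have xL : hull (verts L) x.
  apply: (hull3 LE _ _ _ _ xE); last by field.
  - lra.
  - lra.
  - exact: ltW.
have cL : c \in verts L.
  apply: (support3 KE _ _ e0 _ _ xL); last by [].
  - lra.
  - lra.
  - by field.
apply: verts_sub_eq; rewrite KE; apply/fintype.subsetP => v.
by rewrite !inE => /orP[/orP[]|] /eqP ->; rewrite ?cL// LE !inE eqxx ?orbT.
Qed.

(** The sign with which the ordered pair (u, v) lies in the boundary of the
    counterclockwise triangle K. *)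
Definition orient K u v : R :=
  if (u \in verts K) && (v \in verts K)
  then \sum_(c in verts K) Num.sg (cr (pos v - pos u) (pos c - pos u)) else 0.

Lemma orient3 K a b c : verts K = [set a; b; c]%SET ->
  orient K a b = Num.sg (cr (pos b - pos a) (pos c - pos a)).
Proof.
move=> KE; rewrite /orient KE !inE !eqxx ?orbT /= -KE (sum_set3 _ KE (verts_card conf K)).
by rewrite subrr cr_self /cr !mxE !mulr0 subrr sgr0 !add0r.
Qed.

Lemma orient_refl K u : orient K u u = 0.
Proof.
rewrite /orient; case: ifP => // _; apply: big1 => c _.
by rewrite subrr /cr !mxE !mul0r subrr sgr0.
Qed.

Lemma orientN K u v : orient K u v = - orient K v u.
Proof.
rewrite /orient andbC; case: ifP => [/andP[vK uK]|_]; last by rewrite oppr0.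
have [->|uv] := eqVneq u v.
  by rewrite big1 ?oppr0// => c _; rewrite subrr /cr !mxE !mul0r subrr sgr0.
have [c KE] := set3_third (verts_card conf K) uv uK vK.
rewrite !(sum_set3 _ KE (verts_card conf K)) !subrr !cr_self.
have z (w : plane) : cr w 0 = 0 by rewrite /cr !mxE !mulr0 subrr.
rewrite !z sgr0 !add0r ?addr0 -sgrN; congr Num.sg.
by rewrite /cr !mxE; ring.
Qed.

Lemma sum_orient K a b c (F : vertex Th -> vertex Th -> R) : verts K = [set a; b; c]%SET ->
  \sum_(uv : vertex Th * vertex Th) orient K uv.1 uv.2 * F uv.1 uv.2 =
  Num.sg (cr (pos b - pos a) (pos c - pos a)) *
  ((F a b - F b a) + (F b c - F c b) + (F c a - F a c)).
Proof.
move=> KE; rewrite -(pair_bigA _ (fun u v => orient K u v * F u v)) /=.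
have red (G : vertex Th -> R) : (forall u, u \notin verts K -> G u = 0) ->
    \sum_u G u = G a + G b + G c.
  move=> h; rewrite -(sum_set3 _ KE (verts_card conf K)) [RHS]big_mkcond /=.
  by apply: eq_bigr => u _; case: ifP => // /negbT /h.
have oz u v : (u \notin verts K) || (v \notin verts K) -> orient K u v * F u v = 0.
  by rewrite /orient -negb_and => /negbTE ->; rewrite mul0r.
rewrite red; last by move=> u hu; apply: big1 => v _; rewrite oz// hu.
rewrite !red; try by move=> u hu; rewrite oz// hu orbT.
have KE2 : verts K = [set b; c; a]%SET by rewrite KE set3_rot.
have KE3 : verts K = [set c; a; b]%SET by rewrite KE2 set3_rot.
rewrite !orient_refl (orientN K b a) (orientN K c b) (orientN K a c).
rewrite (orient3 KE) (orient3 KE2) (orient3 KE3) (cr_rot (pos b) (pos c) (pos a)) (cr_rot (pos a) (pos b) (pos c)); ring.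
Qed.

Lemma orient_val K u v : orient K u v != 0 ->
  exists c, [/\ verts K = [set u; v; c]%SET &
   orient K u v = Num.sg (cr (pos v - pos u) (pos c - pos u))].
Proof.
have [->|uv] := eqVneq u v; first by rewrite orient_refl eqxx.
rewrite {1}/orient; case: ifP => [/andP[uK vK] _|]; last by rewrite eqxx.
have [c KE] := set3_third (verts_card conf K) uv uK vK.
by exists c; split=> //; rewrite (orient3 KE).
Qed.

Lemma orient_inj K L u v : orient K u v != 0 -> orient K u v = orient L u v -> K = L.
Proof.
move=> h0 e; have [c [KE oK]] := orient_val h0.
have [|c' [LE oL]] := @orient_val L u v; first by rewrite -e.
apply: (same_side KE LE); rewrite -sgr_gt0 sgrM -oK -oL -e -expr2.
by rewrite exprn_even_gt0.
Qed.

(** An oriented edge bounds at most one triangle on each side. Hence, if the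
    boundaries of the K weighted by y K cancel, so do those weighted by (y
    K)^2. Pairing the latter with the area form, the areas weighted by (y K)^2
    add up to 0. *)
Lemma boundary_inj (y : triangle Th -> R) :
  (forall u v, \sum_K y K * orient K u v = 0) -> forall K, y K = 0.
Proof.
move=> hy.
have ov K u v : [\/ orient K u v = 0, orient K u v = 1 | orient K u v = -1].
  have [->|h] := eqVneq (orient K u v) 0; first by apply: Or31.
  have [c [KE ->]] := orient_val h; have D0 := cr_neq0 KE.
  by case: sgrP D0 => //= _ _; [apply: Or32|apply: Or33].
have split (z : triangle Th -> R) u v : \sum_K z K * orient K u v =
    \sum_(K | orient K u v == 1) z K - \sum_(K | orient K u v == -1) z K.
  rewrite [X in X - _]big_mkcond [X in _ - X]big_mkcond -sumrB; apply: eq_bigr => K _.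
  have n1 : (1 == -1 :> R) = false by apply/eqP; lra.
  have n2 : (-1 == 1 :> R) = false by apply/eqP; lra.
  by case: (ov K u v) => ->; rewrite ?eqxx ?n1 ?n2 ?(eq_sym 0) ?oppr_eq0 ?oner_eq0; ring.
have sq (s : R) u v : s != 0 -> \sum_(K | orient K u v == s) y K ^+ 2 =
    (\sum_(K | orient K u v == s) y K) ^+ 2.
  move=> s0; case: (pickP (fun K => orient K u v == s)) => [K0 /eqP h0|h0]; last first.
    by rewrite !big_pred0// expr0n.
  have e K : (orient K u v == s) = (K == K0).
    apply/eqP/eqP => [h|->//]; apply: (@orient_inj K K0 u v); first by rewrite h.
    by rewrite h h0.
  by rewrite !(eq_bigl _ _ e) !big_pred1_eq.
have hsq u v : \sum_K y K ^+ 2 * orient K u v = 0.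
  have h := hy u v; rewrite split in h; rewrite split !sq ?oppr_eq0 ?oner_eq0//.
  by move: h => /eqP; rewrite subr_eq0 => /eqP ->; rewrite subrr.
pose A K := \sum_(uv : vertex Th * vertex Th) orient K uv.1 uv.2 * cr (pos uv.1) (pos uv.2).
have A0 K : 0 < A K.
  have [a [b [c KE]]] := set3_of_card (verts_card conf K).
  rewrite /A (sum_orient (fun u v => cr (pos u) (pos v)) KE).
  have -> : cr (pos a) (pos b) - cr (pos b) (pos a) + (cr (pos b) (pos c) - cr (pos c) (pos b)) +
    (cr (pos c) (pos a) - cr (pos a) (pos c)) = 2 * cr (pos b - pos a) (pos c - pos a).
    by rewrite /cr !mxE; ring.
  by rewrite mulrCA -normrEsg mulr_gt0// normr_gt0 (cr_neq0 KE).
have : \sum_K y K ^+ 2 * A K = 0.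
  rewrite /A; under eq_bigr do rewrite mulr_sumr.
  rewrite exchange_big /=; apply: big1 => -[u v] _ /=.
  under eq_bigr do rewrite mulrA.
  by rewrite -mulr_suml hsq mul0r.
move=> /eqP; rewrite psumr_eq0; last by move=> K _; rewrite mulr_ge0 ?sqr_ge0// ltW.
move=> /allP h K; have := h K (mem_index_enum _); rewrite mulf_eq0 (gt_eqF (A0 K)) orbF.
by rewrite sqrf_eq0 => /eqP.
Qed.

(** Dual to boundary_inj; the orientation of the list of vertices is absorbed
    in the right-hand side. *)
Lemma circulation_surj (ta tb tc : triangle Th -> vertex Th) (m : triangle Th -> R) :
  (forall K, verts K = [set ta K; tb K; tc K]%SET) ->
  exists x : vertex Th -> vertex Th -> R,
    forall K, x (ta K) (tb K) + x (tb K) (tc K) - x (ta K) (tc K) = m K.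
Proof.
move=> tE.
pose s K := Num.sg (cr (pos (tb K) - pos (ta K)) (pos (tc K) - pos (ta K))).
have [|z hz] := @solvable_of_transpose R (triangle Th) (vertex Th * vertex Th)%type
   (fun K uv => orient K uv.1 uv.2) _ (fun K => s K * m K).
  by move=> y hy; apply: boundary_inj => u v; exact: (hy (u, v)).
exists (fun u v => z (u, v) - z (v, u)) => K; have := hz K.
have s0 : s K != 0 by rewrite sgr_eq0 (cr_neq0 (tE K)).
rewrite (eq_bigr (fun uv => orient K uv.1 uv.2 * z (uv.1, uv.2))); last by case.
rewrite (sum_orient (fun u v => z (u, v)) (tE K)) -/(s K) => /(mulfI s0) <-.
by ring.
Qed.

End MeshGeometry.

(** * Edge data of symmetric curls *)

Section EdgeData.
Variable R : realType.
Local Notation plane := 'rV[R]_2.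
Local Notation pol := (mpoly 2 R).
Local Notation Xv i := (mpolyX R (mnm1 (i : 'I_2))).
Implicit Types (p q f : pol) (a b c d e n v x al : plane) (w z : 'rV[pol]_2).
Implicit Types (tau : 'M[pol]_2) (P Q : {poly R}).

Lemma wdotD e w z : wdot e (w + z) = wdot e w + wdot e z.
Proof. by rewrite /wdot !mxE !scalerDr addrACA. Qed.

Lemma wdotN e w : wdot e (- w) = - wdot e w.
Proof. by rewrite /wdot !mxE !scalerN opprD. Qed.

Lemma wdotB e w z : wdot e (w - z) = wdot e w - wdot e z.
Proof. by rewrite wdotD wdotN. Qed.

Lemma divmD tau (s : 'M[pol]_2) : divm (tau + s) = divm tau + divm s.
Proof.
by apply/matrixP => i j; rewrite ord1 [RHS]mxE !divmE !mxE !mderivD addrACA.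
Qed.

Lemma bilD d tau (s : 'M[pol]_2) n : bil d (tau + s) n = bil d tau n + bil d s n.
Proof. by rewrite !bilE !mxE !scalerDr -!mul_mpolyC; ring. Qed.

Lemma gtrD d tau (s : 'M[pol]_2) : gtr d (tau + s) = gtr d tau + gtr d s.
Proof. exact: bilD. Qed.

Lemma ttrD d tau (s : 'M[pol]_2) : ttr d (tau + s) = ttr d tau + ttr d s.
Proof. by rewrite /ttr bilD divmD wdotD dirderD scalerDr addrACA. Qed.

Lemma divmN tau : divm (- tau) = - divm tau.
Proof.
by apply/matrixP => i j; rewrite ord1 [RHS]mxE !divmE !mxE !mderivN opprD.
Qed.

Lemma bilN d tau n : bil d (- tau) n = - bil d tau n.
Proof. by rewrite !bilE !mxE !scalerN -!mul_mpolyC; ring. Qed.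

Lemma gtrB d tau (s : 'M[pol]_2) : gtr d (tau - s) = gtr d tau - gtr d s.
Proof. by rewrite gtrD /gtr bilN. Qed.

Lemma ttrB d tau (s : 'M[pol]_2) : ttr d (tau - s) = ttr d tau - ttr d s.
Proof. by rewrite ttrD /ttr bilN divmN wdotN dirderN scalerN -opprD. Qed.

Lemma rot90N d : rot90 (- d) = - rot90 d.
Proof. by apply: eq_plane; rewrite !mxE. Qed.

Lemma gtr_opp d tau : gtr (- d) tau = gtr d tau.
Proof.
have rN (u : plane) (i : 'I_2) : (- u) 0 i = - u 0 i by rewrite mxE.
by rewrite /gtr rot90N !bilE !rN !mulrNN.
Qed.

Lemma ttr_opp d tau : ttr (- d) tau = - ttr d tau.
Proof.
have rN (u : plane) (i : 'I_2) : (- u) 0 i = - u 0 i by rewrite mxE.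
rewrite /ttr rot90N !bilE !dirderE !dotE /wdot !rN !mulrNN -!mul_mpolyC mpolyCN mpolyCN; ring.
Qed.

Lemma flat_bil v m d tau n : (forall i j, flat v m (tau i j)) -> flat v m (bil d tau n).
Proof. by move=> h; rewrite bilE; apply: flatD; apply: flatD; apply: flatZ. Qed.

Lemma flat_wdot v m d w : (forall i, flat v m (w 0 i)) -> flat v m (wdot d w).
Proof. by move=> h; apply: flatD; apply: flatZ. Qed.

Lemma flat_ttr v m d tau : (forall i j, flat v m.+1 (tau i j)) -> flat v m (ttr d tau).
Proof.
move=> h; apply: flatD; first exact/flat_dirder/flat_bil.
apply/flatZ/flat_wdot => i; rewrite divmE.
by apply: flatD; apply: flat_mderiv.
Qed.

Lemma msz_bil m d tau n : (forall i j, msz (tau i j) <= m)%N -> (msz (bil d tau n) <= m)%N.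
Proof. by move=> h; rewrite bilE; apply: mszD; apply: mszD; apply: mszZ. Qed.

Lemma msz_ttr m d tau : (forall i j, msz (tau i j) <= m.+1)%N -> (msz (ttr d tau) <= m)%N.
Proof.
move=> h; apply: mszD; first exact/msz_dirder/msz_bil.
apply/mszZ/mszD; apply: mszZ; rewrite divmE; apply: mszD; exact: msz_mderiv.
Qed.

Lemma wdot_rt_eval e al (c : R) x :
  peval (wdot e (rt_field al c)) x = dot e (al + c *: x).
Proof. by rewrite /wdot !rt_fieldE !pevalE dotE !mxE. Qed.

Lemma dirder_wdot_rt d al (c : R) :
  dirder d (wdot d (rt_field al c)) = mpolyC 2 (c * dot d d).
Proof.
rewrite dirderE /wdot !rt_fieldE !(mderivD, mderivZ, mderivC, mderivXU) dotE -!mul_mpolyC /=.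
by rewrite !(mpolyCD, mpolyCM, mpolyC0, mpolyC1); ring.
Qed.

Lemma dirder_wdot_rot_rt d al (c : R) :
  dirder d (wdot (rot90 d) (rt_field al c)) = 0.
Proof.
by apply: oppr_inj; rewrite -gtr_symcurl symcurl_rt /gtr bilE !mxE !scaler0 !addr0 oppr0.
Qed.

Lemma dot_frame d (s t : R) : dot d d != 0 ->
  dot (rot90 d) ((dot d d)^-1 *: (s *: rot90 d + t *: d)) = s /\
  dot d ((dot d d)^-1 *: (s *: rot90 d + t *: d)) = t.
Proof.
move=> L0.
have E (u : plane) (i : 'I_2) : ((dot d d)^-1 *: (s *: rot90 d + t *: d)) 0 i * dot d d =
    s * rot90 d 0 i + t * d 0 i.
  by rewrite rvZ mulrAC mulVf// mul1r !mxE.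
have F (u : plane) : dot u ((dot d d)^-1 *: (s *: rot90 d + t *: d)) * dot d d =
    dot u (s *: rot90 d + t *: d).
  by rewrite [dot u _]dotE mulrDl -!mulrA !E// dotE !mxE.
split; apply: (mulIf L0); rewrite F !dotE ![(_ + _ : plane) _ _]mxE !rvZ !rot0 !rot1; ring.
Qed.

(** The pair (P, Q) agrees to order m + 2, at the end s of the edge xy, with the
    normal and tangential traces of w. *)
Definition matches (m : nat) (s : R) x y P Q w : Prop :=
  uflat s m.+2 (P - res x y (wdot (rot90 (y - x)) w)) /\
  uflat s m.+2 (Q - res x y (wdot (y - x) w)).

Lemma matchesD m s x y P Q P' Q' w z : matches m s x y P Q w ->
  matches m s x y P' Q' z -> matches m s x y (P + P') (Q + Q') (w + z).
Proof.
move=> [h1 h2] [h3 h4]; split; rewrite wdotD resD opprD addrACA; exact: uflatD.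
Qed.

Lemma matches_res m s x y w :
  matches m s x y (res x y (wdot (rot90 (y - x)) w)) (res x y (wdot (y - x) w)) w.
Proof. by split; rewrite subrr; elim: (m.+2) => //= n IH; rewrite horner0 deriv0. Qed.

(** Integrating the edge data from a, where they agree with wa, determines (P,
    Q). At b the result differs from the traces of wb by a constant in the
    normal and an affine function in the tangential part, and these are the
    traces of exactly one field of RT. *)
Lemma edge_transport (m k : nat) a b wa wb (ga et : {poly R}) : a != b ->
  (size ga <= k.+1)%N -> (size et <= k)%N ->
  uflat 0 m.+1 (ga - res a b (gtr (b - a) (symcurl wa))) ->
  uflat 0 m (et - res a b (ttr (b - a) (symcurl wa))) ->
  uflat 1 m.+1 (ga - res a b (gtr (b - a) (symcurl wb))) ->
  uflat 1 m (et - res a b (ttr (b - a) (symcurl wb))) ->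
  exists (rho : plane * R) (P Q : {poly R}),
  [/\ P^`() = - ga, Q^`()^`() = - et, (size P <= k.+2)%N, (size Q <= k.+2)%N &
   matches m 0 a b P Q wa /\ matches m 1 a b P Q (wb + rt_field rho.1 rho.2)].
Proof.
move=> ab sg se ga0 et0 ga1 et1; set d := b - a; set N := rot90 d.
have L0 : dot d d != 0 by rewrite gt_eqF// dot_gt0// subr_eq0 eq_sym.
have linC (p q : {poly R}) (s : R) (n : nat) : (size p <= n.+1)%N -> (size (p + s%:P)%R <= n.+1)%N.
  move=> hp; apply: leq_trans (size_polyD _ _) _; rewrite geq_max hp /=.
  by apply: leq_trans (size_polyC_leq1 _) _.
pose P0 := uprim (- ga).
pose P := P0 + ((res a b (wdot N wa)).[0] - P0.[0])%:P.
have dP : P^`() = - ga by rewrite derivD derivC addr0 deriv_uprim.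
pose Q0 := uprim (- et).
pose Q1 := Q0 + ((res a b (wdot d wa))^`().[0] - Q0.[0])%:P.
pose Q2 := uprim Q1.
pose Q := Q2 + ((res a b (wdot d wa)).[0] - Q2.[0])%:P.
have dQ : Q^`() = Q1 by rewrite derivD derivC addr0 deriv_uprim.
have ddQ : Q^`()^`() = - et by rewrite dQ derivD derivC addr0 deriv_uprim.
have sP : (size P <= k.+2)%N.
  by apply: (linC _ 0); apply: leq_trans (size_uprim _) _; rewrite size_polyN.
have sQ : (size Q <= k.+2)%N.
  apply: (linC _ 0); apply: leq_trans (size_uprim _) _; rewrite ltnS.
  by apply: (linC _ 0); apply: leq_trans (size_uprim _) _; rewrite size_polyN.
pose dlP := P.[1] - peval (wdot N wb) b.
pose dlQ := Q.[1] - peval (wdot d wb) b.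
pose dlR := Q^`().[1] - peval (dirder d (wdot d wb)) b.
pose c := dlR / dot d d.
pose al := (dot d d)^-1 *: (dlP *: N + dlQ *: d) - c *: b.
exists (al, c), P, Q => /=.
have atb : al + c *: b = (dot d d)^-1 *: (dlP *: N + dlQ *: d) by rewrite /al subrK.
have rN : dot N (al + c *: b) = dlP.
  by rewrite atb; case: (dot_frame dlP dlQ L0).
have rd : dot d (al + c *: b) = dlQ.
  by rewrite atb; case: (dot_frame dlP dlQ L0).
split=> //; split; split.
- split; first by rewrite hornerD hornerN /P hornerD hornerC; ring.
  rewrite derivB dP deriv_res -/d; move/uflatN: ga0.
  by rewrite gtr_symcurl rmorphN /= opprB addrC.
- split; first by rewrite hornerD hornerN /Q hornerD hornerC; ring.
  split; first by rewrite derivB dQ hornerD hornerN /Q1 hornerD hornerC; ring.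
  rewrite !derivB ddQ !deriv_res -/d; move/uflatN: et0.
  by rewrite ttr_symcurl rmorphN /= opprB addrC.
- split; first by rewrite hornerD hornerN res_at1 wdotD pevalD wdot_rt_eval rN /dlP; ring.
  rewrite derivB dP deriv_res -/d wdotD dirderD dirder_wdot_rot_rt addr0.
  by move/uflatN: ga1; rewrite gtr_symcurl rmorphN /= opprB addrC.
- split; first by rewrite hornerD hornerN res_at1 wdotD pevalD wdot_rt_eval rd /dlQ; ring.
  rewrite derivB deriv_res -/d wdotD dirderD dirder_wdot_rt; split.
    rewrite hornerD hornerN res_at1 pevalD pevalC /c divfK// /dlR; ring.
  rewrite derivB ddQ deriv_res -/d dirderD [dirder d (mpolyC _ _)]dirderE !mderivC.
  rewrite !scaler0 !addr0; move/uflatN: et1.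
  by rewrite ttr_symcurl rmorphN /= opprB addrC.
Qed.

Lemma edge_step (m : nat) a b w z : exists (P Q : {poly R}),
  [/\ (size P <= m.+2.*2)%N, (size Q <= m.+2.*2)%N, matches m 0 a b P Q w &
   matches m 1 a b P Q z].
Proof.
have [P [sP P0 P1]] := hermite m.+2 (res a b (wdot (rot90 (b - a)) w))
  (res a b (wdot (rot90 (b - a)) z)).
have [Q [sQ Q0 Q1]] := hermite m.+2 (res a b (wdot (b - a) w)) (res a b (wdot (b - a) z)).
by exists P, Q.
Qed.

(** The component i of the vector with the products P and Q with rot90 (b - a)
    and b - a. *)
Definition comp_of a b P Q (i : 'I_2) : {poly R} :=
  (dot (b - a) (b - a))^-1 *: (rot90 (b - a) 0 i *: P + (b - a) 0 i *: Q).

Lemma comp_ofB a b P Q P' Q' i :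
  comp_of a b P Q i - comp_of a b P' Q' i = comp_of a b (P - P') (Q - Q') i.
Proof. by rewrite /comp_of -scalerBr opprD addrACA -!scalerBr. Qed.

Lemma size_comp_of (n : nat) a b P Q i : (size P <= n)%N -> (size Q <= n)%N ->
  (size (comp_of a b P Q i) <= n)%N.
Proof.
move=> hP hQ; apply: leq_trans (size_scale_leq _ _) _.
apply: leq_trans (size_polyD _ _) _; rewrite geq_max.
by rewrite !(leq_trans (size_scale_leq _ _)).
Qed.

Lemma uflat_comp_of s (n : nat) a b P Q i : uflat s n P -> uflat s n Q ->
  uflat s n (comp_of a b P Q i).
Proof. by move=> hP hQ; apply/uflatZ/uflatD; apply: uflatZ. Qed.

Lemma comp_of_wdot a b w i : a != b ->
  comp_of a b (res a b (wdot (rot90 (b - a)) w)) (res a b (wdot (b - a) w)) i =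
  res a b (w 0 i).
Proof.
move=> ab; set d := b - a.
have L0 : dot d d != 0 by rewrite gt_eqF// dot_gt0// subr_eq0 eq_sym.
apply: (scalerI L0); rewrite /comp_of -/d scalerA divff// scale1r -!resZ -resD.
congr (res _ _ _); rewrite /wdot rot0 rot1 dotE -!mul_mpolyC mpolyCN mpolyCD !mpolyCM.
by elim/ord2_ind: i; rewrite ?rot0 ?rot1 ?mpolyCN; ring.
Qed.

Lemma wdot_comp_of a b P Q w : a != b -> (forall i, res a b (w 0 i) = comp_of a b P Q i) ->
  res a b (wdot (rot90 (b - a)) w) = P /\ res a b (wdot (b - a) w) = Q.
Proof.
move=> ab hw; set d := b - a.
have L0 : dot d d != 0 by rewrite gt_eqF// dot_gt0// subr_eq0 eq_sym.
have DE i : dot d d *: comp_of a b P Q i = rot90 d 0 i *: P + d 0 i *: Q.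
  by rewrite /comp_of -/d scalerA divff// scale1r.
have DS (s t : R) : dot d d *: (s *: comp_of a b P Q 0 + t *: comp_of a b P Q 1) =
    s *: (rot90 d 0 0 *: P + d 0 0 *: Q) + t *: (rot90 d 0 1 *: P + d 0 1 *: Q).
  by rewrite scalerDr !(scalerA (dot d d)) !(mulrC (dot d d)) -!scalerA !DE.
rewrite /wdot !resD !resZ !hw.
split; apply: (scalerI L0); rewrite DS !rot0 !rot1 dotE -!mul_polyC !polyCD !polyCM !polyCN; ring.
Qed.

(** The two components of w are interpolated separately. *)
Lemma triangle_field (m k : nat) a b c wa wb wc
  (Pab Qab Pbc Qbc Pac Qac : {poly R}) :
  (m.*2.+2 <= k)%N -> cr (b - a) (c - a) != 0 -> a != b -> b != c -> a != c ->
  (size Pab <= k.+2)%N -> (size Qab <= k.+2)%N -> (size Pbc <= k.+2)%N ->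
  (size Qbc <= k.+2)%N -> (size Pac <= k.+2)%N -> (size Qac <= k.+2)%N ->
  matches m 0 a b Pab Qab wa -> matches m 1 a b Pab Qab wb ->
  matches m 0 b c Pbc Qbc wb -> matches m 1 b c Pbc Qbc wc ->
  matches m 0 a c Pac Qac wa -> matches m 1 a c Pac Qac wc ->
  exists w, [/\ forall i, (msz (w 0%R i) <= k.+2)%N,
    forall i, [/\ flat a m.+2 ((w - wa) 0 i), flat b m.+2 ((w - wb) 0 i)
      & flat c m.+2 ((w - wc) 0 i)],
    res a b (wdot (rot90 (b - a)) w) = Pab /\ res a b (wdot (b - a) w) = Qab,
    res b c (wdot (rot90 (c - b)) w) = Pbc /\ res b c (wdot (c - b) w) = Qbc &
    res a c (wdot (rot90 (c - a)) w) = Pac /\ res a c (wdot (c - a) w) = Qac].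
Proof.
move=> mk D0 ab bc ac s1 s2 s3 s4 s5 s6 o1 o2 o3 o4 o5 o6.
have okc s x y P Q w i : x != y -> matches m s x y P Q w ->
    uflat s m.+2 (comp_of x y P Q i - res x y (w 0 i)).
  by move=> xy [h1 h2]; rewrite -comp_of_wdot// comp_ofB; apply: uflat_comp_of.
have ex i : exists p, [/\ (msz p <= k.+2)%N,
    [/\ flat a m.+2 (p - wa 0 i), flat b m.+2 (p - wb 0 i) & flat c m.+2 (p - wc 0 i)] &
    [/\ res a b p = comp_of a b Pab Qab i, res b c p = comp_of b c Pbc Qbc i
      & res a c p = comp_of a c Pac Qac i]].
  apply: (@triangle_interp R m.+1 k.+1) => //; try exact: size_comp_of; try exact: okc.
have [p0 [sz0 [a0 b0 c0] [r01 r02 r03]]] := ex 0.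
have [p1 [sz1 [a1 b1 c1] [r11 r12 r13]]] := ex 1.
pose w : 'rV[pol]_2 := \row_j (if j == 0 then p0 else p1).
have w0 : w 0 0 = p0 by rewrite mxE.
have w1 : w 0 1 = p1 by rewrite mxE.
have sub z i : (w - z) 0 i = w 0 i - z 0 i by rewrite mxE [(- z) _ _]mxE.
exists w; split.
- by apply: ord2_ind; rewrite ?w0 ?w1.
- by apply: ord2_ind; rewrite !sub ?w0 ?w1.
- by apply: wdot_comp_of => //; apply: ord2_ind; rewrite ?w0 ?w1.
- by apply: wdot_comp_of => //; apply: ord2_ind; rewrite ?w0 ?w1.
- by apply: wdot_comp_of => //; apply: ord2_ind; rewrite ?w0 ?w1.
Qed.

End EdgeData.

(** * Surjectivity of the double divergence *)

Lemma sorted_triple (T : finType) (S : {set T}) : #|S| = 3%N ->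
  exists t : T * T * T, [/\ S = [set t.1.1; t.1.2; t.2]%SET,
   (enum_rank t.1.1 < enum_rank t.1.2)%N & (enum_rank t.1.2 < enum_rank t.2)%N].
Proof.
move=> cS; have [a [b [c SE]]] := set3_of_card cS.
have [ab bc ac] := set3_neq SE cS.
have wl x y z : S = [set x; y; z]%SET -> (enum_rank x < enum_rank y)%N ->
    y != z -> x != z -> exists t : T * T * T, [/\ S = [set t.1.1; t.1.2; t.2]%SET,
   (enum_rank t.1.1 < enum_rank t.1.2)%N & (enum_rank t.1.2 < enum_rank t.2)%N].
  move=> Sx xy yz xz; have rk u v : u != v -> ~~ (enum_rank u < enum_rank v)%N ->
      (enum_rank v < enum_rank u)%N.
    move=> uv; rewrite -leqNgt leq_eqVlt => /orP[/eqP/val_inj/enum_rank_inj e|//].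
    by rewrite e eqxx in uv.
  have [lyz|/rk] := boolP (enum_rank y < enum_rank z)%N; first by exists (x, y, z).
  move=> /(_ yz) lzy; have [lxz|/rk] := boolP (enum_rank x < enum_rank z)%N.
    by exists (x, z, y); split=> //=; rewrite Sx; apply/finset.setP => w; rewrite !inE orbAC.
  move=> /(_ xz) lzx; exists (z, x, y); split=> //=.
  by rewrite Sx; apply/finset.setP => w; rewrite !inE orbC orbA.
have [lab|] := boolP (enum_rank a < enum_rank b)%N; first exact: (wl a b c).
rewrite -leqNgt leq_eqVlt => /orP[/eqP/val_inj/enum_rank_inj e|lba].
  by rewrite e eqxx in ab.
by apply: (wl b a c) => //; rewrite SE; apply/finset.setP => w; rewrite !inE; congr (_ || _); rewrite orbC.
Qed.

Lemma edge_step_pair (R : realType) (m : nat) (a b : 'rV[R]_2) (w z : 'rV[mpoly 2 R]_2) :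
  exists D : {poly R} * {poly R},
  [/\ (size D.1 <= m.+2.*2)%N, (size D.2 <= m.+2.*2)%N, matches m 0 a b D.1 D.2 w &
   matches m 1 a b D.1 D.2 z].
Proof. by have [P [Q h]] := edge_step m a b w z; exists (P, Q). Qed.

Lemma choice2 (A B C : Type) (P : A -> B -> C -> Prop) :
  (forall x y, exists z, P x y z) -> exists f, forall x y, P x y (f x y).
Proof.
move=> h; have [f fP] := choice (fun xy : A * B => h xy.1 xy.2).
by exists (fun x y => f (x, y)) => x y; exact: fP (x, y).
Qed.

Section Surjectivity.
Variables (R : realType) (Th : mesh R) (Omega : set 'rV[R]_2).
Hypothesis conf : conforming_triangulation Th Omega.
Local Notation plane := 'rV[R]_2.
Local Notation pol := (mpoly 2 R).
Implicit Types (K L : triangle Th) (a b c u v : vertex Th) (x : plane).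
Implicit Types (tau : 'M[pol]_2) (w : 'rV[pol]_2) (P Q : {poly R}).

Lemma vertex_neq a b : a != b -> pos a != pos b.
Proof. by apply: contra => /eqP /(pos_inj conf) ->. Qed.

(** On each triangle tau is sought as t0 + symcurl w, with t0 a polynomial
    solution. Fix common vertex jets, those of t0 on one triangle at each
    vertex, and common edge data. On a single triangle w is then found by
    integrating the data along the three edges and interpolating, except that
    the integration may fail to close up, by a field of RT. Changing the data
    of an edge shifts this defect by an arbitrary field of RT, with opposite
    signs on the two sides of the edge, so that circulation_surj provides data
    for which all defects vanish. *)
Theorem divdiv_onto (m k : nat) (u : triangle Th -> pol) :
  (m.*2.+2 <= k)%N -> (forall K, msz (u K) <= k.-1)%N ->
  (forall v K L, v \in verts K -> v \in verts L -> flat (pos v) m.-1 (u K - u L)) ->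
  exists tau : triangle Th -> 'M[pol]_2,
  [/\ forall K, (tau K)^T = tau K, forall K i j, (msz (tau K i j) <= k.+1)%N,
    forall K, divdiv (tau K) = u K,
    forall v K L, v \in verts K -> v \in verts L ->
      forall i j, flat (pos v) m.+1 ((tau K - tau L) i j) &
    forall a b K L, edge_of a b K -> edge_of a b L ->
      res (pos a) (pos b) (gtr (pos b - pos a) (tau K)) =
        res (pos a) (pos b) (gtr (pos b - pos a) (tau L)) /\
      res (pos a) (pos b) (ttr (pos b - pos a) (tau K)) =
        res (pos a) (pos b) (ttr (pos b - pos a) (tau L))].
Proof.
move=> mk su fu.
have [t0 t0P] := choice (fun K => divdiv_surj (su K)).
have [Kv KvP] := choice (verts_cover conf).
pose Qv v := t0 (Kv v).
have subE (s t : 'M[pol]_2) i j : (s - t) i j = s i j - t i j.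
  by rewrite mxE [(- t) _ _]mxE.
have exW (K : triangle Th) (v : vertex Th) : exists w, v \in verts K ->
    forall i j, flat (pos v) m.+1 ((Qv v - t0 K - symcurl w) i j).
  have [vK|_] := boolP (v \in verts K); last by exists 0.
  have [s1 d1 _] := t0P K; have [s2 d2 _] := t0P (Kv v).
  have [||w wP] := @symcurl_exact_jet R (pos v) m.-1 (Qv v - t0 K).
  - by rewrite linearB /= /Qv s1 s2.
  - by rewrite divdivB d1 d2; apply: fu.
  by exists w => _ i j; apply: flat_le (wP i j); lia.
have [W WP] := choice2 exW.
(* the common edge data, for one of the two orientations of each edge *)
pose tn a b (X : 'M[pol]_2) := res (pos a) (pos b) (gtr (pos b - pos a) X).
pose tt a b (X : 'M[pol]_2) := res (pos a) (pos b) (ttr (pos b - pos a) X).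
have [G GP] := choice (fun ab : vertex Th * vertex Th =>
  hermite m.+1 (tn ab.1 ab.2 (Qv ab.1)) (tn ab.1 ab.2 (Qv ab.2))).
have [H HP] := choice (fun ab : vertex Th * vertex Th =>
  hermite m (tt ab.1 ab.2 (Qv ab.1)) (tt ab.1 ab.2 (Qv ab.2))).
pose ga K ab := G ab - tn ab.1 ab.2 (t0 K).
pose et K ab := H ab - tt ab.1 ab.2 (t0 K).
pose spec K (ab : vertex Th * vertex Th) (r : (plane * R) * ({poly R} * {poly R})) :=
  [/\ r.2.1^`() = - ga K ab, r.2.2^`()^`() = - et K ab,
   (size r.2.1 <= k.+2)%N, (size r.2.2 <= k.+2)%N &
   matches m 0 (pos ab.1) (pos ab.2) r.2.1 r.2.2 (W K ab.1) /\
   matches m 1 (pos ab.1) (pos ab.2) r.2.1 r.2.2 (W K ab.2 + rt_field r.1.1 r.1.2)].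
have exE K (ab : vertex Th * vertex Th) : exists r, edge_of ab.1 ab.2 K -> spec K ab r.
  have [|_] := boolP (edge_of ab.1 ab.2 K); last by exists ((0, 0), (0, 0)).
  case: ab => a b /= /andP[ab /fintype.subsetP abK].
  have aK : a \in verts K by apply: abK; rewrite !inE eqxx.
  have bK : b \in verts K by apply: abK; rewrite !inE eqxx orbT.
  have [sG G0 G1] := GP (a, b); have [sH H0 H1] := HP (a, b).
  have [_ _ szt] := t0P K.
  have jn v : v \in verts K -> flat (pos v) m.+1 (gtr (pos b - pos a) (Qv v) -
      gtr (pos b - pos a) (t0 K) - gtr (pos b - pos a) (symcurl (W K v))).
    by move=> vK; rewrite -!gtrB; apply: flat_bil; apply: WP.
  have jt v : v \in verts K -> flat (pos v) m (ttr (pos b - pos a) (Qv v) -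
      ttr (pos b - pos a) (t0 K) - ttr (pos b - pos a) (symcurl (W K v))).
    by move=> vK; rewrite -!ttrB; apply: flat_ttr; apply: WP.
  have re (p q r s : {poly R}) : p - q - r = (p - s) + (s - q - r) by ring.
  have [|||||||rho [P [Q [h1 h2 h3 h4 [h5 h6]]]]] :=
    @edge_transport R m k (pos a) (pos b) (W K a) (W K b) (ga K (a, b)) (et K (a, b)).
  - exact: vertex_neq.
  - apply: leq_trans (size_polyD _ _) _; rewrite size_polyN geq_max; apply/andP; split.
      by apply: leq_trans sG _; lia.
    by apply: leq_trans (size_res _ _ _) _; apply: msz_bil => i j; have := szt i j; lia.
  - apply: leq_trans (size_polyD _ _) _; rewrite size_polyN geq_max; apply/andP; split.
      by apply: leq_trans sH _; lia.
    by apply: leq_trans (size_res _ _ _) _; apply: msz_ttr => i j; have := szt i j; lia.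
  - rewrite /ga (re _ _ _ (tn a b (Qv a))); apply: uflatD G0 _.
    by rewrite /tn -!resB; apply: flat_res0; apply: jn.
  - rewrite /et (re _ _ _ (tt a b (Qv a))); apply: uflatD H0 _.
    by rewrite /tt -!resB; apply: flat_res0; apply: jt.
  - rewrite /ga (re _ _ _ (tn a b (Qv b))); apply: uflatD G1 _.
    by rewrite /tn -!resB; apply: flat_res1; apply: jn.
  - rewrite /et (re _ _ _ (tt a b (Qv b))); apply: uflatD H1 _.
    by rewrite /tt -!resB; apply: flat_res1; apply: jt.
  by exists (rho, (P, Q)).
have [E EP] := choice2 exE.
have [lab labP] := choice (fun K => sorted_triple (verts_card conf K)).
pose ta K := (lab K).1.1; pose tb K := (lab K).1.2; pose tc K := (lab K).2.
have tE K : verts K = [set ta K; tb K; tc K]%SET by have [] := labP K.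
have lab_ab K : (enum_rank (ta K) < enum_rank (tb K))%N by have [] := labP K.
have lab_bc K : (enum_rank (tb K) < enum_rank (tc K))%N by have [] := labP K.
pose rho K a b : plane * R := (E K (a, b)).1.
(* edge unknowns closing all monodromies *)
have solve (f : plane * R -> R) : exists x : vertex Th -> vertex Th -> R, forall K,
    f (rho K (ta K) (tb K)) + x (ta K) (tb K) + (f (rho K (tb K) (tc K)) + x (tb K) (tc K)) =
    f (rho K (ta K) (tc K)) + x (ta K) (tc K).
  have [x hx] := circulation_surj conf (fun K => f (rho K (ta K) (tc K)) -
     f (rho K (ta K) (tb K)) - f (rho K (tb K) (tc K))) tE.
  by exists x => K; have := hx K; lra.
have [x0 hx0] := solve (fun r => r.1 0 0).
have [x1 hx1] := solve (fun r => r.1 0 1).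
have [x2 hx2] := solve (fun r => r.2).
pose xr a b : 'rV[pol]_2 := rt_field (\row_j (if j == 0 then x0 a b else x1 a b)) (x2 a b).
pose er K a b : 'rV[pol]_2 := rt_field (rho K a b).1 (rho K a b).2.
have closed K : (er K (ta K) (tb K) + xr (ta K) (tb K)) +
    (er K (tb K) (tc K) + xr (tb K) (tc K)) = er K (ta K) (tc K) + xr (ta K) (tc K).
  rewrite /er /xr -!rt_fieldD; congr rt_field; last exact: hx2.
  apply: eq_plane; have := hx0 K; have := hx1 K; rewrite !mxE /= => h1 h0 //.
have [D DP] := choice2 (fun a b => edge_step_pair m (pos a) (pos b) 0 (xr a b)).
have symrt K a b : symcurl (er K a b + xr a b) = 0.
  by rewrite symcurlD !symcurl_rt addr0.
have ctn K a b (P Q : {poly R}) w : P = (E K (a, b)).2.1 + (D a b).1 ->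
    Q = (E K (a, b)).2.2 + (D a b).2 -> spec K (a, b) (E K (a, b)) ->
    res (pos a) (pos b) (wdot (rot90 (pos b - pos a)) w) = P ->
    res (pos a) (pos b) (wdot (pos b - pos a) w) = Q ->
    tn a b (t0 K + symcurl w) = G (a, b) - (D a b).1^`() /\
    tt a b (t0 K + symcurl w) = H (a, b) - (D a b).2^`()^`().
  move=> PE QE [/= e1 e2 _ _ _] hP hQ; split.
    rewrite /tn gtrD resD gtr_symcurl rmorphN /= -deriv_res hP PE derivD e1 /ga /tn /=; ring.
  rewrite /tt ttrD resD ttr_symcurl rmorphN /= -!deriv_res hQ QE !derivD e2 /et /tt /=; ring.
have tri K a b c : verts K = [set a; b; c]%SET ->
    (enum_rank a < enum_rank b)%N -> (enum_rank b < enum_rank c)%N ->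
    (er K a b + xr a b) + (er K b c + xr b c) = er K a c + xr a c ->
    exists w, [/\ forall i, (msz (w 0%R i) <= k.+2)%N,
    forall v, v \in verts K -> forall i j,
      flat (pos v) m.+1 ((Qv v - (t0 K + symcurl w)) i j) &
    forall a b, edge_of a b K -> (enum_rank a < enum_rank b)%N ->
      tn a b (t0 K + symcurl w) = G (a, b) - (D a b).1^`() /\
      tt a b (t0 K + symcurl w) = H (a, b) - (D a b).2^`()^`()].
  move=> KE rab rbc cl; have [ab bc ac] := set3_neq KE (verts_card conf K).
  have sub (x y : vertex Th) : x \in verts K -> y \in verts K -> x != y -> edge_of x y K.
    move=> xK yK xy; rewrite /edge_of xy; apply/fintype.subsetP => z.
    by rewrite !inE => /orP[] /eqP ->.
  have aK : a \in verts K by rewrite KE !inE eqxx.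
  have bK : b \in verts K by rewrite KE !inE eqxx orbT.
  have cK : c \in verts K by rewrite KE !inE eqxx orbT.
  have spab := EP K (a, b) (sub a b aK bK ab).
  have spbc := EP K (b, c) (sub b c bK cK bc).
  have spac := EP K (a, c) (sub a c aK cK ac).
  have [_ _ q1 q2 [q3 q4]] := spab; have [_ _ q5 q6 [q7 q8]] := spbc.
  have [_ _ q9 q10 [q11 q12]] := spac; rewrite /= in q3 q4 q7 q8 q11 q12.
  have [d1 d2 d3 d4] := DP a b; have [d5 d6 d7 d8] := DP b c; have [d9 d10 d11 d12] := DP a c.
  have szD (P Q : {poly R}) : (size P <= k.+2)%N -> (size Q <= m.+2.*2)%N ->
      (size (P + Q)%R <= k.+2)%N.
    move=> hp hq; apply: leq_trans (size_polyD _ _) _; rewrite geq_max hp /=.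
    by apply: leq_trans hq _; rewrite doubleS doubleS !ltnS.
  have szr x y e al (s : R) : (size (res x y (wdot e (rt_field al s))) <= m.+2.*2)%N.
    apply: (@leq_trans 2); last by rewrite doubleS.
    apply: leq_trans (size_res _ _ _) _.
    by apply: mszD; apply: mszZ; rewrite rt_fieldE; apply: mszD; rewrite ?mszC//;
       apply: mszZ; rewrite mszX.
  pose s : 'rV[pol]_2 := er K a b + xr a b.
  have sE : s = rt_field ((rho K a b).1 + \row_j (if j == 0 then x0 a b else x1 a b))
      ((rho K a b).2 + x2 a b) by rewrite /s /er /xr -rt_fieldD.
  pose rP := res (pos b) (pos c) (wdot (rot90 (pos c - pos b)) s).
  pose rQ := res (pos b) (pos c) (wdot (pos c - pos b) s).
  have := @triangle_field R m k (pos a) (pos b) (pos c) (W K a) (W K b + s)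
    (W K c + (er K a c + xr a c))
    ((E K (a, b)).2.1 + (D a b).1) ((E K (a, b)).2.2 + (D a b).2)
    ((E K (b, c)).2.1 + (D b c).1 + rP) ((E K (b, c)).2.2 + (D b c).2 + rQ)
    ((E K (a, c)).2.1 + (D a c).1) ((E K (a, c)).2.2 + (D a c).2) mk
    (cr_neq0 conf KE) (vertex_neq ab) (vertex_neq bc) (vertex_neq ac)
    (szD _ _ q1 d1) (szD _ _ q2 d2) (szD _ _ (szD _ _ q5 d5) _) (szD _ _ (szD _ _ q6 d6) _)
    (szD _ _ q9 d9) (szD _ _ q10 d10).
  rewrite /rP /rQ sE => /(_ (szr _ _ _ _ _) (szr _ _ _ _ _)); rewrite -sE -/rP -/rQ.
  have m1 := matchesD q3 d3; have m2 := matchesD q4 d4.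
  have mr0 : matches m 0 (pos b) (pos c) rP rQ s by exact: matches_res.
  have mr1 : matches m 1 (pos b) (pos c) rP rQ s by exact: matches_res.
  have m3 := matchesD (matchesD q7 d7) mr0; have m4 := matchesD (matchesD q8 d8) mr1.
  have m5 := matchesD q11 d11; have m6 := matchesD q12 d12.
  rewrite !addr0 in m1 m3 m5; rewrite -addrA in m2; rewrite -addrA in m6.
  have m4E : W K c + rt_field (E K (b, c)).1.1 (E K (b, c)).1.2 + xr b c + s =
      W K c + (er K a c + xr a c) by rewrite -cl -/s -[rt_field _ _]/(er K b c)
      -addrA -addrA; congr (_ + _); rewrite [RHS]addrC addrA.
  rewrite m4E in m4.
  move=> /(_ m1 m2 m3 m4 m5 m6) [w [szw fw eab ebc eac]].
  exists w; split => //.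
  - have key v z : flat (pos v) m.+2 ((w - (W K v + z)) 0 0) ->
        flat (pos v) m.+2 ((w - (W K v + z)) 0 1) -> symcurl z = 0 -> v \in verts K ->
        forall i j, flat (pos v) m.+1 ((Qv v - (t0 K + symcurl w)) i j).
      move=> f0 f1 z0 vK i j.
      have -> : Qv v - (t0 K + symcurl w) =
          (Qv v - t0 K - symcurl (W K v)) - symcurl (w - (W K v + z)).
        rewrite symcurlB symcurlD z0 addr0 opprD opprB !addrA; congr (_ - _).
        by rewrite -!addrA; congr (_ + _); rewrite addNr addr0.
      rewrite subE; apply: flatB; first exact: WP.
      by apply: flat_symcurl; apply: ord2_ind.
    have [fa0 fb0 fc0] := fw 0; have [fa1 fb1 fc1] := fw 1.
    move=> v; rewrite {1}KE !inE => /orP[/orP[]|] /eqP ->.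
    + by apply: (key a 0); rewrite ?addr0//; have := symcurlB (0 : 'rV[pol]_2) 0; rewrite !subrr.
    + by apply: (key b s) => //; exact: symrt.
    + by apply: (key c (er K a c + xr a c)) => //; exact: symrt.
  - have nlt (x y : vertex Th) : (enum_rank x < enum_rank y)%N -> (enum_rank y < enum_rank x)%N -> False.
      by move=> h1 h2; have := ltn_trans h1 h2; rewrite ltnn.
    have rac := ltn_trans rab rbc.
    move=> x y /andP[xy /fintype.subsetP xyK].
    have : x \in verts K by apply: xyK; rewrite !inE eqxx.
    have : y \in verts K by apply: xyK; rewrite !inE eqxx orbT.
    move: xy; rewrite KE !inE => xy /orP[/orP[]|] /eqP yE /orP[/orP[]|] /eqP xE;
      subst x y; rewrite ?eqxx // in xy * => rxy; try by case: (nlt _ _ rxy).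
    + by case: eab => e1 e2; apply: ctn e1 e2.
    + by case: eac => e1 e2; apply: ctn e1 e2.
    + case: ebc => e1 e2.
      have dz (p q : {poly R}) : p - q = p + - q by [].
      have := @ctn K b c _ _ (w - s) erefl erefl spbc.
      rewrite !wdotB !resB e1 e2 symcurlB symrt subr0; apply.
        by rewrite -/rP addrK.
      by rewrite -/rQ addrK.
have exw K := tri K _ _ _ (tE K) (lab_ab K) (lab_bc K) (closed K).
have [w wP] := choice exw.
exists (fun K => t0 K + symcurl (w K)).
have flatQ v K : v \in verts K -> forall i j,
    flat (pos v) m.+1 ((Qv v - (t0 K + symcurl (w K))) i j) by have [_ h _] := wP K; apply: h.
split.
- by move=> K; have [h _ _] := t0P K; rewrite linearD /= h trmx_symcurl.
- move=> K i j; have [_ _ h] := t0P K; have [h2 _ _] := wP K; rewrite mxE; apply: mszD.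
    by apply: leq_trans (h i j) _; lia.
  exact: msz_symcurl.
- by move=> K; have [_ h _] := t0P K; rewrite divdivD h divdiv_symcurl addr0.
- move=> v K L vK vL i j.
  have via (A B C : 'M[pol]_2) : A - B = (C - B) - (C - A).
    by rewrite opprB [RHS]addrC addrA subrK.
  rewrite (via _ _ (Qv v)).
  by rewrite subE; apply: flatB; apply: flatQ.
- have one a b K L : edge_of a b K -> edge_of a b L -> (enum_rank a < enum_rank b)%N ->
      tn a b (t0 K + symcurl (w K)) = tn a b (t0 L + symcurl (w L)) /\
      tt a b (t0 K + symcurl (w K)) = tt a b (t0 L + symcurl (w L)).
    move=> eK eL r; have [_ _ hK] := wP K; have [_ _ hL] := wP L.
    have [g1 g2] := hK a b eK r; have [g3 g4] := hL a b eL r.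
    by split; [exact: etrans g1 (esym g3) | exact: etrans g2 (esym g4)].
  move=> a b K L eK eL; have [r|] := boolP (enum_rank a < enum_rank b)%N; first exact: one.
  rewrite -leqNgt leq_eqVlt => /orP[/eqP/val_inj/enum_rank_inj e|r].
    by move: eK; rewrite /edge_of e eqxx.
  have sw (x : triangle Th) : edge_of a b x -> edge_of b a x by rewrite /edge_of eq_sym finset.setUC.
  have [h1 h2] := one b a K L (sw _ eK) (sw _ eL) r.
  have op : pos b - pos a = - (pos a - pos b) by rewrite opprB.
  have eg X : tn a b X = tn b a X \Po (1 - 'X) by rewrite /tn op gtr_opp res_swap.
  have et' X : tt a b X = - tt b a X \Po (1 - 'X).
    by rewrite /tt op ttr_opp rmorphN /= res_swap [RHS]linearN.
  split.
    exact: etrans (eg _) (etrans (congr1 (comp_poly (1 - 'X)) h1) (esym (eg _))).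
  exact: etrans (et' _) (etrans (congr1 (fun p => - p \Po (1 - 'X)) h2) (esym (et' _))).
Qed.

End Surjectivity.

(** * Jumps along paths *)

Section Topology.
Variable R : realType.
Local Notation plane := 'rV[R]_2.

Lemma lebesgue_number (X : pseudoMetricType R) (A : set X) (P : set X -> Prop) :
  compact A -> (forall B C : set X, B `<=` C -> P C -> P B) ->
  (forall x, A x -> exists2 d : R, 0 < d & P (ball x d `&` A)) ->
  exists2 e : R, 0 < e & forall x, A x -> P (ball x e `&` A).
Proof.
move=> /compact_near_coveringP cA mono loc.
have := cA R 0^'+ (fun e x => P (ball x e `&` A)) _; case.
  move=> x Ax; have [d d0 Pd] := loc x Ax.
  exists (ball x (d / 2), [set e | e < d / 2]); first split => /=.
  - by apply: nbhsx_ballx; rewrite divr_gt0.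
  - by apply: nbhs_right_lt; rewrite divr_gt0.
  move=> [x' e] /= [bx ed]; apply: mono Pd => z [bz Az]; split=> //.
  rewrite [d]splitr; apply: ball_triangle bx _.
  by apply: le_ball bz; exact: ltW.
move=> e /= e0 he; exists (e / 2); first by rewrite divr_gt0.
apply: (he (e / 2)); last by rewrite divr_gt0.
by rewrite /= sub0r normrN gtr0_norm ?divr_gt0// ltr_pdivrMr// mulr_natr mulr2n ltrDl.
Qed.

Lemma within_continuous_ballP (X : pseudoMetricType R) (Y : topologicalType) (A : set X)
    (f : X -> Y) : {within A, continuous f} <->
  (forall x, A x -> forall U, nbhs (f x) U ->
     exists2 d : R, 0 < d & forall x', A x' -> ball x d x' -> U (f x')).
Proof.
rewrite subspace_continuousP; split=> h x Ax.
  move=> U /(h x Ax) /nbhs_ballP[d /= d0 hd]; exists d => // x' Ax' bx.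
  exact: hd bx Ax'.
move=> U /(h x Ax) [d d0 hd]; apply/nbhs_ballP; exists d => //= x' bx Ax'.
exact: hd.
Qed.

Section Cocycle.
Variables (V : zmodType) (Omega : set plane) (J : plane -> plane -> V).

(** On U the values J x y behave like differences of one function. *)
Definition additive_on (U : set plane) : Prop :=
  forall x y z, U x -> U y -> U z -> J x y + J y z = J x z.

Hypothesis J_local : forall x, Omega x -> exists2 U, nbhs x U & additive_on (U `&` Omega).

Lemma additive_on_sub (U W : set plane) : U `<=` W -> additive_on W -> additive_on U.
Proof. by move=> UW h x y z Ux Uy Uz; apply: h; apply: UW. Qed.

Lemma additive_refl (U : set plane) x : additive_on U -> U x -> J x x = 0.
Proof.
by move=> h Ux; apply: (@addrI _ (J x x)); rewrite addr0 h.
Qed.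

Lemma fine_mesh (X : pseudoMetricType R) (A : set X) (f : X -> plane) : compact A ->
  {within A, continuous f} -> (forall x, A x -> Omega (f x)) ->
  exists2 e : R, 0 < e & forall x, A x -> additive_on (f @` (ball x e `&` A)).
Proof.
move=> cA /within_continuous_ballP cf fO.
apply: (@lebesgue_number X A (fun B => additive_on (f @` B))) => //.
  by move=> B C BC; apply: additive_on_sub; exact: image_subset.
move=> x Ax; have [U nU JU] := J_local (fO x Ax).
have [d d0 hd] := cf x Ax U nU; exists d => //.
apply: additive_on_sub JU => _ [x' [bx Ax'] <-]; split; last exact: fO.
exact: hd.
Qed.

Definition psum (g : R -> plane) (n : nat) : V :=
  \sum_(0 <= i < n) J (g (i%:R / n%:R)) (g (i.+1%:R / n%:R)).

Lemma telescope_on (U : set plane) (f : nat -> plane) n : additive_on U ->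
  (forall i, (i <= n)%N -> U (f i)) -> \sum_(0 <= i < n) J (f i) (f i.+1) = J (f 0%N) (f n).
Proof.
move=> hU; elim: n => [|n IH] fU; first by rewrite big_geq// (additive_refl hU (fU _ _)).
rewrite big_nat_recr//= IH; last by move=> i hi; apply/fU/leqW.
by rewrite hU//; apply: fU.
Qed.

Lemma frac01 (i n : nat) : (i <= n)%N -> 0 <= (i%:R / n%:R : R) <= 1.
Proof.
move=> hi; rewrite divr_ge0 ?ler0n//=.
case: n hi => [|n] hi; first by rewrite invr0 mulr0 ler01.
by rewrite ler_pdivrMr ?ltr0n// mul1r ler_nat.
Qed.

Lemma pow2_large (e : R) : 0 < e -> exists j0 : nat, forall j, (j0 <= j)%N ->
  (2 ^ j)%:R^-1 < e.
Proof.
move=> e0; pose N := Num.truncn e^-1; exists N => j Nj.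
have : e^-1 < (2 ^ j)%:R.
  apply: lt_le_trans (truncnS_gt _) _; rewrite ler_nat.
  by apply: leq_ltn_trans Nj _; exact: ltn_expl.
by move=> h; rewrite -[e]invrK ltf_pV2// posrE ?invr_gt0// ltr0n expn_gt0.
Qed.

Lemma psum_double (g : R -> plane) (n : nat) (e : R) : 0 < e -> (0 < n)%N -> n%:R^-1 < e ->
  (forall s : R, 0 <= s <= 1 ->
     additive_on (g @` (ball s e `&` [set s | 0 <= s <= 1]))) ->
  psum g n.*2 = psum g n.
Proof.
move=> e0 n0 ne he; rewrite /psum.
have n0' : (n%:R : R) != 0 by rewrite pnatr_eq0 -lt0n.
have dbl (F : nat -> V) m : \sum_(0 <= i < m.*2) F i =
    \sum_(0 <= i < m) (F i.*2 + F i.*2.+1).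
  elim: m => [|m IH]; first by rewrite !big_geq.
  by rewrite doubleS !big_nat_recr//= IH addrA.
rewrite dbl; apply: eq_big_nat => i /= hi.
have e1 : i.*2%:R / n.*2%:R = i%:R / n%:R :> R.
  by rewrite -!muln2 !natrM -mulf_div divff ?mulr1// pnatr_eq0.
have e2 : i.*2.+2%:R / n.*2%:R = i.+1%:R / n%:R :> R.
  by rewrite -doubleS -!muln2 !natrM -mulf_div divff ?mulr1// pnatr_eq0.
rewrite e1 e2; apply: (he (i%:R / n%:R)); first exact/frac01/ltnW.
- by exists (i%:R / n%:R) => //; split; [exact: ballxx | exact/frac01/ltnW].
- exists (i.*2.+1%:R / n.*2%:R) => //; split; last by apply/frac01; lia.
  rewrite /ball /= -e1 -mulrBl -addn1 natrD opprD addNKr normrM normrN normr1 mul1r.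
  rewrite ger0_norm ?invr_ge0// (le_lt_trans _ ne)// lef_pV2 ?posrE ?ltr0n ?double_gt0//.
  by rewrite ler_nat; lia.
- exists (i.+1%:R / n%:R) => //; split; last by apply/frac01.
  rewrite /ball /= -mulrBl -addn1 natrD opprD addNKr normrM normrN normr1 mul1r.
  by rewrite ger0_norm ?invr_ge0.
Qed.

(** Some path from x to y has total jump l along all fine dyadic partitions.
    With dyadic partitions the sum for a concatenation of two paths is the sum
    of those of the pieces, one level below. *)
Definition jump (x y : plane) (l : V) : Prop :=
  exists g, [/\ path_in Omega g, g 0 = x, g 1 = y &
    exists j0, forall j, (j0 <= j)%N -> psum g (2 ^ j) = l].

Lemma itv01 : [set` `[(0 : R), 1]] = [set s | 0 <= s <= 1].
Proof. by apply/seteqP; split => s /=; rewrite in_itv. Qed.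

Lemma path_inP (g : R -> plane) : path_in Omega g <->
  {within [set s | 0 <= s <= 1], continuous g} /\
  (forall s, 0 <= s <= 1 -> Omega (g s)).
Proof.
rewrite /path_in itv01; split=> -[h1 h2]; by split=> // s hs; apply: h2; move: hs; rewrite ?in_itv.
Qed.

Lemma compact01 : compact [set s : R | 0 <= s <= 1].
Proof. by rewrite -itv01; exact: segment_compact. Qed.

Lemma path_jump g : path_in Omega g -> exists l, jump (g 0) (g 1) l.
Proof.
move=> gO; have /path_inP[cg hg] := gO.
have [e e0 he] := fine_mesh compact01 cg hg.
have [j0 hj] := pow2_large e0.
exists (psum g (2 ^ j0)), g; split=> //; exists j0.
elim=> [|j IH]; first by rewrite leqn0 => /eqP ->.
rewrite leq_eqVlt => /orP[/eqP -> //|]; rewrite ltnS => /[dup] jj /IH <-.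
rewrite expnS mul2n; apply: (psum_double e0) => //; last exact: hj.
by rewrite expn_gt0.
Qed.

Lemma jump_segment (U : set plane) x y : additive_on U ->
  (forall s : R, 0 <= s <= 1 -> (U `&` Omega) (x + s *: (y - x))) -> jump x y (J x y).
Proof.
move=> hU hs; pose g (s : R) := x + s *: (y - x).
have g0 : g 0 = x by rewrite /g scale0r addr0.
have g1 : g 1 = y by rewrite /g scale1r addrC subrK.
exists g; split=> //.
  apply/path_inP; split; last by move=> s /hs[].
  apply: continuous_subspaceT => s; apply: cvgD; first exact: cvg_cst.
  exact: cvgZr_tmp.
exists 0%N => j _; rewrite /psum.
rewrite (@telescope_on U (fun i => g (i%:R / (2 ^ j)%:R))) //.
  by rewrite mul0r divff ?pnatr_eq0 ?expn_eq0// g0 g1.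
by move=> i hi; have [] := hs _ (frac01 hi).
Qed.

Lemma jump_cat x y z l l' : jump x y l -> jump y z l' -> jump x z (l + l').
Proof.
move=> [g1 [/path_inP[c1 h1] g10 g11 [j1 hj1]]] [g2 [/path_inP[c2 h2] g20 g21 [j2 hj2]]].
pose g (s : R) := if s <= 2^-1 then g1 (2 * s) else g2 (2 * s - 1).
exists g; split.
- apply/path_inP; split; last first.
    move=> s /andP[s0 s1]; rewrite /g; case: (leP s 2^-1) => hs; [apply: h1|apply: h2]; lra.
  apply/within_continuous_ballP => s /andP[s0 s1] U nU.
  move/within_continuous_ballP in c1; move/within_continuous_ballP in c2.
  have [d1 d10 hd1] : exists2 d : R, 0 < d & forall s', 0 <= s' <= 1 -> s' <= 2^-1 ->
      `|s - s'| < d -> U (g1 (2 * s')).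
    have [hs|hs] := leP s 2^-1; last first.
      by exists (s - 2^-1) => [|s' _ hs']; [lra | rewrite ger0_norm; lra].
    have [||d d0 hd] := c1 (2 * s) _ U; first by rewrite /=; lra.
      by move: nU; rewrite /g hs.
    exists (d / 2) => [|s' /andP[s'0 s'1] hs' ss']; first by rewrite divr_gt0.
    apply: hd; first by rewrite /=; lra.
    rewrite /ball /= -mulrBr normrM ger0_norm//; lra.
  have [d2 d20 hd2] : exists2 d : R, 0 < d & forall s', 0 <= s' <= 1 -> 2^-1 < s' ->
      `|s - s'| < d -> U (g2 (2 * s' - 1)).
    have [hs|hs] := ltP s 2^-1.
      exists (2^-1 - s) => [|s' _ hs']; first by lra.
      by rewrite distrC ger0_norm; lra.
    have [||d d0 hd] := c2 (2 * s - 1) _ U; first by rewrite /=; lra.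
      move: nU; rewrite /g; case: (leP s 2^-1) => // hs'.
      have -> : s = 2^-1 by lra.
      by rewrite mulfV ?pnatr_eq0// subrr g11 g20.
    exists (d / 2) => [|s' /andP[s'0 s'1] hs' ss']; first by rewrite divr_gt0.
    apply: hd; first by rewrite /=; lra.
    rewrite /ball /= (_ : _ - _ = 2 * (s - s')); last by ring.
    by rewrite normrM ger0_norm//; lra.
  exists (Num.min d1 d2); first by rewrite lt_min d10.
  move=> s' hs'; rewrite /ball /= lt_min => /andP[b1 b2].
  by rewrite /g; case: leP => h; [exact: hd1 | exact: hd2].
- by rewrite /g invr_ge0 ler0n mulr0.
- rewrite /g; have -> : (1 <= 2^-1 :> R) = false by apply/negbTE; rewrite -ltNge; lra.
  by rewrite mulr1 (_ : 2 - 1 = 1 :> R)//; ring.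
- exists (maxn j1 j2).+1 => -[//|j]; rewrite ltnS geq_max => /andP[hj hj'].
  rewrite -(hj1 j hj) -(hj2 j hj') expnS mul2n -addnn /psum.
  have n0 : (0 < 2 ^ j)%N by rewrite expn_gt0.
  move: (2 ^ j)%N n0 => n n0.
  have n0' : (n%:R : R) != 0 by rewrite pnatr_eq0 -lt0n.
  have np : 0 < (n%:R : R) by rewrite ltr0n.
  have nn : (n + n)%:R = 2 * n%:R :> R by rewrite natrD; ring.
  have gl i : (i <= n)%N -> g (i%:R / (n + n)%:R) = g1 (i%:R / n%:R).
    move=> hi; have e : 2 * (i%:R / (n + n)%:R) = i%:R / n%:R :> R by rewrite nn; field.
    have /andP[_ h] := frac01 hi; rewrite /g e.
    by have -> : i%:R / (n + n)%:R <= 2^-1 :> R by lra.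
  have gr i : (i <= n)%N -> g ((i + n)%:R / (n + n)%:R) = g2 (i%:R / n%:R).
    move=> hi; have e : 2 * ((i + n)%:R / (n + n)%:R) - 1 = i%:R / n%:R :> R.
      by rewrite nn natrD; field.
    case: i hi e => [|i] hi e; first by rewrite add0n gl// divff// mul0r g11 g20.
    have h : 0 < (i.+1%:R / n%:R : R) by rewrite divr_gt0 ?ltr0n.
    rewrite /g e; have -> // : (i.+1 + n)%:R / (n + n)%:R <= 2^-1 :> R = false.
    by apply/negbTE; rewrite -ltNge; lra.
  rewrite (@big_cat_nat _ _ _ n) ?leq_addr//=; congr (_ + _).
    by apply: eq_big_nat => i /= hi; rewrite !gl// ltnW.
  rewrite -{1}[n]add0n big_addn addnK; apply: eq_big_nat => i /= hi.
  by rewrite -addSn !gr// ltnW.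
Qed.

(** On a fine subdivision of the homotopy square the jumps around each cell
    cancel, so that all horizontal lines have the same total jump, and the last
    one is constant. *)
Lemma loop_jump x l : (forall g, path_in Omega g -> g 0 = g 1 -> null_homotopic_in Omega g) ->
  jump x x l -> l = 0.
Proof.
move=> sc [g [gO g0 g1 [j1 hj1]]].
have [H [cH HO Hg Hside]] := sc g gO (etrans g0 (esym g1)).
pose Q : set (R * R) := [set s | 0 <= s <= 1] `*` [set s | 0 <= s <= 1].
have [e e0 he] : exists2 e : R, 0 < e & forall p : R * R, Q p ->
   additive_on (H @` (ball p e `&` Q)).
  apply: (@fine_mesh (R * R)%type); first exact: compact_setX compact01 compact01.
    by rewrite /Q -!itv01.
  by move=> [s t] [/= hs ht]; apply: HO; rewrite in_itv.
have [j0 hj0] := pow2_large e0.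
pose j := maxn j0 j1; have jn := hj0 j (leq_maxl _ _).
rewrite -(hj1 j (leq_maxr _ _)).
have : (0 < 2 ^ j)%N by rewrite expn_gt0.
move: (2 ^ j)%N jn => n ne n0.
pose P (i l : nat) : plane := H (i%:R / n%:R, l%:R / n%:R).
have cell i k : (i < n)%N -> (k < n)%N ->
    J (P i k) (P i.+1 k) + J (P i.+1 k) (P i.+1 k.+1) =
    J (P i k) (P i k.+1) + J (P i k.+1) (P i.+1 k.+1).
  move=> hi hk.
  have hp : Q (i%:R / n%:R, k%:R / n%:R).
    by split; apply/frac01/ltnW.
  have near u v : (u = i \/ u = i.+1) -> (v = k \/ v = k.+1) ->
     (H @` (ball ((i%:R / n%:R, k%:R / n%:R) : R * R) e `&` Q)) (P u v).
    have b (a c : nat) : (c = a \/ c = a.+1) -> ball (a%:R / n%:R : R) e (c%:R / n%:R).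
      case=> ->; first exact: ballxx.
      rewrite /ball /= -mulrBl -addn1 natrD opprD addNKr normrM normrN normr1 mul1r.
      by rewrite ger0_norm ?invr_ge0.
    move=> hu hv; exists (u%:R / n%:R, v%:R / n%:R) => //; split; first by split; apply: b.
    by split; [case: hu => -> | case: hv => ->]; apply/frac01 => //; exact: ltnW.
  have hA := he _ hp.
  rewrite (hA (P i k) (P i.+1 k) (P i.+1 k.+1)); try by apply: near; auto.
  by rewrite (hA (P i k) (P i k.+1) (P i.+1 k.+1)) //; apply: near; auto.
have row k : (k < n)%N -> \sum_(0 <= i < n) J (P i k) (P i.+1 k) =
    \sum_(0 <= i < n) J (P i k.+1) (P i.+1 k.+1).
  move=> hk; apply/eqP; rewrite -subr_eq0 -sumrB.
  have -> : \sum_(0 <= i < n) (J (P i k) (P i.+1 k) - J (P i k.+1) (P i.+1 k.+1)) =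
      \sum_(0 <= i < n) (J (P i k) (P i k.+1) - J (P i.+1 k) (P i.+1 k.+1)).
    apply: eq_big_nat => i /= hi; apply/eqP; rewrite subr_eq addrAC eq_sym subr_eq.
    by rewrite cell.
  have := telescope_sumr (fun i => J (P i k) (P i k.+1)) (leq0n n).
  move=> /(congr1 -%R); rewrite -sumrN.
  under [X in X = _ -> _]eq_bigr do rewrite opprB.
  move=> ->; rewrite opprB subr_eq0.
  have side i v : (i = 0%N \/ i = n) -> (v <= n)%N -> P i v = g 0.
    move=> hi hv; have [|h0 h1] := Hside (v%:R / n%:R); first by rewrite in_itv; exact: frac01.
    rewrite /P; case: hi => ->; rewrite ?mul0r ?divff ?pnatr_eq0 -?lt0n//.
  by rewrite !side; auto; exact: ltnW.
have all k : (k <= n)%N -> \sum_(0 <= i < n) J (P i 0%N) (P i.+1 0%N) =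
    \sum_(0 <= i < n) J (P i k) (P i.+1 k).
  elim: k => [//|k IH] hk; rewrite IH; last exact: ltnW.
  exact: row.
have bot i : (i <= n)%N -> P i 0%N = g (i%:R / n%:R).
  move=> hi; have [|h0 _] := Hg (i%:R / n%:R); first by rewrite in_itv; exact: frac01.
  by rewrite /P mul0r.
have top i : (i <= n)%N -> P i n = g 0.
  move=> hi; have [|_ h0] := Hg (i%:R / n%:R); first by rewrite in_itv; exact: frac01.
  by rewrite /P divff ?pnatr_eq0 -?lt0n.
have -> : psum g n = \sum_(0 <= i < n) J (P i 0%N) (P i.+1 0%N).
  by apply: eq_big_nat => i /= hi; rewrite !bot// ltnW.
rewrite (all n)// big_nat_cond big1// => i /andP[/= hi _].
rewrite !top// ?(ltnW hi)//.
have [|U nU JU] := J_local (x := g 0).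
  by have /path_inP[_ hg] := gO; apply: hg; rewrite lexx ler01.
apply: additive_refl JU _; split; first exact: nbhs_singleton.
by have /path_inP[_ hg] := gO; apply: hg; rewrite lexx ler01.
Qed.

End Cocycle.
End Topology.

(** * Lipschitz epigraphs *)

Section PlaneGeometry.
Variable R : realType.
Local Notation plane := 'rV[R]_2.
Implicit Types (a b c e x y z p : plane).

Lemma plane_ballP x (d : R) y : 0 < d ->
  ball x d y <-> `|x 0 0 - y 0 0| < d /\ `|x 0 1 - y 0 1| < d.
Proof.
move=> d0; split=> [[_ h]|[h0 h1]]; first by split; apply: h.
by split=> // i j; rewrite ord1; elim/ord2_ind: j.
Qed.

Lemma segment_coord x y (s : R) (i : 'I_2) :
  (x + s *: (y - x)) 0 i = x 0 i + s * (y 0 i - x 0 i).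
Proof. by rewrite !mxE. Qed.

Lemma ball_convex p (d : R) x y (s : R) : 0 < d -> ball p d x -> ball p d y ->
  0 <= s <= 1 -> ball p d (x + s *: (y - x)).
Proof.
move=> d0 /(plane_ballP _ _ d0)[x0 x1] /(plane_ballP _ _ d0)[y0 y1] /andP[s0 s1].
apply/(plane_ballP _ _ d0); rewrite !segment_coord.
have conv (q u v : R) : `|q - u| < d -> `|q - v| < d -> `|q - (u + s * (v - u))| < d.
  move=> hu hv; apply: (@le_lt_trans _ _ (Num.max `|q - u| `|q - v|)); last first.
    by rewrite gt_max hu.
  have : `|q - u| <= Num.max `|q - u| `|q - v| by rewrite le_max lexx.
  have : `|q - v| <= Num.max `|q - u| `|q - v| by rewrite le_max lexx orbT.
  rewrite !ler_norml => /andP[v1 v2] /andP[u1 u2]; apply/andP; split; nra.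
by split; apply: conv.
Qed.

Lemma dot_segment x y (s : R) e :
  dot (x + s *: (y - x)) e = dot x e + s * (dot y e - dot x e).
Proof. by rewrite !dotE !segment_coord; ring. Qed.

Lemma unit_coord e : dot e e = 1 -> `|e 0 0| <= 1 /\ `|e 0 1| <= 1.
Proof.
rewrite dotE => h; rewrite !ler_norml; split; apply/andP; split; nra.
Qed.

Lemma dot_close e x y (d : R) : dot e e = 1 -> 0 < d -> ball x d y ->
  `|dot x e - dot y e| <= 2 * d.
Proof.
move=> /unit_coord[e0 e1] d0 /(plane_ballP _ _ d0)[h0 h1].
have -> : dot x e - dot y e = (x 0 0 - y 0 0) * e 0 0 + (x 0 1 - y 0 1) * e 0 1.
  by rewrite !dotE; ring.
apply: le_trans (ler_normD _ _) _; rewrite !normrM.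
have m (u v : R) : 0 <= u -> u < d -> 0 <= v -> v <= 1 -> u * v <= d by nra.
have := m _ _ (normr_ge0 _) h0 (normr_ge0 _) e0.
by have := m _ _ (normr_ge0 _) h1 (normr_ge0 _) e1; lra.
Qed.

Lemma lipschitz_bound (phi : R -> R) : [lipschitz phi s | s in [set: R]] ->
  exists2 C : R, 0 <= C & forall s t, `|phi s - phi t| <= C * `|s - t|.
Proof.
move=> [M [Mr hM]]; pose C := Num.max (M + 1) 0; exists C; first by rewrite le_max lexx orbT.
move=> s t; have := hM C; rewrite lt_max ltrDl ltr01 => /(_ isT) h.
by have /= := h (s, t); apply.
Qed.

Section Chart.
Variables (Omega : set plane) (p e : plane) (phi : R -> R) (r : R).
Hypotheses (e1 : dot e e = 1) (lip : [lipschitz phi s | s in [set: R]]) (r0 : 0 < r).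
Hypothesis chart : forall y, ball p r y -> (Omega y <-> phi (dot y (rot90 e)) < dot y e).

Lemma rot_unit : dot (rot90 e) (rot90 e) = 1.
Proof. by rewrite dot_rot90. Qed.

(** Go up in the direction e by the Lipschitz constant times the distance to be
    covered, then across, then down. *)
Lemma chart_connected (eps : R) : 0 < eps -> exists2 d : R, 0 < d &
  forall y1 y2, Omega y1 -> Omega y2 -> ball p d y1 -> ball p d y2 ->
  exists z1 z2, forall s : R, 0 <= s <= 1 ->
    [/\ (Omega `&` ball p eps) (y1 + s *: (z1 - y1)),
        (Omega `&` ball p eps) (z1 + s *: (z2 - z1)) &
        (Omega `&` ball p eps) (z2 + s *: (y2 - z2))].
Proof.
move=> eps0; have [C C0 hC] := lipschitz_bound lip.
pose m := Num.min eps r; have m0 : 0 < m by rewrite lt_min eps0.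
pose d := m / (5 + 4 * C).
have D0 : 0 < 5 + 4 * C by lra.
have d0 : 0 < d by rewrite divr_gt0.
have dm : (5 + 4 * C) * d = m by rewrite /d mulrC divfK// gt_eqF.
exists d => // y1 y2 O1 O2 b1 b2.
have ball_in (eta : R) : m <= eta -> ball p m `<=` ball p eta.
  by move=> h z; apply: le_ball.
have dlem : d <= m by rewrite -dm; nra.
have b1r : ball p r y1 by apply: ball_in (le_ball dlem b1); rewrite ge_min lexx orbT.
have b2r : ball p r y2 by apply: ball_in (le_ball dlem b2); rewrite ge_min lexx orbT.
pose s1 := dot y1 (rot90 e); pose s2 := dot y2 (rot90 e).
pose h1 := dot y1 e; pose h2 := dot y2 e.
have p1 : phi s1 < h1 by apply/chart.
have p2 : phi s2 < h2 by apply/chart.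
have sd : `|s1 - s2| <= 4 * d.
  have := dot_close rot_unit d0 b1; have := dot_close rot_unit d0 b2.
  rewrite -/s1 -/s2 !ler_norml => /andP[? ?] /andP[? ?]; apply/andP; split; lra.
have hd : `|h1 - h2| <= 4 * d.
  have := dot_close e1 d0 b1; have := dot_close e1 d0 b2.
  rewrite -/h1 -/h2 !ler_norml => /andP[? ?] /andP[? ?]; apply/andP; split; lra.
pose H := Num.max h1 h2 + C * `|s1 - s2|.
have Cs0 : 0 <= C * `|s1 - s2| by rewrite mulr_ge0.
have Cs : C * `|s1 - s2| <= C * (4 * d) by rewrite ler_wpM2l.
have H1 : h1 + C * `|s1 - s2| <= H by rewrite lerD2r le_max lexx.
have H2 : h2 + C * `|s1 - s2| <= H by rewrite lerD2r le_max lexx orbT.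
have mx : Num.max h1 h2 <= h1 + 4 * d /\ Num.max h1 h2 <= h2 + 4 * d.
  move: hd; rewrite !ge_max ler_norml => /andP[? ?]; split; apply/andP; split; lra.
have t1 : 0 <= H - h1 <= (4 + 4 * C) * d by case: mx => ? ?; apply/andP; split; [lra | rewrite /H; lra].
have t2 : 0 <= H - h2 <= (4 + 4 * C) * d by case: mx => ? ?; apply/andP; split; [lra | rewrite /H; lra].
have [e01 e11] := unit_coord e1.
have up y (t : R) : ball p d y -> 0 <= t <= (4 + 4 * C) * d -> ball p m (y + t *: e).
  move=> /(plane_ballP _ _ d0)[g0 g1] /andP[t0 tle]; apply/(plane_ballP _ _ m0).
  have st (q u v : R) : `|q - u| < d -> `|v| <= 1 -> `|q - (u + t * v)| < m.
    rewrite -dm !ltr_norml ler_norml => /andP[? ?] /andP[? ?].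
    have : - t <= t * v <= t by apply/andP; split; nra.
    by move=> /andP[? ?]; apply/andP; split; lra.
  by rewrite !mxE; split; apply: st.
pose z1 := y1 + (H - h1) *: e; pose z2 := y2 + (H - h2) *: e.
have bz1 : ball p m z1 by exact: up.
have bz2 : ball p m z2 by exact: up.
have by1 : ball p m y1 by exact: le_ball b1.
have by2 : ball p m y2 by exact: le_ball b2.
have dz (y : plane) (t : R) : dot (y + t *: e) e = dot y e + t.
  by rewrite -[in RHS](mulr1 t) -e1 !dotE !mxE; ring.
have dzr (y : plane) (t : R) : dot (y + t *: e) (rot90 e) = dot y (rot90 e).
  by rewrite !dotE rot0 rot1 !mxE; ring.
have z1e : dot z1 e = H by rewrite /z1 dz -/h1; ring.
have z2e : dot z2 e = H by rewrite /z2 dz -/h2; ring.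
have z1r : dot z1 (rot90 e) = s1 by rewrite /z1 dzr.
have z2r : dot z2 (rot90 e) = s2 by rewrite /z2 dzr.
have fin y : ball p m y -> phi (dot y (rot90 e)) < dot y e -> (Omega `&` ball p eps) y.
  move=> bm h; split; last by apply: ball_in bm; rewrite ge_min lexx.
  by apply/chart => //; apply: ball_in bm; rewrite ge_min lexx orbT.
exists z1, z2 => s s01; have /andP[s0 sle1] := s01; split; apply: fin.
- exact: ball_convex.
- rewrite !dot_segment z1r z1e -/s1 -/h1 subrr mulr0 addr0; move: t1 => /andP[? ?]; nra.
- exact: ball_convex.
- rewrite !dot_segment z1r z1e z2r z2e subrr mulr0 addr0.
  apply: lt_le_trans H1; have := hC (s1 + s * (s2 - s1)) s1.
  have -> : s1 + s * (s2 - s1) - s1 = - (s * (s1 - s2)) by ring.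
  rewrite normrN normrM (ger0_norm s0) => /ler_normlP[_ h].
  have : C * (s * `|s1 - s2|) <= C * `|s1 - s2|.
    by rewrite ler_wpM2l// ler_piMl.
  by move: h; lra.
- exact: ball_convex.
- rewrite !dot_segment z2r z2e -/s2 -/h2 subrr mulr0 addr0; move: t2 => /andP[? ?]; nra.
Qed.

(** Otherwise p is on or below the graph and, by the Lipschitz condition,
    points slightly below p are exterior to Omega, although all points near p
    are in its closure. *)
Lemma chart_boundary : nbhs p (closure Omega) -> Omega p.
Proof.
move=> /nbhs_ballP[eta /= eta0 hcl]; apply: contrapT => Op.
have [C C0 hC] := lipschitz_bound lip.
have pp : dot p e <= phi (dot p (rot90 e)).
  by rewrite leNgt; apply/negP => h; apply: Op; apply/chart => //; exact: ballxx.
pose m := Num.min eta r; have m0 : 0 < m by rewrite lt_min eta0.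
pose t := m / 2; have t0 : 0 < t by rewrite divr_gt0.
have tm : 2 * t = m by rewrite /t mulrC divfK.
have D0 : 0 < 4 + 4 * C by lra.
pose d := t / (4 + 4 * C); have d0 : 0 < d by rewrite divr_gt0.
have dt : (4 + 4 * C) * d = t by rewrite /d mulrC divfK// gt_eqF.
pose y := p - t *: e; have [e01 e11] := unit_coord e1.
have yb (q v w : R) : `|v| <= 1 -> `|q - t * v - w| < d -> `|q - w| < m.
  move=> hv hw; rewrite -tm; move: hv hw; rewrite ler_norml !ltr_norml => /andP[? ?] /andP[? ?].
  have : - t <= t * v <= t by apply/andP; split; nra.
  have : d <= t by rewrite -dt; nra.
  by move=> ? /andP[? ?]; apply/andP; split; nra.
have clm z : ball y d z -> ball p m z.
  move=> /(plane_ballP _ _ d0); rewrite !mxE => -[g0 g1]; apply/(plane_ballP _ _ m0).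
  by split; [apply: (yb _ (e 0 0)) | apply: (yb _ (e 0 1))].
have ycl : closure Omega y.
  apply: hcl; apply: (@le_ball _ _ _ m); first by rewrite ge_min lexx.
  by apply: clm; exact: ballxx.
have [z [Oz bz]] := ycl _ (nbhsx_ballx y _ d0).
have bzr : ball p r z by apply: le_ball (clm _ bz); rewrite ge_min lexx orbT.
have := (chart bzr).1 Oz.
have ye : dot y e = dot p e - t.
  have -> : t = t * dot e e by rewrite e1 mulr1.
  by rewrite /y !dotE !mxE; ring.
have yr : dot y (rot90 e) = dot p (rot90 e).
  by rewrite /y !dotE rot0 rot1 !mxE; ring.
have := dot_close e1 d0 bz; rewrite ye => /ler_normlP[h1 _].
have := dot_close rot_unit d0 bz; rewrite yr => h2.
have := hC (dot p (rot90 e)) (dot z (rot90 e)) => /ler_normlP[_ h3].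
have : C * `|dot p (rot90 e) - dot z (rot90 e)| <= C * (2 * d) by rewrite ler_wpM2l.
by nra.
Qed.

End Chart.
End PlaneGeometry.

(** * Cocycles on a triangulated domain *)

Section MeshTopology.
Variables (R : realType) (Th : mesh R) (Omega : set 'rV[R]_2).
Hypotheses (conf : conforming_triangulation Th Omega) (Oopen : open Omega).
Hypotheses (Osc : simply_connected Omega) (Olip : lipschitz_domain Omega).
Local Notation plane := 'rV[R]_2.
Implicit Types (K L N : triangle Th) (v : vertex Th) (x y p : plane).

Definition lam (a b c x : plane) : R := cr (b - a) (x - a) / cr (b - a) (c - a).

Lemma lam_coef (a b c : plane) (ea eb ec : R) : cr (b - a) (c - a) != 0 ->
  ea + eb + ec = 1 -> lam a b c (ea *: a + eb *: b + ec *: c) = ec.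
Proof.
move=> D0 h; apply: (mulIf D0); rewrite /lam divfK//.
have -> : ea = 1 - eb - ec by lra.
by rewrite /cr !mxE; ring.
Qed.

Lemma lam_sum (a b c x : plane) : cr (b - a) (c - a) != 0 ->
  lam b c a x + lam c a b x + lam a b c x = 1.
Proof.
move=> D0; rewrite /lam (cr_rot b c a) (cr_rot a b c) -!mulrDl; apply: (mulIf D0).
by rewrite divfK// mul1r /cr !mxE; ring.
Qed.

Lemma lam_decomp (a b c x : plane) : cr (b - a) (c - a) != 0 ->
  x = lam b c a x *: a + lam c a b x *: b + lam a b c x *: c.
Proof.
move=> D0; rewrite /lam (cr_rot b c a) (cr_rot a b c).
set D := cr (b - a) (c - a) in D0 *.
have DE : D = cr (b - a) (c - a) by [].
by apply: eq_plane; rewrite !mxE; apply: (mulIf D0); rewrite !mulrDl -!mulrA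
  ![D^-1 * _]mulrC -!mulrA !(mulrC _ (D * D^-1)) divff// !mul1r ![_ * D]mulrC DE /cr !mxE; ring.
Qed.

Lemma lam_continuous (a b c : plane) : continuous (lam a b c).
Proof.
pose f (i : 'I_2) : plane -> R := fun y => y 0 i.
have cf i : continuous (f i) by move=> x; exact: coord_continuous.
pose k (t : R) : plane -> R := fun=> t.
have ck t : continuous (k t) by move=> x; exact: cst_continuous.
have -> : lam a b c = (k ((b - a) 0 0) \* (f 1 - k (a 0 1)) -
    k ((b - a) 0 1) \* (f 0 - k (a 0 0))) \* k (cr (b - a) (c - a))^-1.
  by apply: funext => y; rewrite /lam /cr /f /k !mxE.
move=> x; apply: continuousM; last exact: ck.
apply: continuousB; apply: continuousM; try exact: ck.
  by apply: continuousB; [exact: cf | exact: ck].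
by apply: continuousB; [exact: cf | exact: ck].
Qed.

Section OneTriangle.
Variables (K : triangle Th) (a b c : vertex Th).
Hypothesis KE : verts K = [set a; b; c]%SET.
Local Notation la := (lam (pos b) (pos c) (pos a)).
Local Notation lb := (lam (pos c) (pos a) (pos b)).
Local Notation lc := (lam (pos a) (pos b) (pos c)).
Let D0 := cr_neq0 conf KE.

Lemma hull_lam x : hull (verts K) x <-> [/\ 0 <= la x, 0 <= lb x & 0 <= lc x].
Proof.
split=> [[e [e0 e1 ex]]|[h1 h2 h3]]; last first.
  exact: (hull3 conf KE h1 h2 h3 (lam_sum x D0) (lam_decomp x D0)).
rewrite (sum_set3 _ KE (verts_card conf K)) in e1.
rewrite (sum_set3 _ KE (verts_card conf K)) in ex.
have Da : cr (pos c - pos b) (pos a - pos b) != 0 by rewrite cr_rot.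
have Db : cr (pos a - pos c) (pos b - pos c) != 0 by rewrite cr_rot.
have xa : x = e b *: pos b + e c *: pos c + e a *: pos a by rewrite ex -addrA addrC.
have xb : x = e c *: pos c + e a *: pos a + e b *: pos b by rewrite ex addrC addrA.
rewrite {1}xa (lam_coef Da); last by lra.
by rewrite {1}xb (lam_coef Db) ?ex ?(lam_coef D0)//; lra.
Qed.

End OneTriangle.

Lemma hull_closed K x : ~ hull (verts K) x -> \forall y \near x, ~ hull (verts K) y.
Proof.
have [a [b [c KE]]] := set3_of_card (verts_card conf K).
have neg (A B C : plane) : lam A B C x < 0 -> \forall y \near x, lam A B C y < 0.
  move=> h; have := @lam_continuous A B C x; move=> /cvgr_lt; exact.
move=> hx; have : [|| lam (pos b) (pos c) (pos a) x < 0, lam (pos c) (pos a) (pos b) x < 0 |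
    lam (pos a) (pos b) (pos c) x < 0].
  by apply/negP => /negP; rewrite !negb_or -!leNgt => /and3P[h1 h2 h3]; apply/hx/(hull_lam KE).
case/or3P => /neg; apply: filterS => y hy /(hull_lam KE)[]; rewrite !leNgt hy//.
Qed.

Definition inner K x : Prop := exists a b c, verts K = [set a; b; c]%SET /\
  [/\ 0 < lam (pos b) (pos c) (pos a) x, 0 < lam (pos c) (pos a) (pos b) x &
      0 < lam (pos a) (pos b) (pos c) x].

Lemma hull_closure K x : hull (verts K) x -> closure Omega x.
Proof. by move=> h; rewrite (triangles_cover conf); exists K. Qed.

Lemma closure_hull x : closure Omega x -> exists K, hull (verts K) x.
Proof. by rewrite (triangles_cover conf) => -[K _ h]; exists K. Qed.

Lemma inner_hull K x : inner K x -> hull (verts K) x.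
Proof. by move=> [a [b [c [KE [h1 h2 h3]]]]]; apply/(hull_lam KE); split; exact: ltW. Qed.

(** An interior point of a triangle is interior to the closure of Omega, which
    chart_boundary identifies with Omega. *)
Lemma inner_Omega K x : inner K x -> Omega x.
Proof.
move=> /[dup] hin [a [b [c [KE [h1 h2 h3]]]]].
have nb (A B C : plane) : 0 < lam A B C x -> \forall y \near x, 0 < lam A B C y.
  by move=> h; have := @lam_continuous A B C x; move=> /cvgr_gt; exact.
have nO : nbhs x (closure Omega).
  near=> y; apply: (@hull_closure K); apply: inner_hull; exists a, b, c; split=> //.
  by split; near: y; apply: nb.
apply: contrapT => Ox.
have fx : frontier Omega x.
  split; first exact: nbhs_singleton nO.
  by move=> h; apply: Ox; exact: interior_subset h.
have [e [phi [r [e1 lip r0 ch]]]] := Olip fx.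
exact: Ox (chart_boundary e1 lip r0 ch nO).
Unshelve. all: by end_near. Qed.

Lemma inner_eq K L x : inner K x -> hull (verts L) x -> L = K.
Proof.
move=> [a [b [c [KE [h1 h2 h3]]]]] xL; apply/esym; apply: (verts_sub_eq conf).
have D0 := cr_neq0 conf KE.
have KE2 : verts K = [set b; c; a]%SET by rewrite KE set3_rot.
have KE3 : verts K = [set c; a; b]%SET by rewrite KE2 set3_rot.
have D2 := cr_neq0 conf KE2; have D3 := cr_neq0 conf KE3.
have cL := support3 conf KE (ltW h1) (ltW h2) h3 (lam_sum x D0) (lam_decomp x D0) xL.
have aL := support3 conf KE2 (ltW h2) (ltW h3) h1 (lam_sum x D2) (lam_decomp x D2) xL.
have bL := support3 conf KE3 (ltW h3) (ltW h1) h2 (lam_sum x D3) (lam_decomp x D3) xL.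
by apply/fintype.subsetP => v; rewrite KE !inE => /orP[/orP[]|] /eqP ->.
Qed.

Lemma inner_segment K p x (t : R) : hull (verts K) p -> inner K x -> 0 < t <= 1 ->
  inner K (p + t *: (x - p)).
Proof.
move=> hp [a [b [c [KE [h1 h2 h3]]]]] /andP[t0 t1]; exists a, b, c; split=> //.
have /(hull_lam KE)[g1 g2 g3] := hp.
have aff (A B C : plane) : lam A B C (p + t *: (x - p)) = (1 - t) * lam A B C p + t * lam A B C x.
  by rewrite /lam !mulrA -mulrDl; congr (_ / _); rewrite /cr !mxE; ring.
have pos_comb (u w : R) : 0 <= u -> 0 < w -> 0 < (1 - t) * u + t * w by nra.
by rewrite !aff; split; apply: pos_comb.
Qed.

Lemma inner_ex K : exists x, inner K x.
Proof.
have [a [b [c KE]]] := set3_of_card (verts_card conf K).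
have D0 := cr_neq0 conf KE.
have D2 : cr (pos c - pos b) (pos a - pos b) != 0 by rewrite cr_rot.
have D3 : cr (pos a - pos c) (pos b - pos c) != 0 by rewrite cr_rot.
pose x := 3^-1 *: pos a + 3^-1 *: pos b + 3^-1 *: pos c.
exists x, a, b, c; split=> //.
have E2 : x = 3^-1 *: pos b + 3^-1 *: pos c + 3^-1 *: pos a by rewrite /x -addrA addrC.
have E3 : x = 3^-1 *: pos c + 3^-1 *: pos a + 3^-1 *: pos b by rewrite E2 -addrA addrC.
split.
- by rewrite E2 lam_coef//; lra.
- by rewrite E3 lam_coef//; lra.
- by rewrite /x lam_coef//; lra.
Qed.

(** Take one triangle through x and a vertex at which the barycentric
    coordinate of x is not 0. *)
Lemma common_vertex x : closure Omega x ->
  exists v, forall L, hull (verts L) x -> v \in verts L.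
Proof.
move=> /closure_hull[K xK]; have [e [e0 e1 ex]] := xK.
have [v vK ev] : exists2 v, v \in verts K & e v != 0.
  apply: contrapT => h; have : \sum_(v in verts K) e v = 0.
    by apply: big1 => v vK; apply/eqP; apply: contrapT => /negP ev; apply: h; exists v.
  by rewrite e1 => /eqP; rewrite oner_eq0.
by exists v => L xL; apply: (support_common conf xK xL e1 ex vK ev).
Qed.

Definition star x : set plane := [set y | forall L, hull (verts L) y -> hull (verts L) x].

(** The triangles are closed and finite in number. *)
Lemma nbhs_star x : nbhs x (star x).
Proof.
have h := @filter_forall plane _ (fun L y => hull (verts L) y -> hull (verts L) x)
  (nbhs x) (nbhs_filter x); apply: h => L; have [h|h] := pselect (hull (verts L) x).
  by apply: nearW.
by apply: filterS (hull_closed h) => y hy /hy.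
Qed.

(** At a point of Omega a small ball does; at a boundary point a Lipschitz
    chart does. *)
Lemma locally_connected p (eps : R) : closure Omega p -> 0 < eps -> exists2 d : R, 0 < d &
  forall y1 y2, Omega y1 -> Omega y2 -> ball p d y1 -> ball p d y2 ->
  exists z1 z2, forall s : R, 0 <= s <= 1 ->
    [/\ (Omega `&` ball p eps) (y1 + s *: (z1 - y1)),
        (Omega `&` ball p eps) (z1 + s *: (z2 - z1)) &
        (Omega `&` ball p eps) (z2 + s *: (y2 - z2))].
Proof.
move=> cp eps0; have [Op|Op] := pselect (Omega p); last first.
  have fp : frontier Omega p by split=> // h; apply: Op; exact: interior_subset h.
  have [e [phi [r [e1 lip r0 ch]]]] := Olip fp.
  exact: chart_connected e1 lip r0 ch _ eps0.
have /nbhs_ballP[r /= r0 hr] : nbhs p Omega by exact: open_nbhs_nbhs.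
pose d := Num.min eps r; have d0 : 0 < d by rewrite lt_min eps0.
exists d => // y1 y2 O1 O2 b1 b2; exists y1, y2 => s s01.
have sub : ball p d `<=` Omega `&` ball p eps.
  move=> z bz; split; first by apply: hr; apply: le_ball bz; rewrite ge_min lexx orbT.
  by apply: le_ball bz; rewrite ge_min lexx.
split; apply: sub.
- by rewrite subrr scaler0 addr0.
- exact: ball_convex.
- by rewrite subrr scaler0 addr0.
Qed.

Lemma Omega_nonempty : Omega !=set0.
Proof. by case: Osc. Qed.

Lemma tri_of : exists f : plane -> triangle Th, forall x, closure Omega x -> hull (verts (f x)) x.
Proof.
have [x0 O0] := Omega_nonempty; have [K0 _] := closure_hull (subset_closure O0).
have ex x : exists K, closure Omega x -> hull (verts K) x.
  by have [/closure_hull[K h]|h] := pselect (closure Omega x); [exists K | exists K0].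
by have [f hf] := choice ex; exists f.
Qed.

(** The cocycle defines jumps between points of Omega, which are additive on
    the star of each point by common_vertex. The potential s K is the total
    jump along a path from a base point to an interior point of K: it is well
    defined because loops are null-homotopic. From K to L it changes by rho K L
    because, near a common vertex and even at the boundary, the two interiors
    are joined within the star of that vertex. *)
Theorem cocycle_split (V : zmodType) (rho : triangle Th -> triangle Th -> V) :
  (forall v K L N, v \in verts K -> v \in verts L -> v \in verts N ->
     rho K L + rho L N = rho K N) ->
  exists s : triangle Th -> V, forall v K L, v \in verts K -> v \in verts L ->
    rho K L = s L - s K.
Proof.
move=> hrho; have [T hT] := tri_of.
pose J x y := rho (T x) (T y).
have OT x : Omega x -> hull (verts (T x)) x by move=> Ox; apply/hT/subset_closure.
have Jstar p : closure Omega p -> additive_on J (star p `&` Omega).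
  move=> cp x y z [sx Ox] [sy Oy] [sz Oz]; have [v hv] := common_vertex cp.
  by apply: (hrho v); apply: hv; [apply/sx/OT | apply/sy/OT | apply/sz/OT].
have Jloc p : Omega p -> exists2 U, nbhs p U & additive_on J (U `&` Omega).
  by move=> Op; exists (star p); [exact: nbhs_star | apply/Jstar/subset_closure].
have [c hc] := choice inner_ex.
have Oc K : Omega (c K) by exact: inner_Omega (hc K).
have Tc K : T (c K) = K by exact: inner_eq (hc K) (OT _ (Oc K)).
have [_ Opc Osimp] := Osc.
have [x0 O0] := Omega_nonempty.
have conn x y : Omega x -> Omega y -> exists l, jump Omega J x y l.
  move=> Ox Oy; have [g [gO g0 g1]] := Opc x y Ox Oy.
  by have [l hl] := path_jump Jloc gO; exists l; rewrite -g0 -g1.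
have [s hs] := choice (fun K => conn x0 (c K) O0 (Oc K)).
exists s => v K L vK vL; set p := pos v.
have vhull N : v \in verts N -> hull (verts N) p.
  move=> vN; exists (fun u => (u == v)%:R); split=> [u||]; first exact: ler0n.
    rewrite (bigD1 v)//= eqxx big1 ?addr0// => u /andP[_ /negbTE ->] //.
  rewrite (bigD1 v)//= eqxx scale1r big1 ?addr0// => u /andP[_ /negbTE ->].
  by rewrite scale0r.
have cp : closure Omega p by apply: hull_closure (vhull K vK).
have /nbhs_ballP[eps /= eps0 heps] := nbhs_star p.
have [d d0 hd] := locally_connected cp eps0.
have innerS N x : v \in verts N -> inner N x -> (star p `&` Omega) x.
  move=> vN hx; split; last exact: inner_Omega hx.
  by move=> M hM; rewrite (inner_eq hx hM); apply: vhull.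
(* a point of the interior of N that is close to p *)
have close N : v \in verts N -> exists y, [/\ ball p d y, inner N y &
    forall t : R, 0 <= t <= 1 -> inner N (c N + t *: (y - c N))].
  move=> vN; pose w := `|(c N - p) 0 0| + `|(c N - p) 0 1|.
  have w0 : 0 <= w by rewrite addr_ge0.
  pose t := d / (d + w + 1).
  have D0 : 0 < d + w + 1 by lra.
  have tD : t * (d + w + 1) = d by rewrite divfK// gt_eqF.
  have t0 : 0 < t by rewrite divr_gt0.
  have t1 : t <= 1 by rewrite ler_pdivrMr// mul1r; lra.
  exists (p + t *: (c N - p)); split.
  - have tw : t * w < d by nra.
    apply/(plane_ballP _ _ d0); rewrite !segment_coord.
    have e (i : 'I_2) : `|p 0 i - (p 0 i + t * (c N 0 i - p 0 i))| = t * `|(c N - p) 0 i|.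
      rewrite opprD addNKr normrN normrM gtr0_norm//; congr (_ * `|_|).
      by rewrite !mxE.
    rewrite !e; split; apply: le_lt_trans tw; rewrite ler_pM2l// /w.
      by rewrite lerDl.
    by rewrite lerDr.
  - by apply: inner_segment (vhull N vN) (hc N) _; rewrite t0 t1.
  - move=> u /andP[u0 u1].
    have -> : c N + u *: (p + t *: (c N - p) - c N) =
        p + (1 - u * (1 - t)) *: (c N - p).
      by apply: eq_plane; rewrite !mxE; ring.
    by apply: inner_segment (vhull N vN) (hc N) _; apply/andP; split; nra.
have [y1 [b1 i1 seg1]] := close K vK; have [y2 [b2 i2 seg2]] := close L vL.
have [z1 [z2 hz]] := hd y1 y2 (inner_Omega i1) (inner_Omega i2) b1 b2.
have hball x : (Omega `&` ball p eps) x -> (star p `&` Omega) x.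
  by move=> [Ox bx]; split=> //; apply: heps.
have JP := Jstar p cp.
have seg (x y : plane) : (forall t : R, 0 <= t <= 1 -> (star p `&` Omega) (x + t *: (y - x))) ->
    jump Omega J x y (J x y).
  by move=> h; apply: (jump_segment JP) => t /h[sx Ox].
have z01 : 0 <= (0 : R) <= 1 by rewrite lexx ler01.
have z11 : 0 <= (1 : R) <= 1 by rewrite lexx ler01.
have m1 : jump Omega J (c K) y1 (J (c K) y1).
  by apply: seg => t t01; apply: innerS (seg1 t t01).
have m2 : jump Omega J y1 z1 (J y1 z1) by apply: seg => t /hz[h _ _]; exact: hball.
have m3 : jump Omega J z1 z2 (J z1 z2) by apply: seg => t /hz[_ h _]; exact: hball.
have m4 : jump Omega J z2 y2 (J z2 y2) by apply: seg => t /hz[_ _ h]; exact: hball.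
have m5 : jump Omega J y2 (c L) (J y2 (c L)).
  apply: seg => t /andP[t0 t1]; apply: (innerS L) => //.
  have -> : y2 + t *: (c L - y2) = c L + (1 - t) *: (y2 - c L).
    by apply: eq_plane; rewrite !mxE; ring.
  by apply: seg2; apply/andP; split; lra.
have IcK : (star p `&` Omega) (c K) by apply: innerS (hc K).
have IcL : (star p `&` Omega) (c L) by apply: innerS (hc L).
have Iy1 : (star p `&` Omega) y1 by apply: innerS i1.
have Iy2 : (star p `&` Omega) y2 by apply: innerS i2.
have Iz1 : (star p `&` Omega) z1.
  by apply: hball; have [_ h _] := hz 0 z01; rewrite scale0r addr0 in h.
have Iz2 : (star p `&` Omega) z2.
  by apply: hball; have [_ _ h] := hz 0 z01; rewrite scale0r addr0 in h.
have mKL : jump Omega J (c K) (c L) (rho K L).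
  have := jump_cat (jump_cat (jump_cat (jump_cat m1 m2) m3) m4) m5.
  rewrite !JP//; by rewrite /J !Tc.
have [l' hl'] := conn (c L) x0 (Oc L) O0.
have loop g : path_in Omega g -> g 0 = g 1 -> null_homotopic_in Omega g by exact: Osimp.
have e1 := loop_jump Jloc loop (jump_cat (hs L) hl').
have e2 := loop_jump Jloc loop (jump_cat (jump_cat (hs K) mKL) hl').
apply/eqP; rewrite eq_sym subr_eq eq_sym [_ + s K]addrC.
by apply/eqP; apply: (addIr l'); rewrite e1 e2.
Qed.

(** Consecutive points of a finely cut path lie in triangles with a common
    vertex. *)
Theorem triangles_connected (S : Type) (f : triangle Th -> S) :
  (forall v K L, v \in verts K -> v \in verts L -> f K = f L) ->
  forall K L, f K = f L.
Proof.
move=> hf K L; have [T hT] := tri_of.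
have OT x : Omega x -> hull (verts (T x)) x by move=> Ox; apply/hT/subset_closure.
have [x hx] := inner_ex K; have [y hy] := inner_ex L.
have Ox := inner_Omega hx; have Oy := inner_Omega hy.
have -> : K = T x by apply/esym; exact: inner_eq hx (OT _ Ox).
have -> : L = T y by apply/esym; exact: inner_eq hy (OT _ Oy).
have [_ Opc _] := Osc; have [g [gO g0 g1]] := Opc x y Ox Oy.
have /path_inP[cg hg] := gO.
have [|e e0 he] := @lebesgue_number R R [set s : R | 0 <= s <= 1]
  (fun B => forall s t, B s -> B t -> f (T (g s)) = f (T (g t))) (@compact01 R)
  (fun B C BC h s t Bs Bt => h s t (BC _ Bs) (BC _ Bt)) _; last first.
  have [j0 hj] := pow2_large e0; have := hj j0 (leqnn _).
  have : (0 < 2 ^ j0)%N by rewrite expn_gt0.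
  move: (2 ^ j0)%N => n n0 ne.
  have step i : (i <= n)%N -> f (T (g 0)) = f (T (g (i%:R / n%:R))).
    elim: i => [|i IH] hi; first by rewrite mul0r.
    rewrite IH ?(ltnW hi)//; apply: (he (i%:R / n%:R)); first exact/frac01/ltnW.
      by split; [exact: ballxx | exact/frac01/ltnW].
    split; last exact: frac01.
    rewrite /ball /= -mulrBl -addn1 natrD opprD addNKr normrM normrN normr1 mul1r.
    by rewrite ger0_norm ?invr_ge0.
  by have := step n (leqnn _); rewrite divff ?pnatr_eq0 -?lt0n// g0 g1.
move=> s hs; have Os := hg s hs.
have /within_continuous_ballP h := cg.
have [d d0 hd] := h s hs _ (nbhs_star (g s)); exists d => // t u [bt ht] [bu hu].
have [v hv] := common_vertex (subset_closure Os).
apply: (hf v); apply: hv.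
  by apply: (hd t ht bt); apply/OT/hg.
by apply: (hd u hu bu); apply/OT/hg.
Qed.

End MeshTopology.

(** * The finite element spaces *)

Section Spaces.
Variables (R : realType) (Th : mesh R) (Omega : set 'rV[R]_2).
Variable nu : {set vertex Th} -> 'rV[R]_2.
Hypotheses (conf : conforming_triangulation Th Omega) (Oopen : open Omega).
Hypotheses (Osc : simply_connected Omega) (Olip : lipschitz_domain Omega).
Hypothesis nuP : unit_normals nu.
Local Notation plane := 'rV[R]_2.
Local Notation pol := (mpoly 2 R).
Implicit Types (K L N : triangle Th) (a b v : vertex Th).
Implicit Types (u : triangle Th -> pol) (w : 'rV[pol]_2) (tau : 'M[pol]_2).

Lemma mderivmB_eval (al : multinom 2) (p q : pol) (x : plane) :
  peval (mderivm al (p - q)) x = peval (mderivm al p) x - peval (mderivm al q) x.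
Proof. by rewrite mderivmB pevalB. Qed.

Lemma flat_single_valued (n : nat) (r : int) u : r = n%:Z - 1 ->
  (forall v K L, v \in verts K -> v \in verts L -> flat (pos v) n (u K - u L)) <->
  (forall al : multinom 2, (mdeg al)%:Z <= r -> vertex_single_valued (fun K => mderivm al (u K))).
Proof.
move=> rE; split=> h.
  move=> al hal v K L vK vL; apply/eqP; rewrite -subr_eq0 -mderivmB_eval.
  by have /flat_cond -> := h v K L vK vL; [rewrite eqxx | lia].
move=> v K L vK vL; apply/flat_cond => al hal.
by rewrite mderivmB_eval (h al _ v K L)// ?subrr//; lia.
Qed.

Lemma edge_ends a b K : edge_of a b K -> [/\ a != b, a \in verts K & b \in verts K].
Proof.
move=> /andP[ab /fintype.subsetP h]; split=> //; apply: h; rewrite !inE eqxx ?orbT //.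
Qed.

Lemma edge_in a b K : a != b -> a \in verts K -> b \in verts K -> edge_of a b K.
Proof.
move=> ab aK bK; rewrite /edge_of ab; apply/fintype.subsetP => x.
by rewrite !inE => /orP[] /eqP ->.
Qed.

Lemma edge_neq a b K : edge_of a b K -> pos a != pos b.
Proof. by move=> /andP[ab _]; apply: vertex_neq conf _ _ ab. Qed.

Lemma single_valued_of_res (A : Type) (f : plane -> A -> pol) (j : int) (t : triangle Th -> A) :
  (forall a b K L, edge_of a b K -> edge_of a b L ->
     res (pos a) (pos b) (f (nu [set a; b]%SET) (t K)) =
     res (pos a) (pos b) (f (nu [set a; b]%SET) (t L))) ->
  edge_single_valued nu f j t.
Proof.
by move=> h a b K L eK eL q hq /=; apply: eq_edge_int; rewrite !resM (h a b K L eK eL).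
Qed.

Lemma res_of_single_valued (A : Type) (f : plane -> A -> pol) (J n : nat) (j : int)
    (t : triangle Th -> A) :
  j = J%:Z - 1 - 2 * n%:Z ->
  (forall a b K L, edge_of a b K -> edge_of a b L ->
     [/\ (msz (f (nu [set a; b]%SET) (t K) - f (nu [set a; b]%SET) (t L))%R <= J)%N,
       flat (pos a) n (f (nu [set a; b]%SET) (t K) - f (nu [set a; b]%SET) (t L)) &
       flat (pos b) n (f (nu [set a; b]%SET) (t K) - f (nu [set a; b]%SET) (t L))]) ->
  edge_single_valued nu f j t -> forall a b K L, edge_of a b K -> edge_of a b L ->
     res (pos a) (pos b) (f (nu [set a; b]%SET) (t K)) =
     res (pos a) (pos b) (f (nu [set a; b]%SET) (t L)).
Proof.
move=> jE h sv a b K L eK eL; have [h1 h2 h3] := h a b K L eK eL.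
apply: (moments_eq (edge_neq eK) jE h1 h2 h3) => q hq.
exact: sv eK eL q hq.
Qed.

Lemma normalE a b K : edge_of a b K -> exists2 s : R, s != 0 &
  (forall tau, bil (nu [set a; b]%SET) tau (nu [set a; b]%SET) = s ^+ 2 *: gtr (pos b - pos a) tau) /\
  (forall tau, tr2 (nu [set a; b]%SET) tau = s ^+ 3 *: ttr (pos b - pos a) tau).
Proof.
move=> eK; have [n1 nd] := nuP eK.
have [|s s1 ->] := unit_normalE n1 nd; first by rewrite subr_eq0 eq_sym (edge_neq eK).
exists s; first by apply: contra_eq_neq s1 => ->; rewrite expr0n mul0r eq_sym oner_neq0.
by split=> tau; [exact: bil_unit | exact: tr2_unit].
Qed.

Section Degrees.
Variables (m k : nat).
Hypothesis mk : (m.*2.+2 <= k)%N.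

(** The vertex values make differences flat at the ends of each edge, and the
    edge moments are then those of moments_eq. *)
Lemma Vcurl_char (w : {ffun triangle Th -> 'rV[pol]_2}) :
  Vcurl nu (k%:Z + 1) (m%:Z + 1, 0) w <->
  [/\ forall K i, (msz (w K 0%R i) <= k.+2)%N,
    forall i v K L, v \in verts K -> v \in verts L -> flat (pos v) m.+2 (w K 0 i - w L 0 i) &
    forall i a b K L, edge_of a b K -> edge_of a b L ->
      res (pos a) (pos b) (w K 0 i) = res (pos a) (pos b) (w L 0 i)].
Proof.
have k1 : k%:Z + 1 = k.+1%:Z by lia.
have hp i K : piecewise Th (fun z : 'rV[pol]_2 => z 0 i) w K = w K 0 i by rewrite ffunE.
split=> [h|[h1 h2 h3] i].
- have h1 K i : (msz (w K 0%R i) <= k.+2)%N.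
    by have [h1 _ _] := h i; have := h1 K; rewrite hp k1 deg_leE.
  have h2 i v K L : v \in verts K -> v \in verts L -> flat (pos v) m.+2 (w K 0 i - w L 0 i).
    have [_ h2 _] := h i; have := (@flat_single_valued m.+2 (m%:Z + 1)
      (fun K => piecewise Th (fun z : 'rV[pol]_2 => z 0 i) w K) _).2 h2 v K L.
    by rewrite !hp; apply; lia.
  split=> // i; have [_ _ h3] := h i.
  have := @res_of_single_valued _ (fun n p => iter 0 (dirder n) p) k.+2 m.+2 _
    (fun K => piecewise Th (fun z : 'rV[pol]_2 => z 0 i) w K) _ _ (h3 0%N _).
  move=> H a b K L eK eL; have := H _ _ _ a b K L eK eL; rewrite /= !hp; apply => //.
    by lia.
  move=> {eK eL}a {}b {}K {}L /edge_ends[_ aK bK] /edge_ends[_ aL bL]; rewrite !hp; split.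
  + by apply: mszB; apply: h1.
  + exact: h2.
  + exact: h2.
- split.
  + by move=> K; rewrite hp k1 deg_leE.
  + apply/(@flat_single_valued m.+2 (m%:Z + 1)) => [|v K L vK vL]; first by lia.
    by rewrite !hp; apply: h2.
  + move=> [|be] //= _; apply: single_valued_of_res => a b K L eK eL /=.
    by rewrite !hp; apply: h3 eK eL.
Qed.

(** The conditions of the divdiv space on tau itself, as opposed to those on
    its double divergence, in terms of jets and traces. *)
Definition divdiv_core (tau : triangle Th -> 'M[pol]_2) : Prop :=
  [/\ forall K, (tau K)^T = tau K, forall K i j, (msz (tau K i j) <= k.+1)%N,
    forall v K L, v \in verts K -> v \in verts L ->
      forall i j, flat (pos v) m.+1 ((tau K - tau L) i j) &
    forall a b K L, edge_of a b K -> edge_of a b L ->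
      res (pos a) (pos b) (gtr (pos b - pos a) (tau K)) =
        res (pos a) (pos b) (gtr (pos b - pos a) (tau L)) /\
      res (pos a) (pos b) (ttr (pos b - pos a) (tau K)) =
        res (pos a) (pos b) (ttr (pos b - pos a) (tau L))].

Lemma sub_entry (s t : 'M[pol]_2) i j : (s - t) i j = s i j - t i j.
Proof. by rewrite mxE [(- t) _ _]mxE. Qed.

Lemma Vdivdiv_char (r2 : int * int) (tau : {ffun triangle Th -> 'M[pol]_2}) :
  Vdivdiv nu k%:Z m%:Z r2 tau <->
  [/\ divdiv_core tau,
    forall al : multinom 2, Num.max (m%:Z - 1) 0 <= (mdeg al)%:Z -> (mdeg al)%:Z <= r2.1 ->
          vertex_single_valued (fun K => mderivm al (divdiv (tau K))) &
    forall i : nat, i%:Z <= r2.2 ->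
          edge_single_valued nu (fun n t => iter i (dirder n) (divdiv t))
            (k%:Z - 2 * (r2.1 + 2) + i%:Z) tau].
Proof.
split.
- move=> [h1 h2 [h3 h4 h5 h6 h7]]; split; [|exact: h4|exact: h7].
  have szt K i j : (msz (tau K i j) <= k.+1)%N by have := h2 K i j; rewrite deg_leE.
  have ft v K L : v \in verts K -> v \in verts L ->
      forall i j, flat (pos v) m.+1 ((tau K - tau L) i j).
    move=> vK vL i j; rewrite sub_entry.
    apply: (@flat_single_valued m.+1 m%:Z (fun K => tau K i j) _).2 v K L vK vL; first by lia.
    by move=> al hal; exact: (h3 al hal i j).
  have sb K L i j : (msz ((tau K - tau L) i j)%R <= k.+1)%N.
    by rewrite sub_entry; apply: mszB.
  split; [exact: h1|exact: szt|exact: ft|move=> a b K L eK eL].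
  have [s s0 [sE tE]] := normalE eK.
  have s2 : s ^+ 2 != 0 by rewrite expf_neq0.
  have s3 : s ^+ 3 != 0 by rewrite expf_neq0.
  split.
    apply: (scalerI s2); rewrite -!resZ -!sE.
    have E := @res_of_single_valued _ _ k.+1 m.+1 _ tau _ _ h5 a b K L eK eL.
    apply: E; first by lia.
    move=> a' b' K' L' {}eK {}eL; have [s' _ [{}sE _]] := normalE eK.
    have [_ aK bK] := edge_ends eK; have [_ aL bL] := edge_ends eL.
    rewrite !sE -scalerBr -gtrB; split.
    + by apply/mszZ/msz_bil.
    + by apply/flatZ/flat_bil; apply: ft.
    + by apply/flatZ/flat_bil; apply: ft.
  apply: (scalerI s3); rewrite -!resZ -!tE.
  have E := @res_of_single_valued _ _ k m _ tau _ _ h6 a b K L eK eL.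
  apply: E; first by lia.
  move=> a' b' K' L' {}eK {}eL; have [s' _ [_ {}tE]] := normalE eK.
  have [_ aK bK] := edge_ends eK; have [_ aL bL] := edge_ends eL.
  rewrite !tE -scalerBr -ttrB; split.
  + by apply/mszZ/msz_ttr.
  + by apply/flatZ/flat_ttr; apply: ft.
  + by apply/flatZ/flat_ttr; apply: ft.
- move=> [[h1 h2 h3 h4] h5 h6].
  split; [exact: h1|by move=> K i j; rewrite deg_leE|split; [|exact: h5| | |exact: h6]].
  + move=> al hal i j; apply: (@flat_single_valued m.+1 m%:Z (fun K => tau K i j) _).1 al hal.
      by lia.
    by move=> v K L vK vL; rewrite -sub_entry; apply: h3.
  + apply: single_valued_of_res => a b K L eK eL; have [s _ [sE _]] := normalE eK.
    by rewrite !sE !resZ (h4 a b K L eK eL).1.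
  + apply: single_valued_of_res => a b K L eK eL; have [s _ [_ tE]] := normalE eK.
    by rewrite !tE !resZ (h4 a b K L eK eL).2.
Qed.

Lemma msz_rt (al : plane) (c : R) (n : nat) (i : 'I_2) : (2 <= n)%N ->
  (msz (rt_field al c 0%R i) <= n)%N.
Proof.
move=> n2; rewrite rt_fieldE; apply: mszD; first by rewrite mszC//; lia.
by apply: mszZ; rewrite mszX.
Qed.

Lemma RT_sub : RT Th `<=` Vcurl nu (k%:Z + 1) (m%:Z + 1, 0).
Proof.
move=> _ [al [c ->]]; apply/Vcurl_char; split.
- by move=> K i; rewrite ffunE; apply: msz_rt.
- by move=> i v K L _ _; rewrite !ffunE subrr; exact: flat0.
- by move=> i a b K L _ _; rewrite !ffunE.
Qed.

Lemma res_wdot_eq (e x y : plane) w (z : 'rV[pol]_2) :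
  (forall i, res x y (w 0 i) = res x y (z 0 i)) -> res x y (wdot e w) = res x y (wdot e z).
Proof. by move=> h; rewrite /wdot !resD !resZ !h. Qed.

Lemma rv_subE w (z : 'rV[pol]_2) i : (w - z) 0 i = w 0 i - z 0 i.
Proof. by rewrite mxE [(- z) _ _]mxE. Qed.

Lemma symcurl_sub (r2 : int * int) (w : {ffun triangle Th -> 'rV[pol]_2}) :
  Vcurl nu (k%:Z + 1) (m%:Z + 1, 0) w -> Vdivdiv nu k%:Z m%:Z r2 (piecewise Th (@symcurl R) w).
Proof.
move=> /Vcurl_char[h1 h2 h3]; apply/Vdivdiv_char; split.
- split.
  + by move=> K; rewrite ffunE trmx_symcurl.
  + by move=> K i j; rewrite ffunE; apply: msz_symcurl.
  + move=> v K L vK vL i j; rewrite !ffunE -symcurlB; apply: flat_symcurl => l.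
    by rewrite rv_subE; apply: h2.
  + move=> a b K L eK eL; rewrite !ffunE !gtr_symcurl !ttr_symcurl !rmorphN /= -!deriv_res.
    have he e : res (pos a) (pos b) (wdot e (w K)) = res (pos a) (pos b) (wdot e (w L)).
      by apply: res_wdot_eq => i; exact: h3 eK eL.
    by rewrite !he.
- by move=> al _ _ v K L _ _; rewrite !ffunE !divdiv_symcurl.
- by move=> i _; apply: single_valued_of_res => a b K L _ _; rewrite !ffunE !divdiv_symcurl.
Qed.

Lemma divdiv_sub (r2 : int * int) (tau : {ffun triangle Th -> 'M[pol]_2}) :
  Vdivdiv nu k%:Z m%:Z r2 tau -> VL2 nu (k%:Z - 2) r2 (piecewise Th (@divdiv R) tau).
Proof.
move=> /Vdivdiv_char[[h1 h2 h3 _] h5 h6]; split.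
- move=> K; have -> : k%:Z - 2 = (k - 2)%N%:Z by lia.
  rewrite deg_leE ffunE divdivE; apply: mszD; apply: msz_mderiv; apply: mszD;
  by apply: msz_mderiv; apply: leq_trans (h2 K _ _) _; lia.
- move=> al hal; have [hm|hm] := boolP (Num.max (m%:Z - 1) 0 <= (mdeg al)%:Z).
    by move=> v K L vK vL; rewrite !ffunE; exact: (h5 al hm hal v K L vK vL).
  have hm' : (mdeg al)%:Z <= m.-1%:Z - 1 by move: hm; rewrite ge_max; lia.
  have E := @flat_single_valued m.-1 (m.-1%:Z - 1)
    (fun K => piecewise Th (@divdiv R) tau K) (erefl _).
  apply: (E.1 _ al hm') => v K L vK vL; rewrite !ffunE -divdivB divdivE; have fl i j := h3 v K L vK vL i j.
  have fl' i j : flat (pos v) m.-1.+2 ((tau K - tau L) i j) by apply: flat_le (fl i j); lia.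
  by do 2 (apply: flatD; apply: flat_mderiv).
- move=> be hbe a b K L eK eL q hq; rewrite !ffunE.
  apply: (h6 be hbe a b K L eK eL q).
  by rewrite (_ : k%:Z - 2 * (r2.1 + 2) + be%:Z = k%:Z - 2 - 2 * (r2.1 + 1) + be%:Z)//; ring.
Qed.

Lemma flat_rt (al : plane) (c : R) (x : plane) :
  (forall i, flat x 2 (rt_field al c 0 i)) -> al = 0 /\ c = 0.
Proof.
move=> h; have c0 : c = 0.
  have [_ h0 _] := h 0; have [] := flat_le (leqnn 1) h0.
  rewrite rt_fieldE mderivD mderivC mderivZ mderivXU /= add0r.
  by rewrite pevalZ pevalC mulr1.
split=> //; apply: eq_plane; rewrite mxE.
  by have [] := h 0; rewrite rt_fieldE c0 scale0r addr0 pevalC.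
by have [] := h 1; rewrite rt_fieldE c0 scale0r addr0 pevalC.
Qed.

(** On each triangle the field is in RT, and the single-valued jets of order
    one at a vertex determine an element of RT. *)
Lemma kernel_symcurl : exact_at id (piecewise Th (@symcurl R)) (RT Th)
  (Vcurl nu (k%:Z + 1) (m%:Z + 1, 0)).
Proof.
rewrite /exact_at image_id; apply/seteqP; split=> [w hw|w [hw /= w0]].
  split; first exact: RT_sub.
  have [al [c ->]] := hw; apply/ffunP => K; rewrite !ffunE; exact: symcurl_rt.
have wK K : symcurl (w K) = 0.
  by have := congr1 (fun f : {ffun triangle Th -> 'M[pol]_2} => f K) w0; rewrite !ffunE.
have ex K : exists r : plane * R, w K = rt_field r.1 r.2.
  by have [al [c h]] := symcurl_eq0 (wK K); exists (al, c).
have [f hf] := choice ex.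
have fc v K L : v \in verts K -> v \in verts L -> f K = f L.
  move=> vK vL; have /Vcurl_char[_ h2 _] := hw.
  have [|e1 e2] := @flat_rt ((f K).1 - (f L).1) ((f K).2 - (f L).2) (pos v).
    move=> i; rewrite rt_fieldD rt_fieldN -!hf rv_subE; apply: flat_le (h2 i v K L vK vL).
    by [].
  move: e1 e2 => /eqP; rewrite subr_eq0 => /eqP e1 /eqP; rewrite subr_eq0 => /eqP e2.
  by rewrite (surjective_pairing (f K)) (surjective_pairing (f L)) e1 e2.
have const := triangles_connected conf Osc Olip fc.
have [T _] := tri_of conf Osc; pose K0 := T 0.
exists (f K0).1, (f K0).2; apply/ffunP => K; rewrite ffunE hf (const K K0) //.
Qed.

(** The element of RT with the same value and divergence as w at x. *)
Definition rt_jet (x : plane) w : plane * R :=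
  (\row_i peval (w 0 i) x - peval (hdiv w) x *: x, peval (hdiv w) x).

Lemma rt_jetB x w (z : 'rV[pol]_2) : rt_jet x (w - z) = rt_jet x w - rt_jet x z.
Proof.
rewrite /rt_jet; congr pair; rewrite hdivD hdivN pevalB //.
by apply: eq_plane; rewrite !mxE !(pevalD, pevalN); ring.
Qed.

Definition rt_of (r : plane * R) : 'rV[pol]_2 := rt_field r.1 r.2.

Lemma rt_ofB r s : rt_of (r - s) = rt_of r - rt_of s.
Proof. by rewrite /rt_of /= rt_fieldD rt_fieldN. Qed.

Lemma flat_sub_rt_jet (n : nat) x w : (forall i j, flat x n.+1 (symcurl w i j)) ->
  forall i, flat x n.+2 ((w - rt_of (rt_jet x w)) 0 i).
Proof.
move=> h; apply: flat_of_symcurl.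
- by move=> i j; rewrite symcurlB symcurl_rt subr0.
- by move=> i; rewrite rv_subE pevalB rt_fieldE !pevalE /rt_jet /= !mxE; ring.
- by rewrite hdivD hdivN hdiv_rt pevalB pevalC subrr.
Qed.

(** The difference has a normal part with zero derivative and a tangential part
    with zero second derivative along the edge, and both are flat to order 2 at
    a. *)
Lemma edge_rt_jet a b w : pos a != pos b ->
  res (pos a) (pos b) (gtr (pos b - pos a) (symcurl w)) = 0 ->
  res (pos a) (pos b) (ttr (pos b - pos a) (symcurl w)) = 0 ->
  (forall i j, flat (pos a) 1 (symcurl w i j)) ->
  forall i, res (pos a) (pos b) ((w - rt_of (rt_jet (pos a) w)) 0 i) = 0.
Proof.
move=> ab g0 t0 fs; set D := w - _.
have sD : symcurl D = symcurl w by rewrite symcurlB symcurl_rt subr0.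
have fD : forall i, flat (pos a) 2 (D 0 i) by exact: flat_sub_rt_jet.
have uD (e : plane) : uflat 0 2 (res (pos a) (pos b) (wdot e D)).
  by apply/flat_res0/flat_wdot.
have z0 (r : {poly R}) : r^`() = 0 -> r.[0] = 0 -> r = 0.
  by move=> /deriv_eq0[c ->]; rewrite hornerC => ->.
have zN : res (pos a) (pos b) (wdot (rot90 (pos b - pos a)) D) = 0.
  apply: (z0); last by case: (uD (rot90 (pos b - pos a))).
  rewrite deriv_res; apply: oppr_inj; rewrite oppr0 -rmorphN /= -gtr_symcurl sD //.
have zd : res (pos a) (pos b) (wdot (pos b - pos a) D) = 0.
  have [d0 [d1 _]] := uD (pos b - pos a).
  apply: (z0) => //; apply: (z0) => //.
  by rewrite !deriv_res; apply: oppr_inj; rewrite oppr0 -rmorphN /= -ttr_symcurl sD.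
by move=> i; rewrite -comp_of_wdot// zN zd /comp_of !scaler0 addr0 scaler0.
Qed.

(** Both fields of RT agree along the edge with w to order 2 at b, where an
    element of RT with zero value and zero tangential derivative is zero. *)
Lemma rt_jet_ends a b w : pos a != pos b ->
  res (pos a) (pos b) (gtr (pos b - pos a) (symcurl w)) = 0 ->
  res (pos a) (pos b) (ttr (pos b - pos a) (symcurl w)) = 0 ->
  (forall i j, flat (pos a) 1 (symcurl w i j)) ->
  (forall i j, flat (pos b) 1 (symcurl w i j)) ->
  rt_jet (pos a) w = rt_jet (pos b) w.
Proof.
move=> ab g0 t0 fa fb; set d := pos b - pos a.
have L0 : dot d d != 0 by rewrite gt_eqF// dot_gt0// subr_eq0 eq_sym.
have za := edge_rt_jet ab g0 t0 fa.
have fD := flat_sub_rt_jet fb.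
set ra := rt_jet (pos a) w in za *; set rb := rt_jet (pos b) w in fD *.
pose r := rb - ra.
have zr i : uflat 1 2 (res (pos a) (pos b) (rt_of r 0 i)).
  have -> : rt_of r = (w - rt_of ra) - (w - rt_of rb) by rewrite /r rt_ofB opprB [RHS]addrC addrA subrK.
  rewrite rv_subE resB za sub0r; apply/uflatN/flat_res1; exact: fD.
have zw e : uflat 1 2 (res (pos a) (pos b) (wdot e (rt_of r))).
  by rewrite /wdot resD !resZ; apply: uflatD; apply: uflatZ.
have c0 : r.2 = 0.
  have [_ [+ _]] := zw d; rewrite deriv_res -/d /rt_of dirder_wdot_rt resC hornerC.
  by move=> /eqP; rewrite mulf_eq0 (negbTE L0) orbF => /eqP.
have a0 : r.1 = 0.
  have val i : r.1 0 i = 0.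
    by have [+ _] := zr i; rewrite res_at1 /rt_of rt_fieldE c0 scale0r addr0 pevalC.
  by apply: eq_plane; rewrite val mxE.
apply/eqP; rewrite eq_sym -subr_eq0 -/r; apply/eqP.
by rewrite (surjective_pairing r) a0 c0.
Qed.

(** Two local potentials differ, at a common vertex of their triangles, by a
    field of RT up to a flat remainder, and on a common edge both ends give the
    same field. These fields form a cocycle; cocycle_split corrects the
    potentials so that they match. *)
Lemma kernel_divdiv (r2 : int * int) : exact_at (piecewise Th (@symcurl R)) (piecewise Th (@divdiv R))
  (Vcurl nu (k%:Z + 1) (m%:Z + 1, 0)) (Vdivdiv nu k%:Z m%:Z r2).
Proof.
apply/seteqP; split=> [_ [w hw <-]|tau [htau /= d0]].
  split; first exact: symcurl_sub.
  by apply/ffunP => K; rewrite !ffunE divdiv_symcurl.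
have dK K : divdiv (tau K) = 0.
  by have := congr1 (fun f : {ffun triangle Th -> pol} => f K) d0; rewrite !ffunE.
have /Vdivdiv_char[[sy sz ft tr] _ _] := htau.
have [w hw] := choice (fun K => symcurl_exact (sy K) (dK K) (sz K)).
have wE K : symcurl (w K) = tau K by case: (hw K).
have wsz K i : (msz (w K 0%R i) <= k.+2)%N by case: (hw K).
pose rho K L := if [pick v | (v \in verts K) && (v \in verts L)] is Some v
  then rt_jet (pos v) (w K - w L) else 0.
have sE K L : symcurl (w K - w L) = tau K - tau L by rewrite symcurlB !wE.
have fs v K L : v \in verts K -> v \in verts L ->
    forall i j, flat (pos v) m.+1 (symcurl (w K - w L) i j).
  by move=> vK vL; rewrite sE; apply: ft.
have fs1 v K L : v \in verts K -> v \in verts L ->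
    forall i j, flat (pos v) 1 (symcurl (w K - w L) i j).
  by move=> vK vL i j; apply: flat_le (fs v K L vK vL i j).
have tr0 a b K L : edge_of a b K -> edge_of a b L ->
    res (pos a) (pos b) (gtr (pos b - pos a) (symcurl (w K - w L))) = 0 /\
    res (pos a) (pos b) (ttr (pos b - pos a) (symcurl (w K - w L))) = 0.
  move=> eK eL; have [h1 h2] := tr a b K L eK eL.
  by rewrite sE gtrB ttrB !resB h1 h2 !subrr.
have rhoE v K L : v \in verts K -> v \in verts L -> rho K L = rt_jet (pos v) (w K - w L).
  move=> vK vL; rewrite /rho; case: pickP => [u /andP[uK uL]|/(_ v)]; last by rewrite vK vL.
  have [->//|uv] := eqVneq u v.
  have [g0 t0] := tr0 u v K L (edge_in uv uK vK) (edge_in uv uL vL).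
  exact: rt_jet_ends (vertex_neq conf uv) g0 t0 (fs1 u K L uK uL) (fs1 v K L vK vL).
have [|s hs] := @cocycle_split _ _ _ conf Oopen Osc Olip _ rho _; last first.
  exists [ffun K => w K + rt_of (s K)]; last first.
    by apply/ffunP => K; rewrite !ffunE symcurlD symcurl_rt addr0 wE.
  have dE v K L : v \in verts K -> v \in verts L ->
      (w K + rt_of (s K)) - (w L + rt_of (s L)) =
      (w K - w L) - rt_of (rt_jet (pos v) (w K - w L)).
    move=> vK vL; rewrite -(rhoE v K L vK vL) (hs v K L vK vL) rt_ofB.
    by rewrite !opprD !opprK; apply/matrixP => i j; rewrite !mxE; ring.
  apply/Vcurl_char; split.
  + by move=> K i; rewrite ffunE mxE; apply: mszD => //; apply: msz_rt.
  + move=> i v K L vK vL; rewrite !ffunE -rv_subE (dE v K L vK vL).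
    exact/flat_sub_rt_jet/fs.
  + move=> i a b K L eK eL; apply/eqP; rewrite -subr_eq0 -resB !ffunE -rv_subE.
    have [ab aK bK] := edge_ends eK; have [_ aL bL] := edge_ends eL.
    have [g0 t0] := tr0 a b K L eK eL.
    rewrite (dE a K L aK aL); apply/eqP.
    exact: (edge_rt_jet (edge_neq eK) g0 t0 (fs1 a K L aK aL)).
move=> v K L N vK vL vN; rewrite !(rhoE v)// !rt_jetB.
by rewrite addrA subrK.
Qed.

(** The conditions of the divdiv space on the double divergence of tau are the
    ones that define the last space, so that divdiv_onto applies directly. *)
Lemma onto_divdiv (r2 : int * int) : m%:Z - 2 <= r2.1 ->
  exact_at (piecewise Th (@divdiv R)) (fun=> 0 : R) (Vdivdiv nu k%:Z m%:Z r2)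
   (VL2 nu (k%:Z - 2) r2).
Proof.
move=> hr; apply/seteqP; split=> [_ [tau htau <-]|u [hu _]].
  by split=> //; exact: divdiv_sub.
have [h1 h2 h3] := hu.
have su K : (msz (u K) <= k.-1)%N.
  have := h1 K; have -> : k%:Z - 2 = (k - 2)%N%:Z by lia.
  by rewrite deg_leE => h; apply: leq_trans h _; lia.
have [|tau [t1 t2 t3 t4 t5]] := @divdiv_onto _ _ _ conf m k u mk su.
  have E := @flat_single_valued m.-1 (m.-1%:Z - 1) u (erefl _).
  by apply: E.2 => al hal; apply: h2; lia.
exists [ffun K => tau K]; last by apply/ffunP => K; rewrite !ffunE t3.
apply/Vdivdiv_char; split.
- by split=> *; rewrite !ffunE; auto.
- by move=> al _ hal v K L vK vL; rewrite !ffunE !t3; exact: (h2 al hal v K L vK vL).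
- move=> i hi a b K L eK eL q hq; rewrite !ffunE !t3.
  apply: (h3 i hi a b K L eK eL q).
  by rewrite (_ : k%:Z - 2 - 2 * (r2.1 + 1) + i%:Z = k%:Z - 2 * (r2.1 + 2) + i%:Z)//; ring.
Qed.

End Degrees.
End Spaces.

(** * Exactness *)

Unset Implicit Arguments.

Theorem theorem5p11 (R : realType) (Omega : set 'rV[R]_2)
  (Th : mesh R) (nu : {set vertex Th} -> 'rV[R]_2)
  (r1v r2v r2e k : int) :
  open Omega -> bounded_set Omega -> simply_connected Omega ->
  lipschitz_domain Omega -> polygonal Omega ->
  conforming_triangulation Th Omega -> unit_normals nu ->
  0 <= r1v ->
  Num.max (r1v - 2) (-1) <= r2v -> Num.max (-1 - 2) (-1) <= r2e ->
  2 * r2e <= r2v ->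
  Num.max (2 * r1v + 2)
    (Num.max (2 * r2v + 3)
      (Num.max (3 * r2e + 6)
        (Num.max (6 * ((r2e == -1) && (r2v == 1))%:R)
          (4 * ((r2e == -1) && (r2v == 0))%:R)))) <= k ->
  let V1 := Vcurl nu (k + 1) (r1v + 1, 0) in
  let V2 := Vdivdiv nu k r1v (r2v, r2e) in
  let V3 := VL2 nu (k - 2) (r2v, r2e) in
  let d1 := piecewise Th (@symcurl R) in
  let d2 := piecewise Th (@divdiv R) in
  [/\ RT Th `<=` V1,
      d1 @` V1 `<=` V2,
      d2 @` V2 `<=` V3 &
  [/\ exact_at id d1 (RT Th) V1,
      exact_at d1 d2 V1 V2 &
      exact_at d2 (fun=> 0 : R) V2 V3]].
Proof.
move=> Oopen _ Osc Olip _ conf nuP.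
case: r1v => m hm; last by exfalso; move: hm.
move=> hr2v _ _; rewrite ge_max => /andP[hk _].
have hr : m%:Z - 2 <= r2v by move: hr2v; rewrite ge_max => /andP[].
case: k hk => [k|k] hk; last by exfalso; lia.
have mk : (m.*2.+2 <= k)%N by lia.
move=> V1 V2 V3 d1 d2; split.
- exact (RT_sub nu conf mk).
- by move=> _ [w hw <-]; exact: (symcurl_sub conf nuP mk).
- by move=> _ [tau htau <-]; exact: (divdiv_sub conf nuP mk).
- split.
  + exact (kernel_symcurl nu conf Osc Olip mk).
  + exact (kernel_divdiv conf Oopen Osc Olip nuP mk _).
  + exact (onto_divdiv conf nuP mk (r2 := (r2v, r2e)) hr).
Qed.
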